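(* Let $b$ be a non-constant quasi-extreme contractive multiplier of $H^2_d$, with AC states $\{\mu_\alpha\}_{\alpha\in\mathbb T}$, let $\mathbf X=(X_1,\dots,X_d)$ be the unique contractive solution to the Gleason problem in $\mathcal H(b)$, with associated functions $b_1,\dots,b_d\in\mathcal H(b)$, and let $\mathbf S^\alpha=(S_1^\alpha,\dots,S_d^\alpha)$ be the GNS tuple of $\mu_\alpha$ acting on $P^2(\mu_\alpha)$. For each $\alpha\in\mathbb T$ consider the rank-one perturbation $\mathbf Y^\alpha=(Y^\alpha_1,\dots,Y^\alpha_d)$ of $\mathbf X$ given by $$Y_j^\alpha=X_j+\alpha^*(1-\alpha^*b(0))^{-1}\,b_j\otimes k^b_0 ,\qquad j=1,\dots,d.$$ Then: (1) $\mathbf Y^\alpha$ is cyclic; it is isometric (as a column operator $\mathcal H(b)\to\mathcal H(b)^d$, i.e. $\sum_jY_j^{\alpha*}Y_j^\alpha=I$); and it is unitarily equivalent to $\mathbf S^{\alpha*}=(S_1^{\alpha*},\dots,S_d^{\alpha*})$ under the normalized NC Fantappiè transform $\mathcal V_\alpha:P^2(\mu_\alpha)\to\mathcal H(b)$: $$\mathcal V_\alpha S_j^{\alpha*}=\big(X_j+\alpha^*(1-\alpha^*b(0))^{-1}b_j\otimes k^b_0\big)\mathcal V_\alpha,\qquad j=1,\dots,d.$$ (2) If $\nu_\alpha$ is the unique extension of $\mu_\alpha$ to a state on $\mathcal A+\mathcal A^*$, then the GNS construction applied to $\nu_\alpha$ produces a Cuntz tuple $\mathbf U^\alpha$, which is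 unitarily equivalent to the minimal isometric dilation of $\mathbf S^\alpha$.
   Context: Fix an integer $d\ge 1$; $\mathbb B^d$ is the open unit ball of $\mathbb C^d$, $\mathbb T$ the unit circle, $\lambda^*$ denotes the complex conjugate of a scalar, and $zw^*=\sum_{j=1}^d z_jw_j^*$. $H^2_d$ (Drury–Arveson space) is the reproducing kernel Hilbert space on $\mathbb B^d$ with kernel $\frac1{1-zw^*}$. A contractive multiplier $b$ is a holomorphic function on $\mathbb B^d$ with $bf\in H^2_d$ and $\|bf\|\le\|f\|$ for all $f\in H^2_d$; $\mathcal H(b)$ is the reproducing kernel Hilbert space with kernel $k^b(z,w)=k^b_w(z)=\frac{1-b(z)b(w)^*}{1-zw^*}$. Write $(u\otimes v)h=\langle h,v\rangle u$. Operators: $\mathbb F_d^+$ is the free semigroup of finite words in $1,\dots,d$ (including the empty word); on $\ell^2(\mathbb F_d^+)$ with orthonormal basis $\{\xi_w\}$ put $L_i\xi_w=\xi_{iw}$, so $L_i^*L_j=\delta_{ij}I$. $\mathcal A$ is the norm-closed algebra generated by $I,L_1,\dots,L_d$. For $\mathbf n\in\mathbb N^d$ (nonnegative integers), $|\mathbf n|=\sum n_i$, $L^{(\mathbf n)}$ is the sum of all distinct words (products) in the $L_i$ containing exactly $n_i$ factors $L_i$ for each $i$; $L^{(\mathbf 0)}=I$. $\mathcal S\subset\mathcal A$ is the norm-closed linear span of all $L^{(\mathbf n)}$; $\mathcal S_0=\mathrm{span}\{L^{(\mathbf n)}:|\mathbf n|\ge1\}$; $\mathcal S^*,\mathcal A^*$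 are the sets of adjoints. Polynomials in $\mathcal S$ are finite linear combinations of the $L^{(\mathbf n)}$. Put $z\mathbf L^*=\sum_j z_jL_j^*$. A state on $\mathcal S+\mathcal S^*$ (or $\mathcal A+\mathcal A^*$) means a positive linear functional (not necessarily normalized), identified with its unique positive extension to the norm closure; the closures contain $q^*p$ for $p,q\in\mathcal S$ (respectively $p,q\in\mathcal A$). AC states: for $\alpha\in\mathbb T$, $\mu_\alpha$ is the unique state on $\mathcal S+\mathcal S^*$ with $$\frac{1+\alpha^*b(z)}{1-\alpha^*b(z)}=\mu_\alpha\big((I+z\mathbf L^* )(I-z\mathbf L^* )^{-1}\big)+i\,\mathrm{Im}\Big(\frac{1+\alpha^*b(0)}{1-\alpha^*b(0)}\Big),\quad z\in\mathbb B^d.$$ For a state $\mu$ on $\mathcal S+\mathcal S^*$, $P^2(\mu)$ is the Hilbert space obtained from $\mathcal S$ with the pre-inner product $\langle p,q\rangle=\mu(q^*p)$ by quotienting null vectors and completing; $[p]$ is the class of $p$. $P^2_0(\mu)$ is the closed span of $\{[p]:p\in\mathcal S_0\}$, with orthogonal projection $P_0:P^2(\mu)\to P_0^2(\mu)$. $\mu$ is quasi-extreme if $P_0^2(\mu)=P^2(\mu)$; $b$ is quasi-extreme if $\mu_1$ is, in which case every $\mu_\alpha$ is. The GNS tuple $\mathbf S=(S_1,\dots,S_d)$ of $\mu$ is the tuple on $P_0^2(\mu)$ (which equals $P^2(\mu)$ if $\mu$ is quasi-extreme) whose adjoints are the bounded operators with $S_j^*[p]=P_0[L_j^*p]$ for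 polynomials $p\in\mathcal S_0$. A quasi-extreme state has a unique extension to a state on $\mathcal A+\mathcal A^*$. $\mathcal V_\alpha$ is the unitary from $P^2(\mu_\alpha)$ onto $\mathcal H(\alpha^*b)=\mathcal H(b)$ extending $[p]\mapsto(1-\alpha^*b(z))\,\mu_\alpha((I-z\mathbf L^* )^{-1}p)$ for polynomials $p\in\mathcal S$. Gleason problem: a $d$-tuple of bounded operators $\mathbf X$ on $\mathcal H(b)$ is a contractive solution if $f(z)-f(0)=\sum_jz_j(X_jf)(z)$ for all $f\in\mathcal H(b)$ and $\sum_jX_j^*X_j\le I-k^b_0\otimes k^b_0$. For quasi-extreme $b$ it is unique, and $b_1,\dots,b_d\in\mathcal H(b)$ are the functions determined by $X_jk^b_w=w_j^*k^b_w-b(w)^*b_j$ for all $w\in\mathbb B^d$. GNS on $\mathcal A+\mathcal A^*$: for a state $\nu$, complete $\mathcal A$ modulo null vectors in $\langle a,c\rangle=\nu(c^*a)$; the GNS tuple is $\mathbf U=(U_1,\dots,U_d)$, $U_j[a]=[L_ja]$. A Cuntz tuple is a tuple with $U_i^*U_j=\delta_{ij}I$ and $\sum_jU_jU_j^*=I$. A tuple $\mathbf T$ on $H$ is a row contraction if $\sum T_jT_j^*\le I$. An isometric dilation of a row contraction $\mathbf T$ is a tuple $\mathbf V$ on $K\supset H$ with $V_i^*V_j=\delta_{ij}I$, $V_j^*H\subset H$, $V_j^*|_H=T_j^*$; it is minimal if $K=\bigvee_wV_wH$, where $V_w=V_{i_1}\cdots V_{i_m}$ for $w=i_1\cdots i_m$.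 The minimal isometric dilation exists and is unique up to unitary equivalence. A tuple $\mathbf T$ on $H$ is cyclic if there is $h\in H$ whose images $T_wh$, $w\in\mathbb F_d^+$, span a dense subspace of $H$. *)

(* Defs.v *)
From HB Require Import structures.
From mathcomp Require Import all_boot all_order all_algebra.
From mathcomp Require Import complex.
From mathcomp Require Import all_classical all_reals all_analysis.
Import Order.TTheory GRing.Theory Num.Theory.
Import numFieldNormedType.Exports.

Set Implicit Arguments.
Unset Strict Implicit.
Unset Printing Implicit Defensive.

Local Open Scope classical_set_scope.
Local Open Scope ring_scope.

(* Complex Hilbert spaces.  The scalars are [R[i]], and [Dot] makes the inner
   product linear in its first argument and conjugate-linear in its second.
   Norms take their (nonnegative real) values in [R[i]]. *)
HB.mixin Record isHilbert (R : realType) H of CompleteNormedModule R[i] H := {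
  inner : {dot H for (@Num.conj R[i])};
  inner_normE : forall x : H, `|x| ^+ 2 = inner x x
}.

#[short(type="hilbertType")]
HB.structure Definition Hilbert (R : realType) :=
  {H of isHilbert R H & CompleteNormedModule R[i] H}.

Section Span.
Context {R : realType} {V : lmodType R[i]}.

Definition span (A : set V) : set V :=
  [set x | exists (n : nat) (c : 'I_n -> R[i]) (a : 'I_n -> V),
    (forall i, A (a i)) /\ x = \sum_i c i *: a i].

Definition linear_closed (M : set V) : Prop :=
  M 0 /\ forall (a : R[i]) x y, M x -> M y -> M (a *: x + y).
End Span.

(* Operators are plain functions [H -> K], which form an lmodType pointwise;
   for linear maps boundedness is continuity. *)
Section Operators.
Context {R : realType}.
Implicit Types H K : hilbertType R.

Definition bounded_op H K (T : H -> K) : Prop := linear T /\ continuous T.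

(* A bounded [T] has exactly one such [S], by the Riesz theorem; where no
   such [S] exists, [adj T] is 0. *)
Definition adj H K (T : H -> K) : K -> H :=
  xget 0 [set S : K -> H | forall x y, inner (T x) y = inner x (S y)].

Definition opinv H (T : H -> H) : H -> H :=
  xget 0 [set S : H -> H | [/\ bounded_op S, T \o S = id & S \o T = id]].

Definition op_ge0 H (T : H -> H) : Prop := forall x, 0 <= inner (T x) x.

Definition op_le H (S T : H -> H) : Prop := op_ge0 (T - S).

Definition tens H K (u : K) (v : H) : H -> K := fun h => inner h v *: u.

(* Closure in operator norm, with || T - S || <= e spelled out. *)
Definition norm_closure H K (A : set (H -> K)) : set (H -> K) :=
  [set T | forall e : R[i], 0 < e ->
    exists2 S, A S & forall x, `|T x - S x| <= e * `|x|].

Definition unitary H K (U : H -> K) : Prop :=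
  [/\ linear U, forall x y, inner (U x) (U y) = inner x y &
      forall y, exists x, U x = y].

(* Meaningful for closed subspaces [M] only. *)
Definition oproj H (M : set H) : H -> H := fun x =>
  xget 0 [set y | M y /\ forall m, M m -> inner (x - y) m = 0].

Section Tuples.
Context {d : nat}.

Definition word_op H (T : 'I_d -> H -> H) (w : seq 'I_d) : H -> H :=
  foldr (fun i A => T i \o A) id w.

Definition row_contraction H (T : 'I_d -> H -> H) : Prop :=
  op_le (\sum_j (T j \o adj (T j))) (id : H -> H).

Definition column_isometric H (T : 'I_d -> H -> H) : Prop :=
  \sum_j (adj (T j) \o T j) = (id : H -> H).

Definition orthogonal_isometries H (T : 'I_d -> H -> H) : Prop :=
  forall i j, adj (T i) \o T j = (i == j)%:R *: (id : H -> H).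

Definition cuntz H (T : 'I_d -> H -> H) : Prop :=
  [/\ forall j, bounded_op (T j), orthogonal_isometries T &
      \sum_j (T j \o adj (T j)) = (id : H -> H)].

Definition cyclic_tuple H (T : 'I_d -> H -> H) : Prop :=
  exists h : H, dense (span [set word_op T w h | w in [set: seq 'I_d]]).

Definition unitarily_equivalent H K (T : 'I_d -> H -> H) (T' : 'I_d -> K -> K) :
    Prop :=
  exists W : H -> K, unitary W /\ forall j, W \o T j = T' j \o W.

(* [H] sits in [K] through the isometry [J]; the equation
   V_j^* J = J T_j^* says both V_j^* H \subset H and V_j^* | H = T_j^*. *)
Definition minimal_isometric_dilation H K (T : 'I_d -> H -> H)
    (J : H -> K) (V : 'I_d -> K -> K) : Prop :=
  [/\ (forall j, bounded_op (T j)) /\ row_contraction T,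
      linear J /\ (forall x y, inner (J x) (J y) = inner x y),
      (forall j, bounded_op (V j)) /\ orthogonal_isometries V,
      forall j, adj (V j) \o J = J \o adj (T j) &
      dense (span [set word_op V wh.1 (J wh.2) | wh in [set: seq 'I_d * H]])].
End Tuples.
End Operators.

(* A model of the Hilbert space of functions on [D] with kernel [k].  An
   element [f] is the function [rk_ev f], of which only the values on [D] are
   meaningful; [rk_ker w] is the kernel function k_w. *)
Record rkhs (R : realType) (T : Type) (D : set T) (k : T -> T -> R[i]) := Rkhs {
  rk_space :> hilbertType R;
  rk_ev : rk_space -> T -> R[i];
  rk_ker : T -> rk_space;
  rk_ev_linear : forall (a : R[i]) f g x, D x ->
    rk_ev (a *: f + g) x = a * rk_ev f x + rk_ev g x;
  rk_ev_inj : forall f, (forall x, D x -> rk_ev f x = 0) -> f = 0;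
  rk_kerE : forall x w, D x -> D w -> rk_ev (rk_ker w) x = k x w;
  rk_reproducing : forall f w, D w -> rk_ev f w = inner f (rk_ker w)
}.

Section BallFunctions.
Context {R : realType} {d : nat}.
Local Notation C := R[i].

Definition cdot (z w : 'rV[C]_d) : C := \sum_j z 0 j * (w 0 j)^*.

Definition cball : set 'rV[C]_d := [set z | cdot z z < 1].

Definition drury_arveson_kernel (z w : 'rV[C]_d) : C := (1 - cdot z w)^-1.

Definition db_kernel (b : 'rV[C]_d -> C) (z w : 'rV[C]_d) : C :=
  (1 - b z * (b w)^*) / (1 - cdot z w).

(* Stated for abstract normed spaces, whose topology is found by inference;
   that of a concrete ['rV[C]_d] is not. *)
Definition complex_differentiable (V W : normedModType C) (f : V -> W) (z : V) :
    Prop :=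
  differentiable f z.

Definition contractive_multiplier (H2 : rkhs cball drury_arveson_kernel)
    (b : 'rV[C]_d -> C) : Prop :=
  (forall z, cball z -> complex_differentiable (b : _ -> C^o) z) /\
  forall f : H2, exists2 g : H2,
    (forall z, cball z -> rk_ev g z = b z * rk_ev f z) & `|g| <= `|f|.

Definition nonconstant (b : 'rV[C]_d -> C) : Prop :=
  exists z w, [/\ cball z, cball w & b z <> b w].

Section Gleason.
Variables (b : 'rV[C]_d -> C) (Hb : rkhs cball (db_kernel b)).

Definition gleason_contractive_solution (X : 'I_d -> Hb -> Hb) : Prop :=
  [/\ forall j, bounded_op (X j),
      forall (f : Hb) z, cball z ->
        rk_ev f z - rk_ev f 0 = \sum_j z 0 j * rk_ev (X j f) z &
      op_le (\sum_j (adj (X j) \o X j)) (id - tens (rk_ker Hb 0) (rk_ker Hb 0))].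

Definition gleason_functions (X : 'I_d -> Hb -> Hb) (bs : 'I_d -> Hb) : Prop :=
  forall j w, cball w ->
    X j (rk_ker Hb w) = (w 0 j)^* *: rk_ker Hb w - (b w)^* *: bs j.
End Gleason.
End BallFunctions.

(* A model of l^2(F_d^+), determined up to a unitary preserving the xi_w.
   Words are sequences of letters, and iw is [i :: w]. *)
Record fock (R : realType) (d : nat) := Fock {
  fock_space :> hilbertType R;
  fock_xi : seq 'I_d -> fock_space;
  fock_xi_orthonormal : forall v w, inner (fock_xi v) (fock_xi w) = (v == w)%:R;
  fock_xi_total : dense (span (range fock_xi));
  fock_L : 'I_d -> fock_space -> fock_space;
  fock_L_bounded : forall i, bounded_op (fock_L i);
  fock_LE : forall i w, fock_L i (fock_xi w) = fock_xi (i :: w)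
}.

Section OperatorSystems.
Context {R : realType} {d : nat} (F : fock R d).
Local Notation C := R[i].
Local Notation L := (fock_L (f := F)).

Definition norm_closed_algebra (M : set (F -> F)) : Prop :=
  [/\ linear_closed M, forall S T, M S -> M T -> M (S \o T) &
      norm_closure M `<=` M].

Definition ncA : set (F -> F) :=
  smallest norm_closed_algebra ([set id] `|` range L).

(* A word with n_i letters i has length |n|. *)
Definition Lsym (n : 'I_d -> nat) : F -> F :=
  \sum_(w : (\sum_i n i)%N.-tuple 'I_d | [forall i, count_mem i w == n i])
    word_op L w.

Definition polyS : set (F -> F) := span (range Lsym).

Definition ncS : set (F -> F) := norm_closure polyS.

Definition polyS0 : set (F -> F) :=
  span [set Lsym n | n in [set n | (0 < \sum_i n i)%N]].

Definition opsys (M : set (F -> F)) : set (F -> F) :=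
  norm_closure [set T | exists A B, [/\ M A, M B & T = A + adj B]].

(* States are taken on the norm closure, to which they extend uniquely; the
   values of [mu] outside [opsys M] are irrelevant. *)
Definition is_state (M : set (F -> F)) (mu : (F -> F) -> C) : Prop :=
  (forall a S T, opsys M S -> opsys M T -> mu (a *: S + T) = a * mu S + mu T) /\
  (forall T, opsys M T -> op_ge0 T -> 0 <= mu T).

Definition zLstar (z : 'rV[C]_d) : F -> F := \sum_j z 0 j *: adj (L j).

Definition resolvent (z : 'rV[C]_d) : F -> F := opinv (id - zLstar z).

Definition cayley (c : C) : C := (1 + c) / (1 - c).

Definition ac_state (b : 'rV[C]_d -> C) (alpha : C) (mu : (F -> F) -> C) : Prop :=
  is_state ncS mu /\
  forall z, cball z ->
    cayley (alpha^* * b z) =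
      mu ((id + zLstar z) \o resolvent z) + 'i * 'Im (cayley (alpha^* * b 0)).

(* A completion of [M] modulo null vectors for the pre-inner product
   mu (q^* p), determined up to a unitary preserving the classes; [gns_cls]
   matters on [M] only. *)
Record gns_space (M : set (F -> F)) (mu : (F -> F) -> C) := GnsSpace {
  gns_sort :> hilbertType R;
  gns_cls : (F -> F) -> gns_sort;
  gns_cls_linear : forall (a : C) p q, M p -> M q ->
    gns_cls (a *: p + q) = a *: gns_cls p + gns_cls q;
  gns_cls_inner : forall p q, M p -> M q ->
    inner (gns_cls p) (gns_cls q) = mu (adj q \o p);
  gns_cls_dense : dense [set gns_cls p | p in M]
}.

Local Notation P2 := (gns_space ncS).

Definition P2_0 mu (P : P2 mu) : set P :=
  closure (span [set gns_cls P p | p in polyS0]).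
Arguments P2_0 {mu} P.

Definition quasi_extreme mu (P : P2 mu) : Prop := P2_0 P = setT.

(* An operator on P2_0 is represented by its extension by zero to P2, i.e. by
   an operator T of P2 with T = P_0 T P_0; for quasi-extreme [mu] this
   condition is void. *)
Definition P2_gns_tuple mu (P : P2 mu) (S : 'I_d -> P -> P) : Prop :=
  let P0 := oproj (P2_0 P) in
  forall j, [/\ bounded_op (S j), S j = P0 \o S j \o P0 &
    forall p, polyS0 p ->
      adj (S j) (gns_cls P p) = P0 (gns_cls P (adj (L j) \o p))].

Definition extends_state (mu nu : (F -> F) -> C) : Prop :=
  forall T, opsys ncS T -> nu T = mu T.

Definition gns_tuple nu (G : gns_space ncA nu) (U : 'I_d -> G -> G) : Prop :=
  forall j, bounded_op (U j) /\
    forall a, ncA a -> U j (gns_cls G a) = gns_cls G (L j \o a).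

Definition fantappie (b : 'rV[C]_d -> C) (Hb : rkhs cball (db_kernel b))
    (alpha : C) mu (P : P2 mu) (V : P -> Hb) : Prop :=
  unitary V /\
  forall p, polyS p -> forall z, cball z ->
    rk_ev (V (gns_cls P p)) z =
      (1 - alpha^* * b z) * mu (resolvent z \o p).
End OperatorSystems.

(* Sets being predicates, [F] would otherwise be implicit. *)
Arguments ncA {R d} F _.
Arguments ncS {R d} F _.

Notation P2 := (gns_space (ncS _)).

Record circle (R : realType) := Circle {
  circle_val :> R[i];
  circle_norm : `|circle_val| = 1
}.

Definition circle1 (R : realType) : circle R := Circle (normr1 R[i]).

Definition perturbation (R : realType) (d : nat) (b : 'rV[R[i]]_d -> R[i])
    (Hb : rkhs cball (db_kernel b)) (X : 'I_d -> Hb -> Hb) (bs : 'I_d -> Hb)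
    (alpha : R[i]) : 'I_d -> Hb -> Hb :=
  fun j => X j + (alpha^* / (1 - alpha^* * b 0)) *: tens (bs j) (rk_ker Hb 0).

(* Main.v *)
Require Import Defs.
From mathcomp Require Import all_boot all_order all_algebra.
From mathcomp Require Import complex ring.
From mathcomp Require Import all_classical all_reals all_analysis.
Import Order.TTheory GRing.Theory Num.Theory.
Import numFieldNormedType.Exports.

(** Write q_w for the inverse of I - sum_j w_j^* L_j and K_w for the kernel
    function k_w of H(b) divided by 1 - alpha b(w)^*.  The resolvent that defines
    the Fantappie transform V at the point w is the adjoint of q_w, so V is
    simply the unitary that sends the class [q_w] to K_w ([V_kerop]).  Through it
    the statement about the GNS tuple becomes a computation with kernel
    functions.

    Two identities carry that computation.  The perturbation satisfies
    Y_j (K_w - K_0) = w_j^* K_w ([perturbation_clark_diff]), and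
    <K_w - K_0, K_v - K_0> is sum_j w_j^* v_j <K_w, K_v> ([clark_gram]).  So the
    column Y is isometric as soon as the differences K_w - K_0 are total.  They
    are total exactly when mu_alpha is quasi-extreme ([quasi_extreme_clark]): the
    power series of q_w recovers every class [L^(n)] from the classes [q_w]
    ([cls_iter_rowop] separates the degrees, [Lsym_iter_row] the monomials of one
    degree).  This holds at alpha = 1 by hypothesis.  It holds at every alpha
    because Y at alpha is Y at 1 composed with a unitary that rotates the
    direction k_0 ([perturbation_rot], [clark_diffs_total]).  Finally S_j^* sends
    [q_w] - [I] to w_j^* [q_w] ([adjS_kerop]), which is the intertwining relation
    ([V_intertwines]).

    For cyclicity, S_j^* acts on the classes e_n = [L^(n)] as a backward shift,
    with an unknown value at e_0.  With at least two variables the failure of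
    commutation produces the vectors S_j^* e_0, and modulo these a rapidly
    decreasing sum of the e_n is cyclic, as for a backward shift
    ([cyclic_shift_gt1]).  In one variable S^* is isometric, so the Gram matrix of
    the e_n is Toeplitz, and conjugating coefficients shows that e_0 is cyclic
    ([cyclic_shift_1]).

    For the second part, the space P2(mu_alpha) embeds isometrically in the GNS
    space of nu, since nu extends mu_alpha.  There U is an isometric dilation of
    S, minimal because all classes of words come from [I] ([gns_dilation]), and
    quasi-extremality puts [I] in the closed span of the ranges of the U_j, so U
    is a Cuntz tuple ([gns_cuntz]).  Two minimal isometric dilations of the same
    tuple have the same Gram matrix on the vectors V_w J h, hence are unitarily
    equivalent ([dilation_unique]). *)

Set Implicit Arguments.
Unset Strict Implicit.
Unset Printing Implicit Defensive.

Local Open Scope classical_set_scope.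
Local Open Scope ring_scope.

Local Notation span := Defs.span.

Local Notation linear_closed := Defs.linear_closed.

(** * Linear maps, inner products and limits *)

Section LinearMaps.
Context {C : fieldType} {V W : lmodType C} (f : V -> W).
Hypothesis lf : linear f.

Lemma linP a x y : f (a *: x + y) = a *: f x + f y. Proof. exact: lf. Qed.
Lemma linD x y : f (x + y) = f x + f y.
Proof. by rewrite -[x]scale1r linP !scale1r. Qed.
Lemma lin0 : f 0 = 0.
Proof. by apply: (addrI (f 0)); rewrite -linD !addr0. Qed.
Lemma linZ a x : f (a *: x) = a *: f x.
Proof. by rewrite -[a *: x]addr0 linP lin0 !addr0. Qed.
Lemma linN x : f (- x) = - f x.
Proof. by rewrite -scaleN1r linZ scaleN1r. Qed.
Lemma linB x y : f (x - y) = f x - f y.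
Proof. by rewrite linD linN. Qed.
Lemma lin_sum (I : Type) (r : seq I) (p : pred I) (F : I -> V) :
  f (\sum_(i <- r | p i) F i) = \sum_(i <- r | p i) f (F i).
Proof. by apply: (big_morph f linD lin0). Qed.
End LinearMaps.

Lemma fun0E (U : Type) (V : zmodType) (x : U) : (0 : U -> V) x = 0.
Proof. by []. Qed.

Section Inner.
Context {R : realType} {H : hilbertType R}.
Local Notation C := R[i].
Implicit Types x y z : H.

Lemma innerDl x y z : inner (x + y) z = inner x z + inner y z.
Proof. exact: linearDl. Qed.
Lemma innerDr x y z : inner x (y + z) = inner x y + inner x z.
Proof. exact: linearDr. Qed.
Lemma innerNl x y : inner (- x) y = - inner x y.
Proof. exact: linearNl. Qed.
Lemma innerNr x y : inner x (- y) = - inner x y.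
Proof. exact: linearNr. Qed.
Lemma innerBl x y z : inner (x - y) z = inner x z - inner y z.
Proof. by rewrite innerDl innerNl. Qed.
Lemma innerBr x y z : inner x (y - z) = inner x y - inner x z.
Proof. by rewrite innerDr innerNr. Qed.
Lemma innerZl (a : C) x y : inner (a *: x) y = a * inner x y.
Proof. exact: linearZl_LR. Qed.
Lemma innerZr (a : C) x y : inner x (a *: y) = a^* * inner x y.
Proof. exact: linearZr_LR. Qed.
Lemma inner0l x : inner 0 x = 0. Proof. exact: linear0l. Qed.
Lemma inner0r x : inner x 0 = 0. Proof. exact: linear0r. Qed.
Lemma inner_suml (I : Type) (r : seq I) (p : pred I) (F : I -> H) y :
  inner (\sum_(i <- r | p i) F i) y = \sum_(i <- r | p i) inner (F i) y.
Proof.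
by apply: (big_morph (inner^~ y)) => [u v|]; rewrite ?innerDl ?inner0l.
Qed.
Lemma inner_sumr (I : Type) (r : seq I) (p : pred I) (F : I -> H) y :
  inner y (\sum_(i <- r | p i) F i) = \sum_(i <- r | p i) inner y (F i).
Proof.
by apply: (big_morph (inner y)) => [u v|]; rewrite ?innerDr ?inner0r.
Qed.
Lemma innerC x y : inner x y = (inner y x)^*.
Proof. by rewrite hermC /= expr0 mul1r. Qed.
Lemma inner_ge0 x : 0 <= inner x x.
Proof. by rewrite -inner_normE exprn_ge0. Qed.
Lemma inner_eq0 x : inner x x = 0 -> x = 0.
Proof.
by move/eqP; rewrite -inner_normE sqrf_eq0 normr_eq0 => /eqP.
Qed.
Lemma inner_eq x y : (forall z, inner x z = inner y z) -> x = y.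
Proof.
move=> h; apply/eqP; rewrite -subr_eq0; apply/eqP; apply: inner_eq0.
by rewrite innerBl h subrr.
Qed.
Lemma inner_eqr x y : (forall z, inner z x = inner z y) -> x = y.
Proof. by move=> h; apply: inner_eq => z; rewrite innerC h -innerC. Qed.

(** Pythagoras for the component of [z] orthogonal to [m]; both Cauchy-Schwarz
    and the minimality argument for projections read off a sign from it. *)
Lemma inner_residual z m : m != 0 ->
  inner (z - inner z m / inner m m *: m) (z - inner z m / inner m m *: m)
    = inner z z - `|inner z m| ^+ 2 / inner m m.
Proof.
move=> m0; have mm : inner m m != 0.
  by apply: contraNneq m0 => /inner_eq0 ->.
have mmR : (inner m m)^* = inner m m by rewrite -innerC.
rewrite innerBl !innerBr innerZl !innerZr innerZl rmorphM fmorphV /= mmR.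
by rewrite (innerC m z) normCK; field.
Qed.

Lemma CauchySchwarz_inner x y : `|inner x y| <= `|x| * `|y|.
Proof.
have [->|y0] := eqVneq y 0; first by rewrite inner0r !normr0 mulr0.
have yy : 0 < inner y y by rewrite -inner_normE exprn_gt0 // normr_gt0.
have := inner_ge0 (x - (inner x y / inner y y) *: y).
rewrite inner_residual // subr_ge0 => h.
rewrite -(ler_sqr (x := `|inner x y|)) ?nnegrE ?mulr_ge0 //.
by rewrite exprMn !inner_normE -ler_pdivrMr.
Qed.

Lemma parallelogram x y :
  `|x + y| ^+ 2 + `|x - y| ^+ 2 = 2 * `|x| ^+ 2 + 2 * `|y| ^+ 2.
Proof.
rewrite !inner_normE !(innerBl, innerDl, innerBr, innerDr); ring.
Qed.
End Inner.

Section Scalars.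
Context {R : realType}.
Local Notation C := R[i].

Lemma real_of_ge0 (e : C) : 0 <= e -> e = (complex.Re e)%:C%C.
Proof. by move=> e0; rewrite RRe_real // ger0_real. Qed.

Lemma Re_gt0 (e : C) : 0 < e -> 0 < complex.Re e.
Proof. by rewrite ltcE => /andP[]. Qed.

Lemma ltC_half (e : C) : 0 < e -> 0 < e / 2.
Proof. by move=> e0; rewrite divr_gt0 // ltr0Sn. Qed.

Lemma normB_eq0 (V : normedZmodType C) (x y : V) :
  (forall e : C, 0 < e -> `|x - y| <= e) -> x = y.
Proof.
move=> h; apply/eqP; rewrite -subr_eq0 -normr_eq0; apply/negP => /negP h0.
have p0 : 0 < `|x - y| by rewrite lt_def h0 normr_ge0.
have := h (`|x - y| / 2) (divr_gt0 p0 (ltr0Sn _ 1)).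
rewrite ler_pdivlMr ?ltr0Sn // -[leRHS]mulr1 ler_pM2l //.
by rewrite -[leRHS]/(1%:R) (ler_nat C 2 1).
Qed.

Lemma natV_small (e : C) : 0 < e -> exists n : nat, n.+1%:R^-1 < e.
Proof.
move=> e0; have r0 := Re_gt0 e0.
pose n := Num.Def.truncn (complex.Re e)^-1; exists n.
rewrite (real_of_ge0 (ltW e0)) -(rmorph_nat (real_complex R)) -fmorphV ltcR.
rewrite invf_plt ?posrE ?ltr0Sn //.
by have := truncnS_gt (complex.Re e)^-1.
Qed.

Lemma natV_le (n m : nat) : (n <= m)%N -> (m.+1%:R^-1 : C) <= n.+1%:R^-1.
Proof. by move=> nm; rewrite lef_pV2 ?posrE ?ltr0Sn // ler_nat ltnS. Qed.

Lemma expr_small (r e : C) : 0 <= r -> r < 1 -> 0 < e ->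
  exists n : nat, r ^+ n < e.
Proof.
move=> r0 r1 e0; rewrite (real_of_ge0 r0).
have [s0 s1] : 0 <= complex.Re r /\ `|complex.Re r| < 1.
  move: r1 r0; rewrite lecE ltcE /= => /andP[_ ?] /andP[_ h].
  by rewrite ger0_norm.
have /cvgrPdist_lt/(_ _ (Re_gt0 e0))[N _ /(_ N (leqnn N))] := cvg_expr s1.
rewrite sub0r normrN ger0_norm ?exprn_ge0 // => h; exists N.
by rewrite (real_of_ge0 (ltW e0)) -rmorphXn ltcR.
Qed.

End Scalars.

Section Convergence.
Context {R : realType} {H : hilbertType R}.
Local Notation C := R[i].

Lemma closureNP (A : set H) x :
  closure A x <-> forall e : C, 0 < e -> exists2 y, A y & `|x - y| < e.
Proof.
split=> [h e e0|h B].
  have [y [Ay By]] := h _ (nbhsx_ballx x e e0).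
  by exists y => //; move: By; rewrite -ball_normE.
move=> /nbhs_ballP[e /= e0 sB]; have [y Ay xy] := h e e0.
by exists y; split=> //; apply: sB; rewrite -ball_normE.
Qed.

Lemma denseNP (A : set H) :
  dense A <-> forall x (e : C), 0 < e -> exists2 y, A y & `|x - y| < e.
Proof.
split=> [h x e e0|h O [x Ox] oO].
  have [|y [By Ay]] := h (ball x e) _ (ball_open x e).
    by exists x; exact: ballxx.
  by exists y => //; move: By; rewrite -ball_normE.
have /nbhs_ballP[e /= e0 sO] := open_nbhs_nbhs (conj oO Ox).
have [y Ay xy] := h x e e0.
by exists y; split=> //; apply: sO; rewrite -ball_normE.
Qed.

Lemma dense_closure (A : set H) : dense A <-> forall x, closure A x.
Proof.
split=> [/denseNP h x|h]; first by apply/closureNP => e e0; exact: h.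
by apply/denseNP => x; apply/closureNP.
Qed.

Lemma cauchy_seq_cvg (u : nat -> H) :
  (forall e : C, 0 < e -> exists N, forall m n, (N <= m)%N -> (N <= n)%N ->
     `|u m - u n| < e) ->
  exists l, forall e : C, 0 < e -> exists N, forall n, (N <= n)%N -> `|u n - l| < e.
Proof.
move=> h; have : cauchy (u @ \oo).
  apply: cauchy_exP => e e0; have [N hN] := h e e0.
  exists (u N); exists N => // n /= Nn; rewrite -ball_normE /=.
  exact: hN.
move/cauchy_cvg => /cvg_ex[l /= /cvgrPdist_lt hl]; exists l => e e0.
have [N _ hN] := hl e e0; exists N => n Nn.
by rewrite distrC; apply: hN.
Qed.
End Convergence.

Section Bounded.
Context {R : realType} {H K : hilbertType R}.
Local Notation C := R[i].

(** The scalars are complex, so the condition [0 <= M] also says that the bound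
    [M] is real. *)
Definition bounded_by (T : H -> K) (M : C) := 0 <= M /\ forall x, `|T x| <= M * `|x|.

Lemma bounded_opP (T : H -> K) :
  bounded_op T <-> linear T /\ exists M, bounded_by T M.
Proof.
split=> [[lT cT]|[lT [M [M0 hM]]]]; split=> //.
  have /cvgrPdist_lt/(_ 1 ltr01)/nbhs_ballP[e /= e0 he] := cT 0.
  exists (2 / e); split=> [|x]; first by rewrite divr_ge0 ?ler0n // ltW.
  have [->|x0] := eqVneq x 0; first by rewrite (lin0 lT) !normr0 mulr0.
  have nx : 0 < `|x| by rewrite normr_gt0.
  pose a := e / 2 / `|x|.
  have a0 : 0 < a by rewrite divr_gt0 ?ltC_half.
  have : ball (0 : H) e (a *: x).
    rewrite -ball_normE /= sub0r normrN normrZ gtr0_norm // divfK ?gt_eqF //.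
    by rewrite ltr_pdivrMr ?ltr0Sn // mulr_natr mulr2n ltrDl.
  move/he; rewrite (lin0 lT) sub0r normrN (linZ lT) normrZ gtr0_norm //.
  rewrite -ltr_pdivlMl // mulr1 => /ltW/le_trans; apply.
  by rewrite /a !invf_div mulrC.
move=> x; apply/cvgrPdist_lt => e e0; apply/nbhs_ballP.
have M1 : 0 < M + 1 by rewrite ltr_wpDl.
exists (e / (M + 1)) => /=; first by rewrite divr_gt0.
move=> y; rewrite -ball_normE /= => xy.
rewrite -(linB lT) (le_lt_trans (hM _)) //.
rewrite (@le_lt_trans _ _ ((M + 1) * `|x - y|)) ?ler_wpM2r ?lerDl //.
by rewrite mulrC -ltr_pdivlMr.
Qed.
End Bounded.

(** * Orthogonal projection, Riesz representation and adjoints *)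

Section Spans.
Context {R : realType} {V : lmodType R[i]}.
Implicit Types (A M : set V).

Lemma span_lin A : linear_closed (span A).
Proof.
split=> [|a x y [n [c [u [Au ->]]]] [m [c' [u' [Au' ->]]]]].
  by exists 0%N, (fun=> 0), (fun=> 0); split=> [[]|] //; rewrite big_ord0.
exists (n + m)%N.
exists (fun i => match fintype.split i with inl j => a * c j | inr j => c' j end).
exists (fun i => match fintype.split i with inl j => u j | inr j => u' j end).
split=> [i|]; first by case: fintype.split.
rewrite big_split_ord /=; congr (_ + _).
  rewrite scaler_sumr; apply: eq_bigr => i _; rewrite scalerA.
  by rewrite -[lshift m i]/(unsplit (inl i)) unsplitK.
apply: eq_bigr => i _.
by rewrite -[rshift n i]/(unsplit (inr i)) unsplitK.
Qed.

Lemma span_in A x : A x -> span A x.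
Proof.
move=> Ax; exists 1%N, (fun=> 1), (fun=> x); split=> //.
by rewrite big_ord1 scale1r.
Qed.

Lemma lin_closedZ M a x : linear_closed M -> M x -> M (a *: x).
Proof. by move=> [M0 MP] Mx; rewrite -[_ *: _]addr0; apply: MP. Qed.
Lemma lin_closedD M x y : linear_closed M -> M x -> M y -> M (x + y).
Proof. by move=> [M0 MP] Mx My; rewrite -[x]scale1r; apply: MP. Qed.
Lemma lin_closedN M x : linear_closed M -> M x -> M (- x).
Proof. by move=> lM Mx; rewrite -scaleN1r; apply: lin_closedZ. Qed.
Lemma lin_closedB M x y : linear_closed M -> M x -> M y -> M (x - y).
Proof. by move=> lM Mx My; apply: lin_closedD => //; apply: lin_closedN. Qed.
Lemma lin_closed_sum M (I : Type) (r : seq I) (p : pred I) (F : I -> V) :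
  linear_closed M -> (forall i, p i -> M (F i)) ->
  M (\sum_(i <- r | p i) F i).
Proof.
move=> lM hF; apply: (big_ind M) => //; first by case: lM.
by move=> x y; apply: lin_closedD.
Qed.

Lemma span_min A M : linear_closed M -> A `<=` M -> span A `<=` M.
Proof.
move=> lM AM x [n [c [a [Aa ->]]]]; apply: lin_closed_sum => // i _.
by apply: lin_closedZ => //; apply: AM.
Qed.
End Spans.

Section ClosedSubspaces.
Context {R : realType} {H : hilbertType R}.
Local Notation C := R[i].
Implicit Types (A M : set H).

Definition closed_subspace M := linear_closed M /\ closure M `<=` M.

Lemma closure_lin M : linear_closed M -> linear_closed (closure M).
Proof.
move=> lM; split=> [|a x y /closureNP hx /closureNP hy].
  by apply: subset_closure; case: lM.
apply/closureNP => e e0.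
have a0 : 0 < `|a| + 1 by rewrite ltr_wpDl.
have [x' Mx' xx'] := hx (e / 2 / (`|a| + 1)) (divr_gt0 (ltC_half e0) a0).
have [y' My' yy'] := hy (e / 2) (ltC_half e0).
exists (a *: x' + y'); first by apply: lM.2.
rewrite opprD addrACA -scalerBr (le_lt_trans (ler_normD _ _)) //.
rewrite [ltRHS]splitr ltr_leD //; last exact: ltW.
rewrite normrZ (@le_lt_trans _ _ ((`|a| + 1) * `|x - x'|)) //.
  by rewrite ler_wpM2r // lerDl.
by rewrite mulrC -ltr_pdivlMr.
Qed.

Lemma cspan_closed A : closed_subspace (closure (span A)).
Proof.
split; first exact/closure_lin/span_lin.
by have /closure_id <- := @closed_closure _ (span A).
Qed.

Lemma cspan_in A x : A x -> closure (span A) x.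
Proof. by move=> Ax; apply/subset_closure/span_in. Qed.

Lemma cspan_min A M : closed_subspace M -> A `<=` M -> closure (span A) `<=` M.
Proof.
move=> [lM cM] AM; apply: (subset_trans _ cM).
by apply: closureS; exact: span_min.
Qed.

Lemma orthogonal_closed (A : set H) :
  closed_subspace [set x | forall a, A a -> inner x a = 0].
Proof.
split; first split=> [a _|a x y hx hy u Au] /=; first by rewrite inner0l.
  by rewrite innerDl innerZl hx // hy // mulr0 addr0.
move=> x /closureNP hx a Aa /=; apply/eqP/negP => /negP n0.
have e0 : 0 < `|inner x a| by rewrite normr_gt0.
have a0 : 0 < `|a| + 1 by rewrite ltr_wpDl.
have [y My] := hx _ (divr_gt0 e0 a0).
rewrite ltr_pdivlMr // => lt1.
have : `|inner x a| < `|inner x a|.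
  apply: le_lt_trans lt1; rewrite -[inner x a]subr0 -(My a Aa) -innerBl.
  by rewrite (le_trans (CauchySchwarz_inner _ _)) // ler_wpM2l // lerDl.
by rewrite ltxx.
Qed.

Lemma closed_limit M x : closed_subspace M ->
  (forall e : C, 0 < e -> exists2 y, M y & `|x - y| < e) -> M x.
Proof. by move=> [_ cM] h; apply: cM; apply/closureNP. Qed.

(** A minimizing sequence for the distance to [M] is Cauchy by the parallelogram
    law, since midpoints stay in [M]. *)
Lemma nearest_point M x : closed_subspace M ->
  exists2 y, M y & forall m, M m -> `|x - y| <= `|x - m|.
Proof.
move=> cM; have lM := cM.1.
pose D := [set complex.Re `|x - m| | m in M].
have hD m : `|x - m| = (complex.Re `|x - m|)%:C%C by apply: real_of_ge0.
have D0 m : 0 <= complex.Re `|x - m| by rewrite -ler0c -hD.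
have infD : has_inf D.
  split; first by exists (complex.Re `|x - 0|); exists 0 => //; case: lM.
  by exists 0 => _ [m _ <-].
pose delta := inf D; pose del := delta%:C%C : C.
have del0 : 0 <= del.
  rewrite ler0c; apply: lb_le_inf; first by case: infD.
  by move=> _ [m _ <-].
have del_le m : M m -> del <= `|x - m|.
  by move=> Mm; rewrite hD lecR; apply: ge_inf; [case: infD|exists m].
have ex (n : nat) : exists y, M y /\ `|x - y| < del + n.+1%:R^-1.
  have n0 : 0 < (n.+1%:R : R)^-1 by rewrite invr_gt0 ltr0Sn.
  have [_ [m Mm <-] lt1] := inf_adherent n0 infD; exists m; split=> //.
  by rewrite hD -(rmorph_nat (real_complex R)) -fmorphV -rmorphD ltcR.
have [y hy] := choice ex.
have [|l hl] := cauchy_seq_cvg (u := y).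
  move=> e e0.
  have d0 : 0 < 4 * (2 * del + 1) by rewrite mulr_gt0 ?ltr0Sn // ltr_wpDl ?mulr_ge0 ?ler0n.
  have [N hN] := natV_small (divr_gt0 (exprn_gt0 2 e0) d0).
  pose eta : C := N.+1%:R^-1.
  have eta0 : 0 < eta by rewrite invr_gt0 ltr0Sn.
  have eta1 : eta <= 1 by rewrite invf_le1 ?ltr0Sn // ler1n.
  have near_y n : (N <= n)%N -> `|x - y n| ^+ 2 <= (del + eta) ^+ 2.
    move=> Nn; rewrite lerXn2r ?nnegrE ?addr_ge0 ?normr_ge0 // 1?ltW //.
    by rewrite (lt_le_trans (hy n).2) // lerD2l natV_le.
  exists N => m n Nm Nn.
  rewrite -(ltr_pXn2r (n := 2)) ?nnegrE ?normr_ge0 ?(ltW e0) //.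
  have := parallelogram (x - y m) (x - y n).
  have -> : x - y m - (x - y n) = - (y m - y n).
    by rewrite opprB addrC addrA subrK opprB.
  rewrite normrN => /(canRL (addKr _)) ->.
  have half : (2 : C) * del <= `|x - y m + (x - y n)|.
    have -> : x - y m + (x - y n) = (2 : C) *: (x - (2^-1 : C) *: (y m + y n)).
      rewrite scalerBr scalerA mulfV ?pnatr_eq0 // scale1r scaler_nat mulr2n.
      by rewrite opprD addrACA.
    rewrite normrZ ger0_norm ?ler0n // ler_wpM2l ?ler0n //.
    apply: del_le; apply: lin_closedZ => //.
    by apply: lin_closedD => //; [case: (hy m)|case: (hy n)].
  have half2 : (2 * del) ^+ 2 <= `|x - y m + (x - y n)| ^+ 2.
    by rewrite lerXn2r ?nnegrE ?mulr_ge0 ?ler0n ?normr_ge0.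
  rewrite (@le_lt_trans _ _ (4 * (2 * del + 1) * eta)) //; last first.
    by rewrite mulrC -ltr_pdivlMr.
  rewrite (@le_trans _ _ (- (2 * del) ^+ 2 + (2 * (del + eta) ^+ 2 + 2 * (del + eta) ^+ 2))) //.
    by rewrite lerD ?lerN2 // lerD // ler_wpM2l ?ler0n ?near_y.
  rewrite -subr_ge0.
  have -> : 4 * (2 * del + 1) * eta - (- (2 * del) ^+ 2 +
     (2 * (del + eta) ^+ 2 + 2 * (del + eta) ^+ 2)) = 4 * eta * (1 - eta).
    by ring.
  by rewrite !mulr_ge0 ?ler0n ?subr_ge0 // ltW.
exists l.
  apply: (closed_limit cM) => e e0; have [N hN] := hl e e0.
  by exists (y N); [case: (hy N)|rewrite distrC; apply: hN].
move=> m Mm; apply: le_trans (del_le m Mm).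
suff h : forall e : C, 0 < e -> `|x - l| <= del + e.
  have xlR : `|x - l| \is Num.real by rewrite ger0_real.
  rewrite hD lecR; apply/ler_addgt0Pr => e e0.
  by rewrite -lecR rmorphD -hD; apply: h; rewrite ltcR.
move=> e e0; have [N1 h1] := natV_small (ltC_half e0).
have [N2 h2] := hl _ (ltC_half e0).
pose n := maxn N1 N2.
rewrite -(subrK (y n) x) -addrA (le_trans (ler_normD _ _)) //.
rewrite [e]splitr addrA lerD //; last by rewrite ltW // h2 // leq_maxr.
rewrite (le_trans (ltW (hy n).2)) // lerD2l (le_trans _ (ltW h1)) //.
by rewrite natV_le // leq_maxl.
Qed.

(** Moving the nearest point [y] along [m] by the optimal multiple would come
    closer to [x] if [x - y] were not orthogonal to [m]. *)
Lemma projection M x : closed_subspace M ->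
  exists2 y, M y & forall m, M m -> inner (x - y) m = 0.
Proof.
move=> cM; have lM := cM.1; have [y My hy] := nearest_point x cM.
exists y => // m Mm.
have [->|m0] := eqVneq m 0; first by rewrite inner0r.
have mm : 0 < inner m m by rewrite -inner_normE exprn_gt0 // normr_gt0.
have := hy _ (lin_closedD lM My (lin_closedZ (inner (x - y) m / inner m m) lM Mm)).
rewrite opprD addrA -(ler_pXn2r (n := 2)) ?nnegrE ?normr_ge0 // !inner_normE.
rewrite inner_residual //.
rewrite lerDl oppr_ge0 pmulr_lle0 ?invr_gt0 // => h.
by apply/eqP; rewrite -normr_eq0 -sqrf_eq0 eq_le h exprn_ge0.
Qed.

Lemma orthogonal_total (A : set H) :
  (forall x, (forall a, A a -> inner x a = 0) -> x = 0) ->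
  forall x, closure (span A) x.
Proof.
move=> hA x; have [y My hy] := projection x (cspan_closed A).
suff /eqP : x - y = 0 by rewrite subr_eq0 => /eqP ->.
by apply: hA => a Aa; apply/hy/cspan_in.
Qed.

Lemma total_orthogonal (A : set H) : (forall x, closure (span A) x) ->
  forall x, (forall a, A a -> inner x a = 0) -> x = 0.
Proof.
move=> hA x hx; apply: inner_eq0; rewrite innerC.
suff -> : inner x x = 0 by rewrite conjC0.
pose M := [set y | forall z, [set x] z -> inner y z = 0].
have sM : closure (span A) `<=` M.
  apply: cspan_min; first exact: orthogonal_closed.
  by move=> a Aa _ ->; rewrite innerC hx // conjC0.
exact: (sM x (hA x) x).
Qed.

(** The representing vector spans the orthogonal complement of the kernel. *)
Lemma riesz (phi : H -> C) (k : C) :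
  (forall a x y, phi (a *: x + y) = a * phi x + phi y) ->
  (forall x, `|phi x| <= k * `|x|) ->
  exists z, forall x, phi x = inner x z.
Proof.
move=> phiP phik.
have phi0 : phi 0 = 0.
  by apply/eqP; rewrite -normr_eq0 eq_le normr_ge0 (le_trans (phik _)) ?normr0 ?mulr0.
have phiZ a x : phi (a *: x) = a * phi x by rewrite -[_ *: _]addr0 phiP phi0 addr0.
have phiD x y : phi (x + y) = phi x + phi y by rewrite -[x]scale1r phiP mul1r scale1r.
have phiB x y : phi (x - y) = phi x - phi y by rewrite phiD -scaleN1r phiZ mulN1r.
pose M := [set x | phi x = 0].
have k0 x : phi x != 0 -> 0 < k.
  move=> px; have x0 : 0 < `|x|.
    by rewrite normr_gt0; apply: contraNneq px => ->; rewrite phi0.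
  have : 0 < k * `|x| by rewrite (lt_le_trans _ (phik x)) // normr_gt0.
  by rewrite pmulr_lgt0.
have cM : closed_subspace M.
  split; first by split=> [|a x y]; rewrite /M /= ?phi0 // phiP => -> ->; rewrite mulr0 addr0.
  move=> x /closureNP hx; rewrite /M /=; apply/eqP/negP => /negP px.
  have kp := k0 _ px.
  have [|y My] := hx (`|phi x| / k); first by rewrite divr_gt0 ?normr_gt0.
  rewrite ltr_pdivlMr // mulrC => h; have := le_lt_trans (phik (x - y)) h.
  by rewrite phiB My subr0 ltxx.
have [[x0 px0]|h] := pselect (exists x, phi x != 0); last first.
  exists 0 => x; rewrite inner0r; apply/eqP/negP => /negP px.
  by apply: h; exists x.
have [y0 My0 hy0] := projection x0 cM.
pose y := x0 - y0.
have py : phi y != 0 by rewrite phiB My0 subr0.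
have yy : inner y y != 0.
  apply: contraNneq py => /inner_eq0 ->; by rewrite phi0.
have yyR : (inner y y)^* = inner y y by rewrite -innerC.
exists ((phi y / inner y y)^* *: y) => x.
rewrite innerZr conjCK.
have Mz : M (x - phi x / phi y *: y) by rewrite /M /= phiB phiZ divfK // subrr.
have := hy0 _ Mz; rewrite innerBr innerZr -/y => /eqP; rewrite subr_eq0 => /eqP h.
have -> : inner x y = phi x / phi y * inner y y.
  by rewrite innerC h rmorphM /= conjCK yyR.
by field; rewrite py yy.
Qed.

End ClosedSubspaces.

Section Adjoint.
Context {R : realType}.
Implicit Types H K L : hilbertType R.

Lemma adj_exists H K (T : H -> K) : bounded_op T ->
  exists S : K -> H, forall x y, inner (T x) y = inner x (S y).
Proof.
move=> /bounded_opP[lT [M [M0 hM]]].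
suff /choice[S hS] : forall y, exists z, forall x, inner (T x) y = inner x z.
  by exists S => x y.
move=> y; apply: (@riesz _ _ _ (M * `|y|)) => [a u v|x].
  by rewrite lT innerDl innerZl.
by rewrite (le_trans (CauchySchwarz_inner _ _)) // mulrAC ler_wpM2r.
Qed.

Lemma adjP H K (T : H -> K) : bounded_op T ->
  forall x y, inner (T x) y = inner x (adj T y).
Proof.
move=> /adj_exists hT; rewrite /adj; case: xgetP => [S _ //|].
by case: hT => S hS /(_ S).
Qed.

Lemma adjPl H K (T : H -> K) : bounded_op T ->
  forall x y, inner (adj T y) x = inner y (T x).
Proof. by move=> bT x y; rewrite innerC -adjP // -innerC. Qed.

Lemma adj_unique H K (T : H -> K) (S : K -> H) :
  (forall x y, inner (T x) y = inner x (S y)) -> adj T = S.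
Proof.
move=> hS; apply/funext => y; apply: inner_eqr => x.
rewrite -hS /adj; case: xgetP => [S' _ /= <- //|].
by move/(_ S).
Qed.

Lemma adj_bounded H K (T : H -> K) M : linear T -> bounded_by T M ->
  bounded_by (adj T) M.
Proof.
move=> lT bM; have bT : bounded_op T by apply/bounded_opP; split=> //; exists M.
case: bM => M0 hM; split=> // y.
have [->|n0] := eqVneq (adj T y) 0; first by rewrite normr0 mulr_ge0.
have p0 : 0 < `|adj T y| by rewrite normr_gt0.
have h : 0 <= inner (T (adj T y)) y by rewrite adjP // inner_ge0.
rewrite -(ler_pM2l p0) -expr2 inner_normE -adjP // -(ger0_norm h).
rewrite (le_trans (CauchySchwarz_inner _ _)) //.
by rewrite mulrA [_ * M]mulrC ler_wpM2r.
Qed.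

Lemma adj_linear H K (T : H -> K) : bounded_op T -> linear (adj T).
Proof.
move=> bT a x y; apply: inner_eqr => z.
by rewrite -adjP // !(innerDr, innerZr) -!adjP.
Qed.

Lemma adj_bounded_op H K (T : H -> K) : bounded_op T -> bounded_op (adj T).
Proof.
move=> bT; have /bounded_opP[lT [M hM]] := bT.
apply/bounded_opP; split; first exact: adj_linear.
by exists M; apply: adj_bounded.
Qed.

Lemma adj_comp H K L (S : K -> L) (T : H -> K) : bounded_op S -> bounded_op T ->
  adj (S \o T) = adj T \o adj S.
Proof. by move=> bS bT; apply: adj_unique => x y /=; rewrite !adjP. Qed.

Lemma adjP_lin H K (S T : H -> K) a : bounded_op S -> bounded_op T ->
  adj (a *: S + T) = a^* *: adj S + adj T.
Proof.
move=> bS bT; apply: adj_unique => x y.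
by rewrite !fctE innerDl innerZl innerDr innerZr conjCK !adjP.
Qed.

Lemma adj_id H : adj (@id H) = id. Proof. exact: adj_unique. Qed.

Lemma bounded_comp H K L (S : K -> L) (T : H -> K) :
  bounded_op S -> bounded_op T -> bounded_op (S \o T).
Proof.
move=> /bounded_opP[lS [M [M0 hM]]] /bounded_opP[lT [N [N0 hN]]].
apply/bounded_opP; split=> [a x y|]; first by rewrite /= lT lS.
exists (M * N); split; first exact: mulr_ge0.
by move=> x /=; rewrite (le_trans (hM _)) // -mulrA ler_wpM2l.
Qed.

Lemma bounded_id H : bounded_op (@id H).
Proof.
apply/bounded_opP; split=> //; exists 1; split=> [|x]; first exact: ler01.
by rewrite mul1r.
Qed.

Lemma bounded_lin_closed H K : linear_closed [set T : H -> K | bounded_op T].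
Proof.
split=> [|a S T /= /bounded_opP[lS [M [M0 hM]]] /bounded_opP[lT [N [N0 hN]]]].
  apply/bounded_opP; split=> [a x y|].
    by change (0 = a *: (0 : K) + 0); rewrite scaler0 addr0.
  by exists 0; split=> // x; change (`|0 : K| <= 0 * `|x|); rewrite normr0 mul0r.
apply/bounded_opP; split=> [c x y|].
  by rewrite !fctE lS lT !scalerDr !scalerA [a * c]mulrC addrACA.
exists (`|a| * M + N); split; first by rewrite addr_ge0 // mulr_ge0.
move=> x; rewrite !fctE (le_trans (ler_normD _ _)) // normrZ mulrDl.
by rewrite lerD // -mulrA ler_wpM2l.
Qed.

End Adjoint.

(** * Isometries, total sets and Neumann inversion *)

Section ClosedSets.
Context {R : realType}.
Local Notation C := R[i].
Implicit Types H K : hilbertType R.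

Lemma closed_subspace_preimage H K (T : H -> K) (M : set K) :
  bounded_op T -> closed_subspace M -> closed_subspace [set x | M (T x)].
Proof.
move=> /bounded_opP[lT [k [k0 hk]]] cM; split.
  split=> [|a x y] /=; first by rewrite (lin0 lT); case: cM.1.
  by rewrite lT => hx hy; apply: cM.1.2.
move=> x /closureNP hx /=; apply: (closed_limit cM) => e e0.
have k1 : 0 < k + 1 by rewrite ltr_wpDl.
have [y My xy] := hx _ (divr_gt0 e0 k1).
exists (T y) => //; rewrite -(linB lT) (le_lt_trans (hk _)) //.
rewrite (@le_lt_trans _ _ ((k + 1) * `|x - y|)) ?ler_wpM2r ?lerDl //.
by rewrite mulrC -ltr_pdivlMr.
Qed.

Lemma set0_closed H : closed_subspace [set (0 : H)].
Proof.
split; first by split=> // a x y /= -> ->; rewrite scaler0 addr0.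
move=> x /closureNP hx /=; apply: normB_eq0 => e e0.
by have [_ -> /ltW] := hx e e0.
Qed.

Lemma bounded_eq H K (S T : H -> K) (A : set H) :
  bounded_op S -> bounded_op T -> (forall x, closure (span A) x) ->
  (forall a, A a -> S a = T a) -> S = T.
Proof.
move=> bS bT tA hA; apply/funext => x.
have bST : bounded_op (-1 *: T + S) by apply: (bounded_lin_closed H K).2.
have cM := closed_subspace_preimage bST (@set0_closed K).
have sM : A `<=` [set x | [set (0 : K)] ((-1 *: T + S) x)].
  by move=> a Aa; rewrite /= !fctE hA // scaleN1r addNr.
have := cspan_min cM sM (tA x); rewrite /= !fctE scaleN1r addrC => /eqP.
by rewrite subr_eq0 => /eqP.
Qed.

Lemma isometry_norm H K (J : H -> K) :
  (forall x y, inner (J x) (J y) = inner x y) -> forall x, `|J x| = `|x|.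
Proof.
move=> hJ x; apply/eqP; rewrite -(eqrXn2 (n := 2)) ?normr_ge0 //.
by rewrite !inner_normE hJ.
Qed.

Lemma isometry_bounded H K (J : H -> K) : linear J ->
  (forall x y, inner (J x) (J y) = inner x y) -> bounded_op J.
Proof.
move=> lJ hJ; apply/bounded_opP; split=> //; exists 1; split=> [|x].
  exact: ler01.
by rewrite mul1r isometry_norm.
Qed.

(** The defect of [J] on pairs is a sesquilinear form that vanishes on the
    diagonal; testing it on [x + y] and on [x + i y] kills it. *)
Lemma polarization H K (J : H -> K) : linear J -> (forall x, `|J x| = `|x|) ->
  forall x y, inner (J x) (J y) = inner x y.
Proof.
move=> lJ nJ x y.
have nn z : inner (J z) (J z) = inner z z by rewrite -!inner_normE nJ.
pose D u v := inner (J u) (J v) - inner u v.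
have E a : a^* * D x y + a * D y x = 0.
  have := nn (x + a *: y); rewrite (linD lJ) (linZ lJ) !innerDl !innerDr.
  rewrite !innerZl !innerZr !nn => h; rewrite /D.
  move/eqP: h; rewrite -subr_eq0 => /eqP <-; ring.
have := E 1; rewrite conjC1 !mul1r => /eqP; rewrite addr_eq0 => /eqP e1.
have := E 'i; rewrite conjCi mulNr e1 mulrN opprK -mulr2n => /eqP.
rewrite mulrn_eq0 /= mulf_eq0 (negPf (neq0Ci _)) /= => /eqP D0.
by apply/eqP; rewrite -subr_eq0 -/(D x y) e1 D0 oppr0.
Qed.

Lemma bounded_below_range_closed H K (J : H -> K) (c : C) : bounded_op J -> 0 < c ->
  (forall x, c * `|x| <= `|J x|) -> closed_subspace (range J).
Proof.
move=> /bounded_opP[lJ [M [M0 hM]]] c0 cJ; split.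
  split; first by exists 0 => //; exact: lin0.
  by move=> a _ _ [x _ <-] [y _ <-]; exists (a *: x + y) => //; exact: lJ.
move=> y /closureNP hy.
have ex (n : nat) : exists x, `|y - J x| < n.+1%:R^-1.
  have [|_ [x _ <-] h] := hy (n.+1%:R^-1); first by rewrite invr_gt0 ltr0Sn.
  by exists x.
have [x hx] := choice ex.
have [|l hl] := cauchy_seq_cvg (u := x).
  move=> e e0; have [N hN] := natV_small (ltC_half (mulr_gt0 c0 e0)).
  exists N => m n Nm Nn; rewrite -(ltr_pM2l c0) (le_lt_trans (cJ _)) //.
  rewrite (linB lJ) -(subrK y (J (x m))) -addrA (le_lt_trans (ler_normD _ _)) //.
  rewrite distrC [ltRHS]splitr ltrD //.
    by rewrite (lt_le_trans (hx _)) // (le_trans (natV_le Nm)) // ltW.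
  by rewrite (lt_le_trans (hx _)) // (le_trans (natV_le Nn)) // ltW.
exists l => //; apply/esym/normB_eq0 => e e0.
have M1 : 0 < M + 1 by rewrite ltr_wpDl.
have [N1 h1] := natV_small (ltC_half e0).
have [N2 h2] := hl _ (divr_gt0 (ltC_half e0) M1).
pose n := maxn N1 N2; rewrite -(subrK (J (x n)) y) -addrA.
rewrite (le_trans (ler_normD _ _)) // [e]splitr lerD //.
  rewrite (le_trans (ltW (hx n))) // (le_trans _ (ltW h1)) //.
  by rewrite natV_le // leq_maxl.
rewrite -(linB lJ) (le_trans (hM _)) //.
rewrite (@le_trans _ _ ((M + 1) * `|x n - l|)) ?ler_wpM2r ?lerDl //.
by rewrite mulrC -ler_pdivlMr // ltW // h2 // leq_maxr.
Qed.

Lemma isometry_range_closed H K (J : H -> K) : linear J ->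
  (forall x y, inner (J x) (J y) = inner x y) -> closed_subspace (range J).
Proof.
move=> lJ iJ; apply: (bounded_below_range_closed (isometry_bounded lJ iJ) ltr01) => x.
by rewrite mul1r isometry_norm.
Qed.

Lemma isometry_unitary H K (J : H -> K) (A : set K) : linear J ->
  (forall x y, inner (J x) (J y) = inner x y) ->
  (forall y, closure (span A) y) -> A `<=` range J -> unitary J.
Proof.
move=> lJ iJ tA AJ; split=> // y.
have cR := isometry_range_closed lJ iJ.
by have [x _ <-] := cspan_min cR AJ (tA y); exists x.
Qed.

(** A linear combination and its image have the same norm, computed from the
    same Gram matrix.  So the closure of the span of the pairs [(e i, g i)] is
    the graph of an isometry; working with that graph avoids choosing
    coefficients. *)
Lemma gram_isometry H K (I : Type) (e : I -> H) (g : I -> K) :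
  (forall i j, inner (e i) (e j) = inner (g i) (g j)) ->
  (forall x, closure (span (range e)) x) ->
  exists J : H -> K, [/\ linear J, forall x y, inner (J x) (J y) = inner x y &
    forall i, J (e i) = g i].
Proof.
move=> eg te.
pose G := span (range (fun i => (e i, g i))) : set (H * K)%type.
have lG : linear_closed G by exact: span_lin.
have fstE n (c : 'I_n -> C) (a : 'I_n -> H * K) :
    (\sum_i c i *: a i).1 = \sum_i c i *: (a i).1.
  by rewrite (raddf_sum (fst : {additive H * K -> H})).
have sndE n (c : 'I_n -> C) (a : 'I_n -> H * K) :
    (\sum_i c i *: a i).2 = \sum_i c i *: (a i).2.
  by rewrite (raddf_sum (snd : {additive H * K -> K})).
have nG p : G p -> `|p.1| = `|p.2|.
  move=> [n [c [a [Ga ->]]]]; apply/eqP.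
  rewrite -(eqrXn2 (n := 2)) ?normr_ge0 // !inner_normE fstE sndE; apply/eqP.
  rewrite !inner_suml; apply: eq_bigr => i _; rewrite !inner_sumr.
  apply: eq_bigr => j _; rewrite !innerZl !innerZr.
  by have [[k _ <-] [l _ <-]] := (Ga i, Ga j); rewrite /= eg.
have GB p q : G p -> G q -> `|p.1 - q.1| = `|p.2 - q.2|.
  by move=> Gp Gq; have := nG _ (lin_closedB lG Gp Gq).
have exG x (eps : C) : 0 < eps -> exists2 p, G p & `|x - p.1| < eps.
  move=> e0; have /closureNP/(_ eps e0)[_ [n [c [a [Ga ->]]]] lt1] := te x.
  have /choice[k hk] : forall i, exists k, a i = e k.
    by move=> i; have [k _ <-] := Ga i; exists k.
  exists (\sum_i c i *: (e (k i), g (k i))).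
    by exists n, c, (fun i => (e (k i), g (k i))); split=> // i; exists (k i).
  by rewrite fstE /=; under eq_bigr do rewrite -hk.
pose rel x y := forall eps : C, 0 < eps ->
  exists p, [/\ G p, `|x - p.1| < eps & `|y - p.2| < eps].
have relN x y : rel x y -> `|x| = `|y|.
  move=> h; apply: normB_eq0 => eps e0.
  have [p [Gp h1 h2]] := h _ (ltC_half e0).
  have -> : `|x| - `|y| = (`|x| - `|p.1|) + (`|p.2| - `|y|).
    by rewrite (nG p Gp) addrA subrK.
  rewrite (le_trans (ler_normD _ _)) // [eps]splitr lerD //.
    by rewrite (le_trans (ler_dist_dist _ _)) // ltW.
  by rewrite (le_trans (ler_dist_dist _ _)) // distrC ltW.
have relP a x y x' y' : rel x y -> rel x' y' -> rel (a *: x + x') (a *: y + y').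
  move=> h h' eps e0; have a1 : 0 < `|a| + 1 by rewrite ltr_wpDl.
  have [p [Gp h1 h2]] := h _ (divr_gt0 (ltC_half e0) a1).
  have [q [Gq h1' h2']] := h' _ (ltC_half e0).
  have bnd (V : normedModType C) (u u' v v' : V) :
      `|u - v| < eps / 2 / (`|a| + 1) -> `|u' - v'| < eps / 2 ->
      `|a *: u + u' - (a *: v + v')| < eps.
    move=> k1 k2; rewrite opprD addrACA -scalerBr (le_lt_trans (ler_normD _ _)) //.
    rewrite [ltRHS]splitr ltr_leD // ?(ltW k2) //.
    rewrite normrZ (@le_lt_trans _ _ ((`|a| + 1) * `|u - v|)) ?ler_wpM2r ?lerDl //.
    by rewrite mulrC -ltr_pdivlMr.
  by exists (a *: p + q); split; [apply: lG.2|apply: bnd|apply: bnd].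
have exrel x : exists y, rel x y.
  have ex (n : nat) : exists p, G p /\ `|x - p.1| < n.+1%:R^-1.
    have [|p Gp h] := exG x (n.+1%:R^-1); first by rewrite invr_gt0 ltr0Sn.
    by exists p.
  have [p hp] := choice ex.
  have [|l hl] := cauchy_seq_cvg (u := fun n => (p n).2).
    move=> eps e0; have [N hN] := natV_small (ltC_half e0).
    exists N => m n Nm Nn; rewrite -GB ?(hp _).1 //; [|exact: (hp m).1|exact: (hp n).1].
    rewrite -(subrK x (p m).1) -addrA (le_lt_trans (ler_normD _ _)) //.
    rewrite distrC [ltRHS]splitr ltrD //.
      by rewrite (lt_le_trans (hp _).2) // (le_trans (natV_le Nm)) // ltW.
    by rewrite (lt_le_trans (hp _).2) // (le_trans (natV_le Nn)) // ltW.
  exists l => eps e0; have [N1 h1] := natV_small e0; have [N2 h2] := hl _ e0.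
  pose n := maxn N1 N2; exists (p n); split; first exact: (hp n).1.
    rewrite (lt_le_trans (hp n).2) // (le_trans _ (ltW h1)) //.
    by rewrite natV_le // leq_maxl.
  by rewrite distrC h2 // leq_maxr.
have relU x y y' : rel x y -> rel x y' -> y = y'.
  move=> h h'; have := relP (-1) _ _ _ _ h h'.
  rewrite !scaleN1r addNr => /relN /esym; rewrite normr0 => /eqP.
  by rewrite normr_eq0 addrC subr_eq0 => /eqP.
have [J hJ] := choice exrel; exists J.
have lJ : linear J by move=> a x y; apply: relU (hJ _) _; apply: relP.
split=> //; first by apply: polarization => // x; rewrite (relN _ _ (hJ x)).
move=> i; apply: relU (hJ _) _ => eps e0; exists (e i, g i); split.
- by apply: span_in; exists i.
- by rewrite subrr normr0.
- by rewrite subrr normr0.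
Qed.

Lemma opinvE H (S T : H -> H) :
  bounded_op S -> T \o S = id -> S \o T = id -> opinv T = S.
Proof.
move=> bS TS ST; rewrite /opinv; case: xgetP => [S' _ /= [bS' TS' ST']|].
  apply/funext => x.
  by rewrite -[x in LHS](congr1 (@^~ x) TS) /= -[LHS]/((S' \o T) (S x)) ST'.
by move/(_ S); case.
Qed.

(** [id - A] is bounded below by [1 - r], and a vector orthogonal to its range
    satisfies |y|^2 = <y, A y> <= r |y|^2; hence it is onto.  The last equation
    is the finite geometric expansion with its exact remainder, from which the
    norm estimate follows. *)
Lemma neumann H (A : H -> H) (r : C) : linear A -> bounded_by A r -> r < 1 ->
  exists Q : H -> H, [/\ bounded_op Q, (id - A) \o Q = id, Q \o (id - A) = id,
    forall n x, `|Q x - \sum_(k < n) iter k A x| <= r ^+ n / (1 - r) * `|x| &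
    forall n x, Q x = \sum_(k < n) iter k A x + iter n A (Q x)].
Proof.
move=> lA [r0 hA] r1; pose B : H -> H := id - A.
have BE x : B x = x - A x by [].
have s0 : 0 < 1 - r by rewrite subr_gt0.
have lB : linear B by move=> a x y; rewrite !BE lA scalerBr opprD addrACA.
have lowB x : (1 - r) * `|x| <= `|B x|.
  rewrite mulrBl mul1r lerBlDr -{1}(subrK (A x) x).
  by rewrite (le_trans (ler_normD _ _)) // lerD2l.
have bA : bounded_op A by apply/bounded_opP; split=> //; exists r.
have bB : bounded_op B.
  by have := (bounded_lin_closed H H).2 (-1) A id bA (bounded_id H); rewrite scaleN1r addrC.
have cB := bounded_below_range_closed bB s0 lowB.
have surjB y : exists x, B x = y.
  suff [x _ <-] : range B y by exists x.
  apply: (cspan_min cB (@subset_refl _ _)).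
  apply: orthogonal_total => {y} y hy; apply/eqP/negP => /negP y0.
  have y1 : 0 < `|y| by rewrite normr_gt0.
  have : inner y (B y) = 0 by apply: hy; exists y.
  rewrite BE innerBr -inner_normE => /eqP; rewrite subr_eq0 => /eqP yA.
  have : `|y| ^+ 2 <= r * `|y| ^+ 2.
    rewrite -[leLHS]ger0_norm ?exprn_ge0 // {1}yA.
    rewrite (le_trans (CauchySchwarz_inner _ _)) // expr2 mulrCA.
    by rewrite ler_wpM2l.
  rewrite -subr_ge0 -{2}[_ ^+ 2]mul1r -mulrBl pmulr_lge0 ?exprn_gt0 //.
  by rewrite subr_ge0 => /(lt_le_trans r1); rewrite ltxx.
have [Q hQ] := choice surjB.
have QB x : Q (B x) = x.
  apply/eqP; rewrite -subr_eq0 -normr_eq0 eq_le normr_ge0 andbT.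
  rewrite -(ler_pM2l s0) mulr0 (le_trans (lowB _)) //.
  by rewrite (linB lB) hQ subrr normr0.
have lQ : linear Q by move=> a x y; rewrite -{1}(hQ x) -{1}(hQ y) -lB QB.
have nQ x : `|Q x| <= (1 - r)^-1 * `|x|.
  by rewrite ler_pdivlMl // -{2}(hQ x) lowB.
have QE n x : Q x = \sum_(k < n) iter k A x + iter n A (Q x).
  elim: n => [|n IH]; first by rewrite big_ord0 add0r.
  rewrite {1}IH.
  rewrite big_ord_recr /= -addrA; congr (_ + _).
  have lAn m : linear (iter m A).
    elim: m => [|m IHm] // a u v; by rewrite !iterS IHm lA.
  by rewrite -iterS iterSr -(linD (lAn n)) -{2}(hQ x) BE subrK.
have itA n x : `|iter n A x| <= r ^+ n * `|x|.
  elim: n => [|n IH]; first by rewrite expr0 mul1r.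
  by rewrite iterS (le_trans (hA _)) // exprS -mulrA ler_wpM2l.
exists Q; split=> //.
- apply/bounded_opP; split=> //; exists (1 - r)^-1; split=> //.
  by rewrite invr_ge0 ltW.
- by apply/funext => x /=; rewrite -[RHS]hQ.
- by apply/funext => x /=; rewrite -[RHS]QB.
- move=> n x; rewrite (QE n) addrC addKr (le_trans (itA _ _)) //.
  by rewrite -mulrA ler_wpM2l // exprn_ge0.
Qed.

End ClosedSets.

(** * Norm closures and operator systems *)

Section NormClosure.
Context {R : realType} {H K : hilbertType R}.
Implicit Types (M : set (H -> K)).

Lemma norm_closure_in M : M `<=` norm_closure M.
Proof.
move=> T MT e e0; exists T => // x.
by rewrite subrr normr0 mulr_ge0 // ltW.
Qed.

Lemma norm_closure_mono M N : M `<=` N -> norm_closure M `<=` norm_closure N.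
Proof. by move=> MN T hT e e0; have [S /MN NS h] := hT e e0; exists S. Qed.

Lemma norm_closureK M : norm_closure (norm_closure M) `<=` norm_closure M.
Proof.
move=> T hT e e0; have [S hS TS] := hT _ (ltC_half e0).
have [S' MS' SS'] := hS _ (ltC_half e0); exists S' => // x.
rewrite -(subrK (S x) (T x)) -addrA (le_trans (ler_normD _ _)) //.
by rewrite [e]splitr mulrDl lerD.
Qed.

Lemma norm_closure_lin M : linear_closed M -> linear_closed (norm_closure M).
Proof.
move=> lM; split=> [|a S T hS hT e e0].
  by apply: norm_closure_in; case: lM.
have a0 : 0 < `|a| + 1 by rewrite ltr_wpDl.
have [S' MS' SS'] := hS _ (divr_gt0 (ltC_half e0) a0).
have [T' MT' TT'] := hT _ (ltC_half e0).
exists (a *: S' + T') => [|x]; first exact: lM.2.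
rewrite !fctE opprD addrACA -scalerBr (le_trans (ler_normD _ _)) //.
rewrite [e in leRHS]splitr mulrDl lerD // normrZ.
rewrite (@le_trans _ _ ((`|a| + 1) * `|S x - S' x|)) ?ler_wpM2r ?lerDl //.
by rewrite mulrC -ler_pdivlMr // mulrAC.
Qed.

Lemma norm_closure_bounded M : M `<=` [set T | bounded_op T] ->
  norm_closure M `<=` [set T | bounded_op T].
Proof.
move=> bM T hT; apply/bounded_opP; split.
  move=> a x y; apply: normB_eq0 => e e0.
  pose w := `|a *: x + y| + `|a| * `|x| + `|y|.
  have w0 : 0 <= w by rewrite !addr_ge0 // mulr_ge0.
  have w1 : 0 < w + 1 by rewrite ltr_wpDl.
  have [S /bM/bounded_opP[lS _] TS] := hT _ (divr_gt0 e0 w1).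
  have -> : T (a *: x + y) - (a *: T x + T y) =
      (T (a *: x + y) - S (a *: x + y)) + (a *: (S x - T x) + (S y - T y)).
    by rewrite lS scalerBr [X in _ = _ + X]addrACA -opprD addrA subrK.
  rewrite (le_trans (ler_normD _ _)) //.
  rewrite (le_trans (lerD (TS _) (ler_normD _ _))) // normrZ.
  rewrite (distrC (S x)) (distrC (S y)).
  rewrite (@le_trans _ _ (e / (w + 1) * w)) //.
    move: (e / (w + 1)) TS => k TS.
    by rewrite /w !mulrDr -addrA lerD // lerD // mulrCA ler_wpM2l.
  by rewrite mulrAC ler_pdivrMr // ler_wpM2l ?lerDl // ltW.
have [S /bM/bounded_opP[lS [k [k0 hk]]] TS] := hT 1 ltr01.
exists (1 + k); split=> [|x]; first by rewrite addr_ge0.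
rewrite -(subrK (S x) (T x)) (le_trans (ler_normD _ _)) // mulrDl.
by rewrite lerD.
Qed.
End NormClosure.

Section OperatorSystemProducts.
Context {R : realType} {d : nat} (F : fock R d).
Variable G : set (F -> F).
Hypothesis bG : G `<=` [set T | bounded_op T].
Hypothesis idG : G id.

(** The sums whose norm closure is [opsys M]. *)
Definition adj_sums (M : set (F -> F)) : set (F -> F) :=
  [set T | exists A B, [/\ M A, M B & T = A + adj B]].

Hypothesis GG : forall p q, G p -> G q -> adj_sums (span G) (adj q \o p).
Local Notation M := (norm_closure (span G)).

Lemma spanG_bounded : span G `<=` [set T | bounded_op T].
Proof. exact: span_min (bounded_lin_closed F F) bG. Qed.

Lemma ncG_bounded p : M p -> bounded_op p.
Proof. exact: (norm_closure_bounded spanG_bounded). Qed.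

Lemma ncG_lin : linear_closed M.
Proof. exact/norm_closure_lin/span_lin. Qed.

Lemma ncG_in p : G p -> M p.
Proof. by move=> Gp; apply/norm_closure_in/span_in. Qed.

Lemma adj_sums_lin (N : set (F -> F)) : linear_closed N ->
  N `<=` [set T | bounded_op T] -> linear_closed (adj_sums N).
Proof.
move=> lN bN; have b0 : bounded_op (0 : F -> F) := (bounded_lin_closed F F).1.
have a0 : adj (0 : F -> F) = 0.
  by apply: adj_unique => x y; rewrite !fun0E inner0l inner0r.
split=> [|a S T [A [B [NA NB ->]]] [A' [B' [NA' NB' ->]]]].
  by exists 0, 0; split; [exact: lN.1|exact: lN.1|rewrite a0 addr0].
exists (a *: A + A'), (a^* *: B + B'); split; [exact: lN.2|exact: lN.2|].
rewrite adjP_lin; [|exact: bN..].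
by rewrite conjCK scalerDr addrACA.
Qed.

(** Products q^* p of generators are sums a + b^*, and this extends by
    sesquilinearity; [opsys_mul] then passes to norm limits.  This is why a state
    can be evaluated on q^* p. *)
Lemma adj_sums_mul p q : span G p -> span G q ->
  adj_sums (span G) (adj q \o p).
Proof.
have lE := adj_sums_lin (span_lin G) spanG_bounded.
move=> Gp; pose N := [set r : F -> F | span G r /\ adj_sums (span G) (adj r \o p)].
have lN : linear_closed N.
  split=> [|a S T [GS hS] [GT hT]]; first split.
  - by case: (span_lin G).
  - rewrite (_ : _ \o _ = 0); first by case: lE.
    apply/funext => x /=; rewrite (adj_unique (S := 0)) // => u v.
    by rewrite !fun0E inner0l inner0r.
  - split; first by apply: (span_lin G).2.
    rewrite adjP_lin; [|exact: spanG_bounded..].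
    rewrite (_ : _ \o _ = a^* *: (adj S \o p) + (adj T \o p)) //.
    exact: lE.2.
suff GN : G `<=` N by move=> /(span_min lN GN)[].
move=> {}q Gq; split; first exact: span_in.
have bq := adj_bounded_op (bG Gq).
pose N' := [set r : F -> F | adj_sums (span G) (adj q \o r)].
have lN' : linear_closed N'.
  split=> [|a S T hS hT]; rewrite /N' /=.
  - rewrite (_ : _ \o _ = 0); first by case: lE.
    by apply/funext => x /=; rewrite (lin0 bq.1).
  - rewrite (_ : _ \o _ = a *: (adj q \o S) + (adj q \o T)); first exact: lE.2.
    by apply/funext => x /=; rewrite !fctE bq.1.
by apply: (span_min lN' _ Gp) => r Gr; apply: GG.
Qed.

Lemma opsysE N : opsys N = norm_closure (adj_sums N). Proof. by []. Qed.

Lemma opsys_lin : linear_closed (opsys M).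
Proof.
rewrite opsysE; apply: norm_closure_lin; apply: adj_sums_lin; first exact: ncG_lin.
by move=> p /ncG_bounded.
Qed.

Lemma opsys_mul p q : M p -> M q -> opsys M (adj q \o p).
Proof.
move=> Mp Mq; rewrite opsysE.
suff h : norm_closure (adj_sums (span G)) (adj q \o p).
  apply: norm_closure_mono h => _ [A [B [GA GB ->]]].
  by exists A, B; split=> //; apply: norm_closure_in.
move=> e e0.
have /bounded_opP[lp [kp [kp0 hp]]] := ncG_bounded Mp.
have bq := ncG_bounded Mq; have /bounded_opP[lq [kq [kq0 hq]]] := bq.
pose w := kp + kq + 1; have w0 : 0 < w by rewrite ltr_wpDl // addr_ge0.
pose e1 := e / (e + w + w).
have ew0 : 0 < e + w + w by apply: addr_gt0 => //; apply: addr_gt0.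
have e10 : 0 < e1 by rewrite divr_gt0.
have e11 : e1 <= 1 by rewrite ler_pdivrMr // mul1r -addrA lerDl addr_ge0 // ltW.
have [p' Gp' pp'] := Mp _ e10; have [q' Gq' qq'] := Mq _ e10.
exists (adj q' \o p'); first exact: adj_sums_mul.
have bq' := spanG_bounded Gq'.
have hqq' : bounded_by (adj (-1 *: q' + q)) e1.
  apply: adj_bounded; first by apply: ((bounded_lin_closed F F).2 _ _ _ bq' bq).1.
  split=> [|x]; first exact: ltW.
  by rewrite !fctE scaleN1r addrC.
have hq' : bounded_by (adj q') (kq + e1).
  apply: adj_bounded; first exact: bq'.1.
  split=> [|x]; first by rewrite addr_ge0 // ltW.
  rewrite -(subrK (q x) (q' x)) (le_trans (ler_normD _ _)) // addrC mulrDl lerD //.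
  by rewrite distrC.
move=> x; rewrite /=.
have -> : adj q (p x) - adj q' (p' x) =
    adj (-1 *: q' + q) (p x) + adj q' (p x - p' x).
  rewrite adjP_lin // !fctE (linB (adj_linear bq')) rmorphN /= conjC1 scaleN1r.
  by rewrite [- _ + _]addrC addrA subrK.
rewrite (le_trans (ler_normD _ _)) //.
rewrite (le_trans (lerD (hqq'.2 _) (hq'.2 _))) //.
rewrite (@le_trans _ _ (e1 * (kp * `|x|) + (kq + e1) * (e1 * `|x|))) //.
  apply: lerD; first by rewrite ler_wpM2l // ltW.
  by rewrite ler_wpM2l //; exact: hq'.1.
have -> : e1 * (kp * `|x|) + (kq + e1) * (e1 * `|x|) = (e1 * (kp + kq + e1)) * `|x|.
  ring.
rewrite ler_wpM2r // (@le_trans _ _ (e1 * w)) //.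
  by rewrite ler_wpM2l ?lerD2l // ltW.
rewrite mulrAC ler_pdivrMr // ler_wpM2l ?(ltW e0) //.
by rewrite addrC lerDl addr_ge0 // ltW.
Qed.

Lemma opsys_id : opsys M id.
Proof.
have := opsys_mul (ncG_in idG) (ncG_in idG).
by rewrite (adj_id F).
Qed.

End OperatorSystemProducts.

(** * Words and the symmetrized products of the shifts *)

Section Words.
Context {d : nat}.
Local Open Scope nat_scope.

Lemma big_tuple_cons (V : nmodType) k (p : pred (seq 'I_d)) (g : seq 'I_d -> V) :
  (\sum_(u : k.+1.-tuple 'I_d | p u) g u =
   \sum_(j < d) \sum_(v : k.-tuple 'I_d | p (j :: v)) g (j :: v))%R.
Proof.
rewrite pair_big_dep /=.
rewrite (reindex (fun jv : 'I_d * k.-tuple 'I_d => cons_tuple jv.1 jv.2)) //=.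
exists (fun u => (thead u, behead_tuple u)) => [[j v] _|u _] /=.
  by rewrite theadE; congr (_, _); apply: val_inj.
by rewrite [RHS]tuple_eta; apply: val_inj.
Qed.

Lemma sum_count_mem (u : seq 'I_d) : \sum_i count_mem i u = size u.
Proof.
elim: u => [|j u IH] /=; first by rewrite big1.
rewrite big_split /= IH (bigD1 j) //= eqxx big1 ?addn0 // => i ij.
by rewrite eq_sym (negPf ij).
Qed.

Definition dec_at (j : 'I_d) (n : 'I_d -> nat) : 'I_d -> nat :=
  fun i => n i - (i == j).

Lemma sum_dec_at j n : 0 < n j -> \sum_i n i = (\sum_i dec_at j n i).+1.
Proof.
move=> nj; rewrite (bigD1 j) //= [in RHS](bigD1 j) //= /dec_at eqxx.
rewrite -addSn subn1 prednK //; congr (_ + _).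
by apply: eq_bigr => i /negPf ->; rewrite subn0.
Qed.

Lemma count_cons_dec_at (j : 'I_d) (u : seq 'I_d) n :
  [forall i, count_mem i (j :: u) == n i] =
  (0 < n j) && [forall i, count_mem i u == dec_at j n i].
Proof.
apply/forallP/andP => [h|[nj /forallP h] i /=].
  split; first by rewrite -(eqP (h j)) /= eqxx.
  by apply/forallP => i; rewrite /dec_at -(eqP (h i)) /= [j == i]eq_sym addKn.
rewrite (eqP (h i)) /dec_at [j == i]eq_sym.
have [->|_] := eqVneq i j; last by rewrite add0n subn0.
by rewrite subnKC.
Qed.

(** Uniqueness of base [N] digits: it makes the exponents in the Kronecker
    substitution separate the monomials of a given degree. *)
Lemma digits_inj N k (f g : 'I_k -> nat) : (forall j, f j < N) ->
  (forall j, g j < N) ->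
  \sum_j f j * N ^ j = \sum_j g j * N ^ j -> f =1 g.
Proof.
elim: k f g => [|k IH] f g hf hg; first by move=> _ [].
have N0 : 0 < N by apply: leq_trans (hf ord0).
have E (h : 'I_k.+1 -> nat) : \sum_j h j * N ^ j =
    (\sum_(j < k) h (lift ord0 j) * N ^ j) * N + h ord0.
  rewrite big_ord_recl /= expn0 muln1 addnC; congr (_ + _).
  rewrite big_distrl /=; apply: eq_bigr => j _.
  by rewrite /bump /= add1n expnSr mulnA.
rewrite !E => h; have h0 : f ord0 = g ord0.
  by have := congr1 (modn^~ N) h; rewrite !modnMDl !modn_small.
move: h; rewrite h0 => /addIn/eqP; rewrite eqn_pmul2r // => /eqP h.
move=> j; case: (unliftP ord0 j) => [j' ->|-> //].
by apply: (IH (f \o lift ord0) (g \o lift ord0)) => [i|i|] /=.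
Qed.

Lemma sum_exponents N (u : seq 'I_d) :
  \sum_(j <- u) N ^ j = \sum_(j < d) count_mem j u * N ^ j.
Proof.
elim: u => [|i u IH]; first by rewrite big_nil big1.
rewrite big_cons IH /= [in RHS](eq_bigr (fun j : 'I_d => (i == j) * N ^ j + count_mem j u * N ^ j)).
  rewrite big_split /= [X in _ = X + _](bigD1 i) //= eqxx mul1n.
  congr (_ + _); rewrite big1 ?addn0 //.
  by move=> j ji; rewrite eq_sym (negPf ji).
by move=> j _; rewrite mulnDl.
Qed.
End Words.

Section FockOperators.
Context {R : realType} {d : nat} (F : fock R d).
Local Notation C := R[i].
Local Notation L := (@fock_L R d F).
Local Notation Lsym := (@Lsym R d F).
Local Notation polyS := (@polyS R d F).
Local Notation polyS0 := (@polyS0 R d F).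
Local Notation xi := (@fock_xi R d F).

Lemma xi_total (x : F) : closure (span (range xi)) x.
Proof. by move: x; apply/dense_closure; exact: fock_xi_total. Qed.

Lemma L_linear j : linear (L j). Proof. exact: (fock_L_bounded F j).1. Qed.

Lemma adj_LL i j (x : F) : adj (L i) (L j x) = (i == j)%:R *: x.
Proof.
have bL j := fock_L_bounded F j.
suff /(congr1 (@^~ x)) : adj (L i) \o L j = (i == j)%:R *: id + 0.
  by rewrite /= !fctE fun0E addr0.
apply: (@bounded_eq _ _ _ _ _ (range xi)).
- exact/bounded_comp/bL/adj_bounded_op/bL.
- apply: (bounded_lin_closed F F).2; first exact: bounded_id.
  exact: (bounded_lin_closed F F).1.
- exact: xi_total.
move=> _ [w _ <-]; rewrite !fctE fun0E addr0 /=.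
apply/eqP; rewrite -subr_eq0; apply/eqP.
apply: (total_orthogonal (A := range xi) xi_total) => _ [v _ <-].
rewrite innerBl adjPl // !fock_LE innerZl !fock_xi_orthonormal.
by rewrite eqseq_cons eq_sym -natrM mulnb subrr.
Qed.

Lemma inner_LL i j (x y : F) : inner (L i x) (L j y) = (i == j)%:R * inner x y.
Proof.
have bL := fock_L_bounded F.
by rewrite adjP // adj_LL innerZr conjC_nat.
Qed.

Lemma word_op_bounded (H : hilbertType R) (T : 'I_d -> H -> H) (w : seq 'I_d) :
  (forall j, bounded_op (T j)) -> bounded_op (word_op T w).
Proof.
move=> bT; elim: w => [|j w IH]; first exact: bounded_id.
exact: bounded_comp.
Qed.

(** The row combination of the creation operators: for c = w^* this is the
    adjoint of z L^* at z = w. *)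
Definition rowop (c : 'I_d -> C) : F -> F := \sum_j c j *: L j.

Lemma rowopE c x : rowop c x = \sum_j c j *: L j x.
Proof. by rewrite /rowop fct_sumE. Qed.

Lemma rowop_linear c : linear (rowop c).
Proof.
move=> a x y; rewrite !rowopE scaler_sumr -big_split /=; apply: eq_bigr => j _.
by rewrite L_linear scalerDr !scalerA mulrC.
Qed.

Lemma rowop_norm c x : `|rowop c x| ^+ 2 = (\sum_j `|c j| ^+ 2) * `|x| ^+ 2.
Proof.
rewrite !inner_normE rowopE inner_suml mulr_suml; apply: eq_bigr => i _.
rewrite inner_sumr (bigD1 i) //= big1 ?addr0 => [|j ji].
  by rewrite innerZl innerZr inner_LL eqxx mul1r normCK mulrA.
by rewrite innerZl innerZr inner_LL eq_sym (negPf ji) mul0r !mulr0.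
Qed.

Lemma adj_L_row c j x : adj (L j) (rowop c x) = c j *: x.
Proof.
have lL := adj_linear (fock_L_bounded F j).
rewrite rowopE (lin_sum lL) (bigD1 j) //= big1 ?addr0 => [|i ij].
  by rewrite (linZ lL) adj_LL eqxx scale1r.
by rewrite (linZ lL) adj_LL eq_sym (negPf ij) scale0r scaler0.
Qed.

Lemma iter_row c k x :
  iter k (rowop c) x =
  \sum_(u : k.-tuple 'I_d) (\prod_(j <- u) c j) *: word_op L u x.
Proof.
elim: k => [|k IH].
  rewrite (big_pred1 [tuple]) => [|u]; first by rewrite big_nil scale1r.
  by apply/esym/eqP; exact: tuple0.
rewrite iterS IH rowopE (big_tuple_cons k xpredT (fun u => (\prod_(j <- u) c j) *: word_op L u x)).
apply: eq_bigr => j _; rewrite (lin_sum (@L_linear j)) scaler_sumr.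
apply: eq_bigr => u _.
by rewrite (linZ (@L_linear j)) scalerA big_cons.
Qed.

(** The length is kept apart from the counts, so that recursion on the length
    avoids casts between types of tuples; the value is 0 when the two
    disagree. *)
Definition homog (k : nat) (n : 'I_d -> nat) : F -> F :=
  \sum_(u : k.-tuple 'I_d | [forall i, count_mem i u == n i]) word_op L u.

Lemma Lsym_homog n : Lsym n = homog (\sum_i n i)%N n. Proof. by []. Qed.

Lemma homogE k n x : homog k n x =
  \sum_(u : k.-tuple 'I_d | [forall i, count_mem i u == n i]) word_op L u x.
Proof. by rewrite /homog fct_sumE. Qed.

Lemma homog_eq0 k n : k <> (\sum_i n i)%N -> homog k n = 0.
Proof.
move=> kn; rewrite /homog big1 // => u /forallP hu; case: kn.
rewrite -[LHS](size_tuple u) -sum_count_mem; apply: eq_bigr => i _.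
exact/eqP.
Qed.

Lemma homogS k n x : homog k.+1 n x =
  \sum_j L j (if (0 < n j)%N then homog k (dec_at j n) x else 0).
Proof.
rewrite homogE (big_tuple_cons k (fun u => [forall i, count_mem i u == n i])
  (fun u => word_op L u x)).
apply: eq_bigr => j _; case: ifP => nj; last first.
  rewrite (lin0 (@L_linear j)) big_pred0 // => u.
  by rewrite count_cons_dec_at nj.
rewrite homogE (lin_sum (@L_linear j)); apply: eq_bigl => u.
by rewrite count_cons_dec_at nj.
Qed.

Lemma adj_L_sum j (f : 'I_d -> F) : adj (L j) (\sum_i L i (f i)) = f j.
Proof.
have lL := adj_linear (fock_L_bounded F j).
rewrite (lin_sum lL) (bigD1 j) //= big1 ?addr0 => [|i ij].
  by rewrite adj_LL eqxx scale1r.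
by rewrite adj_LL eq_sym (negPf ij) scale0r.
Qed.

(** Split the words according to their first letter. *)
Lemma Lsym_rec n x : (0 < \sum_i n i)%N ->
  Lsym n x = \sum_j L j (if (0 < n j)%N then Lsym (dec_at j n) x else 0).
Proof.
move=> n0; rewrite Lsym_homog -(prednK n0) homogS; apply: eq_bigr => j _.
by case: ifP => // nj; rewrite Lsym_homog; rewrite (sum_dec_at nj).
Qed.

Lemma adj_L_Lsym j n : (0 < \sum_i n i)%N ->
  adj (L j) \o Lsym n = if (0 < n j)%N then Lsym (dec_at j n) else 0.
Proof.
move=> n0; apply/funext => x /=; rewrite Lsym_rec // adj_L_sum.
by case: ifP.
Qed.

Lemma Lsym0 n : (\sum_i n i)%N = 0%N -> Lsym n = id.
Proof.
move=> n0; rewrite Lsym_homog n0; apply/funext => x; rewrite homogE.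
rewrite (big_pred1 [tuple]) // => u.
have -> : pred1 [tuple] u by apply/eqP; exact: tuple0.
apply/forallP => i; rewrite [u]tuple0 /= eq_sym.
by move/eqP: n0; rewrite sum_nat_eq0 => /forallP/(_ i).
Qed.

Lemma Lsym_bounded n : bounded_op (Lsym n).
Proof.
suff : [set T : F -> F | bounded_op T] (Lsym n) by [].
apply: lin_closed_sum => [|u _]; first exact: bounded_lin_closed.
exact/word_op_bounded/fock_L_bounded.
Qed.

Lemma polyS0_sub : polyS0 `<=` polyS.
Proof.
apply: span_min; first exact: span_lin.
by move=> _ [n _ <-]; apply: span_in; exists n.
Qed.

Lemma id_polyS : range (Lsym) id.
Proof. by exists (fun=> 0%N) => //; apply: Lsym0; rewrite big1. Qed.

(** Without constant term, p is recovered from its backward shifts by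
    p = sum_j L_j L_j^* p, and these are again symmetric polynomials. *)
Lemma polyS0_rec p : polyS0 p ->
  (forall j, polyS (adj (L j) \o p)) /\
  forall x, p x = \sum_j L j (adj (L j) (p x)).
Proof.
have lL j := adj_linear (fock_L_bounded F j).
pose N := [set p : F -> F | (forall j, polyS (adj (L j) \o p)) /\
  forall x, p x = \sum_j L j (adj (L j) (p x))].
suff sN : polyS0 `<=` N by move/sN.
apply: span_min.
  split; first split=> [j|x].
  - rewrite (_ : _ \o _ = 0); first by case: (span_lin (range (Lsym))).
    by apply/funext => x /=; rewrite (lin0 (lL j)).
  - by rewrite fun0E big1 // => j _; rewrite (lin0 (lL j)) (lin0 (@L_linear j)).
  move=> a p1 p2 [h1 e1] [h2 e2]; split=> [j|x].
  - rewrite (_ : _ \o _ = a *: (adj (L j) \o p1) + (adj (L j) \o p2)).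
      by apply: (span_lin (range Lsym)).2; [exact: h1|exact: h2].
    by apply/funext => x /=; rewrite !fctE lL.
  - rewrite !fctE {1}e1 {1}e2 scaler_sumr -big_split /=; apply: eq_bigr => j _.
    by rewrite lL L_linear.
move=> _ [n /= n0 <-]; split=> [j|x].
  rewrite adj_L_Lsym //; case: ifP => _; last by case: (span_lin (range (Lsym))).
  by apply: span_in; exists (dec_at j n).
rewrite {1}Lsym_rec //; apply: eq_bigr => j _.
by rewrite -[adj _ _]/((adj (L j) \o Lsym n) x) adj_L_Lsym //; case: ifP.
Qed.

(** By [Lsym_rec], L^(m)^* L^(n) is the sum over j of the same product with one
    letter j removed from both sides; the recursion ends when m or n is 0. *)
Lemma Lsym_GG p q : range (Lsym) p -> range (Lsym) q ->
  adj_sums (polyS) (adj q \o p).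
Proof.
move=> [n _ <-] [m _ <-] {p q}.
have bS : polyS `<=` [set T | bounded_op T].
  apply: span_min; first exact: bounded_lin_closed.
  by move=> _ [k _ <-]; apply: Lsym_bounded.
have lE := adj_sums_lin (span_lin (range (Lsym))) bS.
have a0 : adj (0 : F -> F) = 0.
  by apply: adj_unique => x y; rewrite !fun0E inner0l inner0r.
move: {-2}(\sum_i m i)%N (erefl (\sum_i m i)%N) => k.
elim: k m n => [|k IH] m n hm.
  rewrite Lsym0 // adj_id; exists (Lsym n), 0; split.
  - by apply: span_in; exists n.
  - by case: (span_lin (range (Lsym))).
  - by rewrite a0 addr0.
have [n0|n0] := posnP (\sum_i n i)%N.
  rewrite (Lsym0 n0); exists 0, (Lsym m); split.
  - by case: (span_lin (range (Lsym))).
  - by apply: span_in; exists m.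
  - by rewrite add0r.
rewrite (_ : _ \o _ = \sum_j if (0 < m j)%N && (0 < n j)%N then
    adj (Lsym (dec_at j m)) \o Lsym (dec_at j n) else 0).
  apply: lin_closed_sum => // j _; case: ifP => [/andP[mj nj]|_]; last by case: lE.
  by apply: IH; move: hm; rewrite (sum_dec_at mj) => -[].
apply/funext => x; rewrite fct_sumE /=; apply: inner_eqr => y.
rewrite -adjP; last exact: Lsym_bounded.
rewrite (Lsym_rec x) // (Lsym_rec y) -?hm // inner_suml inner_sumr.
apply: eq_bigr => i _; rewrite inner_sumr (bigD1 i) //= big1 ?addr0.
  rewrite inner_LL eqxx mul1r; case: ifP => mi /=; last by rewrite inner0l fun0E inner0r.
  case: ifP => ni; last by rewrite fun0E !inner0r.
  by rewrite adjP //; apply: Lsym_bounded.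
by move=> j ji; rewrite inner_LL eq_sym (negPf ji) mul0r.
Qed.

Lemma homog_polyS0 k n : polyS0 (homog k.+1 n).
Proof.
have [kn|/eqP kn] := eqVneq k.+1 (\sum_i n i)%N.
  by apply: span_in; exists n; rewrite /= -?kn // Lsym_homog -kn.
rewrite homog_eq0 //.
by case: (span_lin [set Lsym n | n in [set n | (0 < \sum_i n i)%N]]).
Qed.

Lemma prod_counts (c : 'I_d -> C) (u : seq 'I_d) :
  \prod_(j <- u) c j = \prod_j c j ^+ count_mem j u.
Proof.
elim: u => [|i u IH]; first by rewrite big_nil big1.
rewrite big_cons IH [in RHS](eq_bigr (fun j => c j ^+ (i == j) * c j ^+ count_mem j u)).
  rewrite big_split /= [X in _ = X * _](bigD1 i) //= eqxx expr1.
  congr (_ * _); rewrite big1 ?mulr1 //.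
  by move=> j ji; rewrite eq_sym (negPf ji).
by move=> j _; rewrite -exprD.
Qed.

Lemma iter_row_homog c k : iter k (rowop c) =
  \sum_(n : {ffun 'I_d -> 'I_k.+1}) (\prod_j c j ^+ n j) *: homog k (fun i => n i).
Proof.
apply/funext => x; rewrite iter_row fct_sumE.
rewrite (partition_big (fun u : k.-tuple 'I_d =>
  [ffun j => inord (count_mem j u)] : {ffun 'I_d -> 'I_k.+1}) predT) //=.
apply: eq_bigr => n _; rewrite fctE homogE scaler_sumr.
apply: eq_big => u.
  apply/eqP/forallP => [<- i|h]; last first.
    by apply/ffunP => i; rewrite ffunE (eqP (h i)) inord_val.
  rewrite ffunE inordK // ltnS -[X in (_ <= X)%N](size_tuple u).
  exact: count_size.
move=> /eqP <-; congr (_ *: _); rewrite prod_counts; apply: eq_bigr => j _.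
rewrite ffunE inordK // ltnS -[X in (_ <= X)%N](size_tuple u).
exact: count_size.
Qed.

Lemma iter_row_polyS0 c k : polyS0 (iter k.+1 (rowop c)).
Proof.
rewrite iter_row_homog; apply: lin_closed_sum => [|n _]; first exact: span_lin.
apply: lin_closedZ; first exact: span_lin.
exact: homog_polyS0.
Qed.

(** Kronecker substitution: for c_j = t^(N^j) with N > |n|, the k-th power of
    the row is a polynomial in t in which distinct L^(n) of degree k carry
    distinct exponents.  Evaluating at enough integers t and inverting the
    Vandermonde matrix isolates each of them. *)
Lemma Lsym_iter_row n : span [set iter (\sum_i n i) (rowop c) | c in setT] (Lsym n).
Proof.
pose k := (\sum_i n i)%N; pose N := k.+1.
pose ex (u : seq 'I_d) := (\sum_(j <- u) N ^ j)%N.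
pose E0 := (\sum_(j < d) n j * N ^ j)%N.
pose M := (maxn E0 (\max_(u : k.-tuple 'I_d) ex u)).+1.
pose B (m : 'I_M) : F -> F := \sum_(u : k.-tuple 'I_d | ex u == m) word_op L u.
pose c (t : nat) (j : 'I_d) : C := t%:R ^+ (N ^ j).
have exM (u : k.-tuple 'I_d) : (ex u < M)%N.
  by rewrite ltnS leq_max (leq_bigmax (F := fun u : k.-tuple 'I_d => ex u)) orbT.
have iterE (t : nat) : iter k (rowop (c t)) = \sum_(m < M) (t%:R : C) ^+ m *: B m.
  apply/funext => x; rewrite iter_row fct_sumE.
  rewrite (partition_big (fun u : k.-tuple 'I_d => Ordinal (exM u)) predT) //=.
  apply: eq_bigr => m _; rewrite fctE /B fct_sumE scaler_sumr.
  apply: eq_big => u; first by rewrite -val_eqE.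
  move=> /eqP <- /=; congr (_ *: _); rewrite /c /ex.
  by rewrite (big_morph _ (exprD _) (expr0 _)).
have E0M : (E0 < M)%N by rewrite ltnS leq_maxl.
have BE : B (Ordinal E0M) = Lsym n.
  rewrite /B /Lsym; apply: eq_bigl => u /=; rewrite /ex sum_exponents /E0.
  apply/eqP/forallP => [h i|h]; last by apply: eq_bigr => i _; rewrite (eqP (h i)).
  apply/eqP; apply: (digits_inj (N := N) (f := fun i => count_mem i u)) h _ => j.
    by rewrite ltnS -[X in (_ <= X)%N](size_tuple u) count_size.
  by rewrite ltnS /k (bigD1 j) //= leq_addr.
pose Vm : 'M[C]_M := \matrix_(t, m) (t : nat)%:R ^+ m.
have Vu : Vm \in unitmx.
  rewrite -unitmx_tr; have -> : Vm^T = Vandermonde M (\row_(t < M) (t : nat)%:R).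
    by apply/matrixP => i j; rewrite !mxE.
  rewrite unitmxE det_Vandermonde unitfE; apply/prodf_neq0 => i _.
  apply/prodf_neq0 => j ij; rewrite !mxE subr_eq0 eqr_nat.
  by rewrite neq_ltn ij orbT.
have -> : Lsym n = \sum_t invmx Vm (Ordinal E0M) t *: iter k (rowop (c t)).
  under eq_bigr do rewrite iterE scaler_sumr.
  rewrite exchange_big /= -BE.
  have iV (m : 'I_M) : \sum_t invmx Vm (Ordinal E0M) t *: ((t : nat)%:R ^+ m *: B m)
      = (Ordinal E0M == m)%:R *: B m.
    under eq_bigr do rewrite scalerA; rewrite -scaler_suml; congr (_ *: _).
    have := congr1 (fun A : 'M[C]_M => A (Ordinal E0M) m) (mulVmx Vu).
    rewrite !mxE => <-; apply: eq_bigr => t _; by rewrite !mxE.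
  rewrite [RHS](eq_bigr (fun m => (Ordinal E0M == m)%:R *: B m)) => [|m _]; last exact: iV.
  rewrite [RHS](bigD1 (Ordinal E0M)) //= eqxx scale1r big1 ?addr0 // => m hm.
  by rewrite eq_sym (negPf hm) scale0r.
apply: lin_closed_sum => [|t _]; first exact: span_lin.
by apply: lin_closedZ; [exact: span_lin|apply: span_in; exists (c t)].
Qed.

End FockOperators.

Arguments rowop {R d} F c _.

(** * Completion of an operator system; resolvents *)

Lemma le_sqr1D (R : numDomainType) (m : R) : 0 <= m -> m <= (1 + m) ^+ 2.
Proof.
move=> m0; rewrite -subr_ge0.
have -> : (1 + m) ^+ 2 - m = 1 + m + m * m by ring.
by rewrite !addr_ge0 ?mulr_ge0.
Qed.

Section Gns.
Context {R : realType} {d : nat} (F : fock R d).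
Local Notation C := R[i].
Variable G : set (F -> F).
Hypothesis bG : G `<=` [set T | bounded_op T].
Hypothesis idG : G id.
Hypothesis GG : forall p q, G p -> G q -> adj_sums (span G) (adj q \o p).
Variable M : set (F -> F).
Hypothesis hM : M = norm_closure (span G).
Variable mu : (F -> F) -> C.
Hypothesis smu : is_state M mu.
Variable P : gns_space M mu.
Local Notation cls := (gns_cls P).

Lemma gns_lin : linear_closed M.
Proof. by rewrite hM; exact: ncG_lin. Qed.

Lemma gns_in p : G p -> M p.
Proof. by rewrite hM; exact: ncG_in. Qed.

Lemma gns_bounded p : M p -> bounded_op p.
Proof. by rewrite hM; exact: ncG_bounded. Qed.


Lemma cls0 : cls 0 = 0.
Proof.
have M0 := gns_lin.1; apply: (addrI (cls 0)); rewrite addr0.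
by have := gns_cls_linear P 1 M0 M0; rewrite !scale1r addr0 => <-.
Qed.

Lemma clsD p q : M p -> M q -> cls (p + q) = cls p + cls q.
Proof. by move=> Mp Mq; rewrite -[p]scale1r gns_cls_linear // !scale1r. Qed.

Lemma clsZ a p : M p -> cls (a *: p) = a *: cls p.
Proof.
move=> Mp; rewrite -[a *: p]addr0 gns_cls_linear ?cls0 ?addr0 //.
exact: gns_lin.1.
Qed.

Lemma clsB p q : M p -> M q -> cls (p - q) = cls p - cls q.
Proof.
move=> Mp Mq; rewrite -scaleN1r clsD //; first by rewrite clsZ // scaleN1r.
by apply: lin_closedZ => //; exact: gns_lin.
Qed.

Lemma cls_sum (I : Type) (r : seq I) (p : pred I) (f : I -> F -> F) :
  (forall i, M (f i)) ->
  cls (\sum_(i <- r | p i) f i) = \sum_(i <- r | p i) cls (f i).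
Proof.
move=> Mf; elim: r => [|i r IH]; first by rewrite !big_nil cls0.
rewrite !big_cons; case: ifP => // _; rewrite clsD ?IH //.
by apply: lin_closed_sum => //; exact: gns_lin.
Qed.

(** Positivity of [mu] applied to e^2 I - p^* p.  The constant 1 + mu I stands
    for the square root of mu I, which it dominates. *)
Lemma cls_bound : exists2 K : C, 0 <= K &
  forall p e, M p -> bounded_by p e -> `|cls p| <= K * e.
Proof.
have Mid := gns_in idG.
have [muP mu0] := smu; rewrite hM in muP mu0.
have oid := opsys_id bG idG GG.
have mid0 : 0 <= mu id.
  by apply: mu0 => // x; exact: inner_ge0.
exists (1 + mu id) => [|p e Mp [e0 hp]]; first by rewrite addr_ge0.
have opp : opsys (norm_closure (span G)) (adj p \o p).
  by apply: opsys_mul => //; rewrite -hM.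
have bp := gns_bounded Mp.
rewrite -(ler_pXn2r (n := 2)) ?nnegrE ?normr_ge0 ?mulr_ge0 ?addr_ge0 //.
rewrite inner_normE gns_cls_inner //.
have : 0 <= mu (-1 *: (adj p \o p) + (e ^+ 2 *: id + 0)).
  have lo := opsys_lin bG.
  apply: mu0 => [|x]; first by apply: lo.2 => //; apply: lo.2 => //; exact: lo.1.
  rewrite !fctE fun0E addr0 scaleN1r addrC innerDl innerNl innerZl adjPl //.
  rewrite subr_ge0 -!inner_normE -exprMn.
  by rewrite lerXn2r ?nnegrE ?mulr_ge0.
have lo := opsys_lin bG.
have mu00 : mu 0 = 0.
  apply: (addrI (mu 0)); rewrite addr0.
  by have := muP 1 0 0 lo.1 lo.1; rewrite scale1r mul1r addr0.
rewrite muP // ?muP //; [|exact: lo.1|by apply: lo.2 => //; exact: lo.1].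
rewrite mu00 addr0 mulN1r addrC subr_ge0 => /le_trans; apply.
rewrite exprMn mulrC ler_wpM2r ?exprn_ge0 //.
exact: le_sqr1D.
Qed.

(** A set of classes closed in the Hilbert norm is closed under operator norm
    limits, by [cls_bound]. *)
Lemma cls_limit (N : set P) p : closed_subspace N -> M p ->
  (forall e : C, 0 < e -> exists q, [/\ M q, N (cls q) & bounded_by (p - q) e]) ->
  N (cls p).
Proof.
move=> cN Mp h; apply: (closed_limit cN) => e e0.
have [K K0 hK] := cls_bound.
have K1 : 0 < K + 1 by rewrite ltr_wpDl.
have [q [Mq Nq bq]] := h _ (divr_gt0 e0 K1); exists (cls q) => //.
rewrite -clsB //; apply: le_lt_trans (hK _ _ _ bq) _.
  by apply: lin_closedB => //; exact: gns_lin.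
by rewrite mulrA ltr_pdivrMr // mulrC ltr_pM2l // ltrDl.
Qed.

Lemma cls_total (x : P) : closure (span (cls @` G)) x.
Proof.
have cN := cspan_closed (cls @` G).
move: x; apply/dense_closure/denseNP => x e e0.
have dP : forall x (e : C), 0 < e -> exists2 y, (cls @` M) y & `|x - y| < e.
  by apply/denseNP; exact: gns_cls_dense.
have [_ [p Mp <-] xp] := dP x _ (ltC_half e0).
have Np : closure (span (cls @` G)) (cls p).
  apply: cls_limit => // k k0.
  have Mp' : norm_closure (span G) p by rewrite -hM.
  have [q Gq pq] := Mp' k k0.
  have Mq : M q by rewrite hM; apply: norm_closure_in.
  exists q; split=> //; last by split=> [|x0]; [exact: ltW|exact: pq].
  apply: subset_closure; move: Gq {pq Mq} => [n [c [a [Ga ->]]]].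
  rewrite cls_sum => [|i]; last by apply: lin_closedZ; [exact: gns_lin|exact: gns_in].
  apply: lin_closed_sum => [|i _]; first exact: span_lin.
  rewrite clsZ; last exact: gns_in.
  by apply: lin_closedZ; [exact: span_lin|apply: span_in; exists (a i)].
have /closureNP/(_ _ (ltC_half e0))[y Ny py] := Np; exists y => //.
rewrite -(subrK (cls p) x) -addrA (le_lt_trans (ler_normD _ _)) //.
by rewrite [ltRHS]splitr ltrD.
Qed.

End Gns.

Section Resolvents.
Context {R : realType} {d : nat} (F : fock R d).
Local Notation C := R[i].
Local Notation L := (@fock_L R d F).
Local Notation zLstar := (@zLstar R d F).
Local Notation resolvent := (@resolvent R d F).
Local Notation polyS := (@polyS R d F).

Definition wL (w : 'rV[C]_d) : F -> F := rowop F (fun j => (w 0 j)^*).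
(** The operator q_w = (I - w^* L)^-1.  Its adjoint is the resolvent at w, so
    mu of the resolvent times p is the inner product of [p] and [q_w]: the
    classes of the q_w play the role of kernel functions. *)
Definition kerop (w : 'rV[C]_d) : F -> F := opinv (id - wL w).

Lemma rowop_bounded c : bounded_by (rowop F c) (1 + \sum_j `|c j| ^+ 2).
Proof.
have s0 : 0 <= \sum_j `|c j| ^+ 2 by apply: sumr_ge0 => j _; rewrite exprn_ge0.
split=> [|x]; first by rewrite addr_ge0.
rewrite -(ler_pXn2r (n := 2)) ?nnegrE ?normr_ge0 ?mulr_ge0 ?addr_ge0 //.
rewrite rowop_norm exprMn ler_wpM2r ?exprn_ge0 //.
exact: le_sqr1D.
Qed.

Lemma rowop_bounded_op c : bounded_op (rowop F c).
Proof.
by apply/bounded_opP; split; [exact: rowop_linear|eexists; exact: rowop_bounded].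
Qed.

Lemma adj_wL w : adj (wL w) = zLstar w.
Proof.
apply: adj_unique => x y; rewrite /wL rowopE /Defs.zLstar fct_sumE inner_suml inner_sumr.
apply: eq_bigr => j _; rewrite !fctE innerZl innerZr adjP //.
exact: fock_L_bounded.
Qed.

Lemma psum_polyS w n : polyS (\sum_(k < n) iter k (wL w)).
Proof.
apply: lin_closed_sum => [|k _]; first exact: span_lin.
case: (nat_of_ord k) => [|m]; first exact/span_in/id_polyS.
exact/polyS0_sub/iter_row_polyS0.
Qed.

(** Neumann inversion applies because the row w^* L has norm |w| < 1. *)
Lemma kerop_spec w : cball w ->
  [/\ ncS F (kerop w), resolvent w = adj (kerop w),
    forall n x, kerop w x = \sum_(k < n) iter k (wL w) x + iter n (wL w) (kerop w x) &
    forall e : C, 0 < e -> exists n0, forall n, (n0 <= n)%N ->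
      bounded_by (kerop w - \sum_(k < n) iter k (wL w)) e].
Proof.
move=> bw; set r := sqrtC (cdot w w).
have ww : \sum_j `|(w 0 j)^*| ^+ 2 = cdot w w.
  by apply: eq_bigr => j _; rewrite norm_conjC normCK.
have ww0 : 0 <= cdot w w by rewrite -ww sumr_ge0 // => j _; rewrite exprn_ge0.
have r0 : 0 <= r by rewrite sqrtC_ge0.
have r1 : r < 1.
  rewrite -(ltr_pXn2r (n := 2)) ?nnegrE ?ler01 // sqrtCK expr1n; exact: bw.
have bA : bounded_by (wL w) r.
  split=> // x; rewrite -(ler_pXn2r (n := 2)) ?nnegrE ?normr_ge0 ?mulr_ge0 //.
  by rewrite rowop_norm ww exprMn sqrtCK.
have [Q [bQ AQ QA estQ sumQ]] := neumann (@rowop_linear R d F _) bA r1.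
have QE : kerop w = Q by apply: opinvE.
have small (e : C) : 0 < e -> exists n0, forall n, (n0 <= n)%N ->
    bounded_by (Q - \sum_(k < n) iter k (wL w)) e.
  move=> e0; have s0 : 0 < 1 - r by rewrite subr_gt0.
  have [n0 h0] := expr_small r0 r1 (mulr_gt0 e0 s0).
  exists n0 => n nn; split=> [|x]; first exact: ltW.
  rewrite !fctE fct_sumE (le_trans (estQ n x)) // ler_wpM2r //.
  rewrite ler_pdivrMr // (le_trans _ (ltW h0)) //.
  by rewrite ler_wiXn2l // ltW.
have bwL : bounded_op (wL w) by exact: rowop_bounded_op.
have bB : bounded_op (id - wL w).
  by have := (bounded_lin_closed F F).2 (-1) (wL w) id bwL (bounded_id F);
    rewrite scaleN1r addrC.
rewrite QE; split=> //.
- move=> e e0; have [n h] := small e e0.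
  exists (\sum_(k < n) iter k (wL w)); first exact: psum_polyS.
  by move=> x; have [_ hx] := h n (leqnn n); exact: hx.
- have -> : resolvent w = opinv (adj (id - wL w)).
    rewrite /resolvent; congr opinv; rewrite -adj_wL; apply/esym.
    have -> : id - wL w = -1 *: wL w + id by rewrite scaleN1r addrC.
    rewrite adjP_lin //; last exact: bounded_id.
    by rewrite adj_id rmorphN1 scaleN1r addrC.
  apply: opinvE; first exact: adj_bounded_op.
    by rewrite -adj_comp // QA adj_id.
  by rewrite -adj_comp // AQ adj_id.
Qed.

End Resolvents.


Arguments wL {R d} F w _.
Arguments kerop {R d} F w _.

(** * States on the symmetric operator system *)

Section AnalyticStates.
Context {R : realType} {d : nat} (F : fock R d).
Local Notation C := R[i].
Local Notation L := (@fock_L R d F).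
Local Notation Lsym := (@Lsym R d F).
Local Notation polyS := (@polyS R d F).
Local Notation polyS0 := (@polyS0 R d F).
Local Notation GS := (range Lsym).

Lemma GS_bounded : GS `<=` [set T | bounded_op T].
Proof. by move=> _ [n _ <-]; exact: Lsym_bounded. Qed.

Lemma ncSE : ncS F = norm_closure (span GS). Proof. by []. Qed.

Variable mu : (F -> F) -> C.
Hypothesis smu : is_state (ncS F) mu.
Variable P : gns_space (ncS F) mu.
Local Notation cls := (gns_cls P).

Lemma ncS_lin : linear_closed (ncS F).
Proof. exact: (gns_lin ncSE). Qed.

Lemma polyS_ncS p : polyS p -> ncS F p. Proof. exact: norm_closure_in. Qed.

Lemma Lsym_ncS n : ncS F (Lsym n).
Proof. by apply/polyS_ncS/span_in; exists n. Qed.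

Lemma id_ncS : ncS F id.
Proof. exact/polyS_ncS/span_in/id_polyS. Qed.

Lemma iter_rowop_ncS c k : ncS F (iter k (rowop F c)).
Proof.
case: k => [|k]; first exact: id_ncS.
exact/polyS_ncS/polyS0_sub/iter_row_polyS0.
Qed.

Lemma clsS_total (x : P) : closure (span (cls @` GS)) x.
Proof.
exact: (cls_total GS_bounded (@id_polyS R d F) (@Lsym_GG R d F) ncSE smu).
Qed.

Definition clsS_limit := cls_limit GS_bounded (@id_polyS R d F) (@Lsym_GG R d F) ncSE smu (P := P).
Definition clsS_bound := cls_bound GS_bounded (@id_polyS R d F) (@Lsym_GG R d F) ncSE smu P.

(** Expand the class of q_w along w = t c^*: when the terms of degree at most k
    are subtracted and t^(k+1) is divided out, what is left is the class of the
    power of degree k + 1 plus t times a bounded vector.  Let t tend to 0. *)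
Lemma cls_iter_rowop (N : set P) : closed_subspace N ->
  (forall w, cball w -> N (cls (kerop F w) - cls id)) ->
  forall k c, N (cls (iter k.+1 (rowop F c))).
Proof.
move=> cN hN; elim/ltn_ind => k IH c.
have lN := cN.1; have lM := ncS_lin.
pose a : C := 1 + \sum_j `|c j| ^+ 2; pose A := rowop F c.
have s0 : 0 <= \sum_j `|c j| ^+ 2 by apply: sumr_ge0 => j _; rewrite exprn_ge0.
have a1 : 1 <= a by rewrite lerDl.
have a0 : 0 < a by rewrite (lt_le_trans ltr01).
have a0' : 0 <= a by exact: ltW.
have ak i : 0 <= a ^+ i by rewrite exprn_ge0.
have [_ hA] := rowop_bounded F c.
have [K K0 hK] := clsS_bound.
apply: (closed_limit cN) => e e0.
pose D := e * (2 * a) + K * (2 * a ^+ k.+2) + 1.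
have KD0 : 0 <= K * (2 * a ^+ k.+2) by rewrite mulr_ge0 // mulr_ge0 ?ler0n.
have ea0 : 0 <= e * (2 * a) by rewrite mulr_ge0 ?(ltW e0) // mulr_ge0 ?ler0n.
have D0 : 0 < D by rewrite ltr_wpDl // addr_ge0.
have [n hn] := natV_small (divr_gt0 e0 D0).
pose t : C := n.+1%:R^-1; rewrite -/t in hn.
have t0 : 0 < t by rewrite invr_gt0 ltr0Sn.
have tn0 : t != 0 by rewrite gt_eqF.
move: hn; rewrite ltr_pdivlMr // => tD.
have ta : t * a <= 2^-1.
  rewrite -(ler_pM2l (x := 2 * e)) ?mulr_gt0 ?ltr0Sn //.
  have -> : 2 * e * 2^-1 = e by rewrite mulrAC mulfV ?mul1r // pnatr_eq0.
  have -> : 2 * e * (t * a) = t * (e * (2 * a)) by ring.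
  apply: le_trans (ltW tD); rewrite ler_pM2l // /D -addrA lerDl.
  by rewrite addr_ge0.
have tK : t * (K * (2 * a ^+ k.+2)) < e.
  apply: le_lt_trans tD; rewrite ler_pM2l // /D addrAC lerDr.
  by rewrite addr_ge0.
pose w : 'rV[C]_d := \row_j (t * c j)^*.
have wLE : wL F w = t *: A.
  apply/funext => x; rewrite -[RHS]/(t *: rowop F c x) /wL !rowopE scaler_sumr.
  apply: eq_bigr => j _.
  by rewrite mxE conjCK scalerA.
have iterE i x : iter i (wL F w) x = t ^+ i *: iter i A x.
  have lA : linear A by exact: rowop_linear.
  elim: i => [|i IHi]; first by rewrite scale1r.
  by rewrite !iterS IHi wLE -[LHS]/(t *: A _) (linZ lA) scalerA exprS.
have bw : cball w.
  rewrite /cball /= /cdot.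
  have -> : \sum_j w 0 j * (w 0 j)^* = t ^+ 2 * \sum_j `|c j| ^+ 2.
    rewrite mulr_sumr; apply: eq_bigr => j _.
    by rewrite !mxE conjCK mulrC -normCK normrM exprMn (gtr0_norm t0).
  rewrite (@le_lt_trans _ _ ((t * a) ^+ 2)) //.
    by rewrite exprMn ler_wpM2l ?exprn_ge0 ?(ltW t0) // le_sqr1D.
  rewrite (@le_lt_trans _ _ (2^-1 ^+ 2)) //.
    by rewrite lerXn2r ?nnegrE ?mulr_ge0 ?invr_ge0 ?ler0n // ltW.
  by rewrite exprVn invf_lt1 ?exprn_gt0 ?ltr0Sn // -natrX ltr1n.
have [Mq _ sumq _] := kerop_spec F bw.
pose q := kerop F w; pose r : F -> F := iter k.+2 A \o q.
have rE : r = (t ^- k.+2) *: (q - \sum_(i < k.+2) iter i (wL F w)).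
  apply/funext => x; rewrite -[LHS]/(iter k.+2 A (kerop F w x)).
  rewrite -[RHS]/(t ^- k.+2 *: (kerop F w x - (\sum_(i < k.+2) iter i (wL F w)) x)).
  rewrite fct_sumE {2}(sumq k.+2 x) addrC addKr.
  by rewrite iterE scalerA mulVf ?scale1r // expf_neq0.
have Mi i : ncS F (iter i (wL F w)) by exact: iter_rowop_ncS.
have MiA i : ncS F (iter i A) by exact: iter_rowop_ncS.
have Mr : ncS F r.
  rewrite rE; apply: (lin_closedZ _ lM); apply: (lin_closedB lM) => //.
  by apply: lin_closed_sum => [|i _]; [exact: lM|exact: Mi].
have qb x : `|q x| <= 2 * `|x|.
  have := sumq 1%N x; rewrite big_ord1 /= wLE -[(t *: A) _]/(t *: A _) => hq.
  have : `|q x| <= `|x| + 2^-1 * `|q x|.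
    rewrite {1}/q hq (le_trans (ler_normD _ _)) // lerD2l normrZ (gtr0_norm t0).
    rewrite (le_trans (ler_wpM2l (ltW t0) (hA _))) // mulrA.
    by rewrite ler_wpM2r.
  rewrite -lerBlDr -{1}[`|q x|]mul1r -mulrBl.
  have -> : (1 - 2^-1 : C) = 2^-1 by rewrite {1}[1 : C]splitr !mul1r addrK.
  by rewrite mulrC ler_pdivrMr ?ltr0Sn // mulrC.
have itA i x : `|iter i A x| <= a ^+ i * `|x|.
  elim: i => [|i IHi]; first by rewrite expr0 mul1r.
  by rewrite iterS (le_trans (hA _)) // exprS -mulrA ler_wpM2l // ltW.
have rb : `|cls r| <= K * (2 * a ^+ k.+2).
  apply: hK => //; split=> [|x]; first by rewrite mulr_ge0 ?ler0n.
  apply: le_trans (itA _ _) _; rewrite -mulrA mulrCA.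
  by apply: ler_wpM2l => //; exact: qb.
exists (cls (iter k.+1 A) + t *: cls r); last first.
  rewrite opprD addrA subrr add0r normrN normrZ (gtr0_norm t0).
  by rewrite (le_lt_trans _ tK) // ler_wpM2l // ltW.
have -> : cls (iter k.+1 A) + t *: cls r = (t ^- k.+1) *:
    (cls q - cls id - \sum_(i < k) t ^+ i.+1 *: cls (iter i.+1 A)).
  have -> : cls q = cls id + \sum_(i < k) t ^+ i.+1 *: cls (iter i.+1 A)
      + t ^+ k.+1 *: cls (iter k.+1 A) + t ^+ k.+2 *: cls r.
    have -> : q = \sum_(i < k.+2) iter i (wL F w) + t ^+ k.+2 *: r.
      rewrite rE scalerA mulfV ?scale1r ?expf_neq0 //.
      by rewrite addrC subrK.
    have cz i : cls (iter i (wL F w)) = t ^+ i *: cls (iter i A).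
      rewrite -(clsZ ncSE) //; congr (cls _); apply/funext => x.
      exact: iterE.
    rewrite clsD; last 2 first.
    - by apply: lin_closed_sum => [|i _]; [exact: lM|exact: Mi].
    - exact: (lin_closedZ _ lM).
    rewrite (clsZ ncSE) // (cls_sum ncSE) //.
    rewrite big_ord_recr big_ord_recl; congr (_ + _ + _ + _); last exact: cz.
    by apply: eq_bigr => i _; exact: cz.
  set I := cls id; set s := \sum_(i < k) t ^+ i.+1 *: cls (iter i.+1 A).
  set X := cls (iter k.+1 A); set r' := cls r.
  have -> : I + s + t ^+ k.+1 *: X + t ^+ k.+2 *: r' - I - s =
      t ^+ k.+1 *: X + t ^+ k.+2 *: r'.
    by rewrite -addrA -opprD -(addrA (I + s)) addrC addKr.
  rewrite scalerDr !scalerA mulVf ?expf_neq0 // scale1r [t ^+ k.+2]exprSr mulrA.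
  by rewrite mulVf ?expf_neq0 // mul1r.
apply: (lin_closedZ _ lN); apply: (lin_closedB lN); first exact: hN.
by apply: lin_closed_sum => [|i _]; [exact: lN|apply: (lin_closedZ _ lN); apply: IH].
Qed.

Lemma cls_Lsym_extract (N : set P) : closed_subspace N ->
  (forall w, cball w -> N (cls (kerop F w) - cls id)) ->
  forall n, (0 < \sum_i n i)%N -> N (cls (Lsym n)).
Proof.
move=> cN hN n n0; have [k [c [f [hf ->]]]] := Lsym_iter_row F n.
have Mf i : ncS F (f i) by case: (hf i) => g _ <-; exact: iter_rowop_ncS.
rewrite (cls_sum ncSE) => [|i]; last exact: (lin_closedZ _ ncS_lin).
apply: lin_closed_sum => [|i _]; first exact: cN.1.
rewrite (clsZ ncSE) //.
apply: (lin_closedZ _ cN.1); have [g _ <-] := hf i.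
by rewrite -(prednK n0); exact: cls_iter_rowop.
Qed.

(** Quasi-extremality in terms of the classes of the q_w.  That the differences
    lie in the closed span of the classes without constant term is
    [kerop_P2_0]; here the converse inclusion is used. *)
Lemma P2_0_total (x : P) : P2_0 (P:=P) = setT ->
  closure (span [set cls (kerop F w) - cls id | w in cball]) x.
Proof.
move=> qe; set A := [set _ | _ in _].
have : P2_0 (P:=P) x by rewrite qe.
have cN := cspan_closed A; apply: (cspan_min cN) => _ [p Sp <-].
have [k [c [f [hf ->]]]] := Sp.
have Mf i : ncS F (f i) by case: (hf i) => n _ <-; exact: Lsym_ncS.
rewrite (cls_sum ncSE) => [|i]; last exact: (lin_closedZ _ ncS_lin).
apply: lin_closed_sum => [|i _]; first exact: cN.1.
rewrite (clsZ ncSE) //.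
apply: (lin_closedZ _ cN.1); have [n n0 <-] := hf i.
by apply: cls_Lsym_extract => // w bw; apply: cspan_in; exists w.
Qed.


Lemma kerop_P2_0 w : cball w -> P2_0 (P:=P) (cls (kerop F w) - cls id).
Proof.
move=> bw; have [Mq _ _ lim] := kerop_spec F bw.
have cN := cspan_closed (cls @` polyS0).
rewrite -(clsB ncSE) //; last exact: id_ncS.
apply: clsS_limit => //; first by apply: (lin_closedB ncS_lin) => //; exact: id_ncS.
move=> e e0; have [n0 /(_ n0.+1 (leqnSn _)) h] := lim e e0.
have S0p : polyS0 (\sum_(k < n0) iter k.+1 (wL F w)).
  by apply: lin_closed_sum => [|k _]; [exact: span_lin|exact: iter_row_polyS0].
exists (\sum_(k < n0) iter k.+1 (wL F w)); split.
- exact/polyS_ncS/polyS0_sub.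
- by apply: cspan_in; exists (\sum_(k < n0) iter k.+1 (wL F w)).
- move: h; rewrite big_ord_recl opprD addrA; apply.
Qed.

Lemma adj_L_kerop j w : cball w ->
  adj (L j) \o (kerop F w - id) = (w 0 j)^* *: kerop F w.
Proof.
move=> bw; have [_ _ sumq _] := kerop_spec F bw; apply/funext => x /=.
by rewrite !fctE {1}(sumq 1%N x) big_ord1 /= addrC addKr adj_L_row.
Qed.

End AnalyticStates.

(** * The space H(b) and the perturbed Gleason solutions *)

Section Ball.
Context {R : realType} {d : nat}.
Local Notation C := R[i].
Implicit Types v w z : 'rV[C]_d.

Lemma cdotC v w : cdot v w = (cdot w v)^*.
Proof.
rewrite /cdot rmorph_sum; apply: eq_bigr => j _.
by rewrite rmorphM /= conjCK mulrC.
Qed.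

Lemma cdot0r v : cdot v 0 = 0.
Proof. by rewrite /cdot big1 // => j _; rewrite mxE conjC0 mulr0. Qed.
Lemma cdot0l v : cdot 0 v = 0.
Proof. by rewrite /cdot big1 // => j _; rewrite mxE mul0r. Qed.

Lemma cball0 : cball (0 : 'rV[C]_d).
Proof. by rewrite /cball /= cdot0r ltr01. Qed.

Lemma cdot_neq1 v w : cball v -> cball w -> 1 - cdot v w != 0.
Proof.
rewrite /cball /= => hv hw; rewrite subr_eq0; apply/eqP => e1.
have e2 : cdot w v = 1 by rewrite cdotC -e1 conjC1.
have : 0 <= cdot v v - cdot v w - cdot w v + cdot w w.
  have -> : cdot v v - cdot v w - cdot w v + cdot w w =
      \sum_j `|v 0 j - w 0 j| ^+ 2.
    rewrite /cdot -!sumrB -big_split; apply: eq_bigr => j _ /=.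
    rewrite normCK rmorphB /=; ring.
  by apply: sumr_ge0 => j _; rewrite exprn_ge0.
rewrite e2 -e1 => h; have : (2 : C) <= cdot v v + cdot w w.
  by rewrite -subr_ge0; congr (0 <= _): h; ring.
by move=> /le_lt_trans/(_ (ltrD hv hw)); rewrite -mulr2n ltxx.
Qed.
End Ball.

Section ColumnIsometries.
Context {R : realType} {d : nat} {H : hilbertType R}.
Variable Y : 'I_d -> H -> H.
Hypothesis bY : forall j, bounded_op (Y j).

Lemma column_isometricP : column_isometric Y <->
  forall x y, \sum_j inner (Y j x) (Y j y) = inner x y.
Proof.
have E x y : inner ((\sum_j (adj (Y j) \o Y j)) x) y = \sum_j inner (Y j x) (Y j y).
  rewrite fct_sumE inner_suml; apply: eq_bigr => j _ /=.
  by rewrite adjPl.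
split=> [h x y|h]; first by rewrite -E h.
by apply/funext => x; apply: inner_eq => y; rewrite E h.
Qed.

(** On a total set it is enough to check the Gram matrix. *)
Lemma column_isometric_total (A : set H) : (forall x, closure (span A) x) ->
  (forall x y, A x -> A y -> \sum_j inner (Y j x) (Y j y) = inner x y) ->
  column_isometric Y.
Proof.
move=> tA hA; apply: (bounded_eq _ (bounded_id H) tA).
  apply: lin_closed_sum => [|j _]; first exact: bounded_lin_closed.
  exact/bounded_comp/bY/adj_bounded_op/bY.
move=> x Ax; apply/eqP; rewrite -subr_eq0; apply/eqP.
apply: (total_orthogonal tA) => y Ay; apply/eqP.
rewrite innerBl subr_eq0 -(hA x y Ax Ay) fct_sumE inner_suml; apply/eqP.
by apply: eq_bigr => j _ /=; rewrite adjPl.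
Qed.
End ColumnIsometries.

Section DeBrangesRovnyak.
Context {R : realType} {d : nat}.
Local Notation C := R[i].
Variables (b : 'rV[C]_d -> C) (Hb : rkhs cball (db_kernel b)).
Hypothesis b_nc : nonconstant b.
Local Notation k := (rk_ker Hb).

Lemma inner_ker w v : cball w -> cball v ->
  inner (k w) (k v) = (1 - b v * (b w)^*) / (1 - cdot v w).
Proof. by move=> bw bv; rewrite -rk_reproducing // rk_kerE. Qed.

(** The kernel is nonnegative on the diagonal, which gives |b| <= 1.  If
    |b z| = 1, the kernel function at z has norm 0, so it vanishes everywhere
    and b is constant. *)
Lemma b_lt1 z : cball z -> `|b z| < 1.
Proof.
move=> bz; have z0 : 0 < 1 - cdot z z by rewrite subr_gt0; exact: bz.
have := inner_ge0 (k z); rewrite inner_ker // pmulr_lge0 ?invr_gt0 //.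
rewrite subr_ge0 -normCK => h1.
rewrite -(ltr_pXn2r (n := 2)) ?nnegrE ?ler01 // expr1n lt_neqAle h1 andbT.
apply/eqP => e1.
have kz : k z = 0.
  by apply: inner_eq0; rewrite inner_ker // -normCK e1 subrr mul0r.
have bE v : cball v -> b v = b z.
  move=> bv; have := rk_kerE Hb bv bz.
  rewrite kz rk_reproducing // inner0l /db_kernel => /esym/eqP.
  rewrite mulf_eq0 invr_eq0 (negPf (cdot_neq1 bv bz)) orbF subr_eq0 -e1 normCK.
  move=> /eqP/mulIf -> //; apply/eqP => b0; move: e1.
  by rewrite -norm_conjC b0 normr0 expr0n => /eqP; rewrite eq_sym oner_eq0.
by have [u [v [bu bv []]]] := b_nc; rewrite !bE.
Qed.

Section Alpha.
Variable alpha : C.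
Hypothesis alpha1 : `|alpha| = 1.

Lemma alphaV : alpha = (alpha^*)^-1.
Proof.
have := normCK alpha; rewrite alpha1 expr1n => h.
have a0 : alpha^* != 0 by rewrite conjC_eq0 -normr_eq0 alpha1 oner_eq0.
by apply: (mulIf a0); rewrite mulVf.
Qed.

Lemma clark_neq0 w : cball w -> 1 - alpha * (b w)^* != 0.
Proof.
move=> bw; rewrite subr_eq0; apply/eqP => e1.
have := b_lt1 bw; rewrite -[`|b w|]mul1r -{1}alpha1 -(norm_conjC (b w)) -normrM -e1.
by rewrite normr1 ltxx.
Qed.

Lemma clark_neq0' w : cball w -> 1 - alpha^* * b w != 0.
Proof.
move=> bw; rewrite -conjC_eq0 rmorphB rmorph1 rmorphM /= conjCK.
exact: clark_neq0.
Qed.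

(** These are the images of the classes of the q_w under the Fantappie
    transform. *)
Definition clark_ker w : Hb := (1 - alpha * (b w)^*)^-1 *: k w.

(** The right-hand side is half of the sum of the Cayley transform of
    alpha^* b at v and of the conjugate of the one at w.  It is a function of v
    plus a function of w, which is what makes [clark_gram] work. *)
Lemma inner_clark_ker w v : cball w -> cball v ->
  (1 - cdot v w) * inner (clark_ker w) (clark_ker v) =
  (1 - alpha * (b w)^*)^-1 + (1 - alpha^* * b v)^-1 - 1.
Proof.
move=> bw bv; rewrite /clark_ker innerZl innerZr inner_ker //.
rewrite fmorphV rmorphB rmorph1 rmorphM /= conjCK.
have := clark_neq0 bw; have := clark_neq0' bv; have := cdot_neq1 bv bw.
have a0 : alpha^* != 0 by rewrite conjC_eq0 -normr_eq0 alpha1 oner_eq0.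
have := alphaV; move: (alpha^*) a0 => a a0 -> n1 n2 n3.
have n3' : a - (b w)^* != 0.
  have -> : a - (b w)^* = a * (1 - a^-1 * (b w)^*) by rewrite mulrBr mulr1 mulVKf.
  by rewrite mulf_neq0.
field. by rewrite n1 n2 a0 n3'.
Qed.

Lemma clark_gram w v : cball w -> cball v ->
  inner (clark_ker w - clark_ker 0) (clark_ker v - clark_ker 0) =
  cdot v w * inner (clark_ker w) (clark_ker v).
Proof.
move=> bw bv; have b0 := @cball0 R d.
have e1 := inner_clark_ker bw bv; have e2 := inner_clark_ker bw b0.
have e3 := inner_clark_ker b0 bv; have e4 := inner_clark_ker b0 b0.
move: e2 e3 e4; rewrite !(cdot0l, cdot0r) subr0 !mul1r => e2 e3 e4.
rewrite innerBl !innerBr e2 e3 e4; move/eqP: e1; rewrite -subr_eq0 => /eqP e1.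
by apply/eqP; rewrite -subr_eq0 -e1; apply/eqP; ring.
Qed.

Variables (X : 'I_d -> Hb -> Hb) (bs : 'I_d -> Hb).
Hypothesis bX : forall j, bounded_op (X j).
Hypothesis hbs : gleason_functions X bs.
Local Notation Y := (perturbation X bs alpha).

Lemma perturbationE j f :
  Y j f = X j f + (alpha^* / (1 - alpha^* * b 0) * inner f (k 0)) *: bs j.
Proof.
by rewrite -scalerA.
Qed.

Lemma tens_bounded (u v : Hb) : bounded_op (tens u v).
Proof.
apply/bounded_opP; split=> [a x y|].
  by rewrite /tens innerDl innerZl scalerDl scalerA.
exists (`|v| * `|u|); split=> [|x]; first by rewrite mulr_ge0.
rewrite /tens normrZ mulrAC ler_wpM2r // mulrC.
exact: CauchySchwarz_inner.
Qed.

Lemma perturbation_bounded j : bounded_op (Y j).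
Proof.
rewrite /perturbation addrC; apply: (bounded_lin_closed Hb Hb).2; last exact: bX.
exact: tens_bounded.
Qed.

Lemma perturbation_clark_ker j w : cball w -> Y j (clark_ker w) =
  (w 0 j)^* *: clark_ker w + (alpha^* / (1 - alpha^* * b 0)) *: bs j.
Proof.
move=> bw; have [lX _] := bX j; rewrite perturbationE /clark_ker (linZ lX) hbs //.
have b0 := @cball0 R d.
rewrite innerZl inner_ker // cdot0l subr0 divr1 scalerBr !scalerA -addrA.
rewrite [_^-1 * (w 0 j)^*]mulrC -scaleNr -scalerDl; congr (_ + _ *: _).
have := clark_neq0 bw; have := clark_neq0' b0.
have a0 : alpha^* != 0 by rewrite conjC_eq0 -normr_eq0 alpha1 oner_eq0.
have := alphaV; move: (alpha^*) a0 => a a0 -> n2 n3.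
have n3' : a - (b w)^* != 0.
  have -> : a - (b w)^* = a * (1 - a^-1 * (b w)^*) by rewrite mulrBr mulr1 mulVKf.
  by rewrite mulf_neq0.
field. by rewrite n2 a0 n3'.
Qed.

(** On K_w the perturbation is multiplication by w_j^* up to a vector that does
    not depend on w, and the difference removes that vector. *)
Lemma perturbation_clark_diff j w : cball w ->
  Y j (clark_ker w - clark_ker 0) = (w 0 j)^* *: clark_ker w.
Proof.
move=> bw; have [lY _] := perturbation_bounded j.
rewrite (linB lY) !perturbation_clark_ker //; last exact: cball0.
by rewrite mxE conjC0 scale0r add0r addrK.
Qed.

Definition clark_diffs : set Hb := [set clark_ker w - clark_ker 0 | w in cball].

Lemma perturbation_isometric : (forall f, closure (span clark_diffs) f) ->
  column_isometric Y.
Proof.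
move=> tA; apply: (column_isometric_total perturbation_bounded tA).
move=> _ _ [w bw <-] [v bv <-]; rewrite clark_gram //.
rewrite /cdot mulr_suml; apply: eq_bigr => j _.
by rewrite !perturbation_clark_diff // innerZl innerZr conjCK mulrA [_^* * _]mulrC.
Qed.
End Alpha.

Section ChangeOfAlpha.
Variables (X : 'I_d -> Hb -> Hb) (bs : 'I_d -> Hb) (alpha : C).
Hypothesis bX : forall j, bounded_op (X j).
Hypothesis hbs : gleason_functions X bs.
Hypothesis alpha1 : `|alpha| = 1.
Hypothesis total1 : forall f, closure (span (clark_diffs 1)) f.

Let norm1 : `|1 : C| = 1 := normr1 C.
(* Changing the parameter multiplies the perturbation on the right by the
   unitary [rot], which is a rotation in the direction of the kernel at 0. *)
Let tau : C := (alpha^* / (1 - alpha^* * b 0) - 1 / (1 - b 0)) *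
  ((1 - b 0) / (1 - (b 0)^*)).
Let rot (f : Hb) : Hb := f + (tau * inner f (k 0)) *: k 0.

Lemma perturbation_rot j f : perturbation X bs alpha j f =
  perturbation X bs 1 j (rot f).
Proof.
have b0 := @cball0 R d; have [lY _] := perturbation_bounded 1 bs bX j.
have bsE : perturbation X bs 1 j (k 0) = ((1 - (b 0)^*) / (1 - b 0)) *: bs j.
  have := perturbation_clark_ker norm1 bX hbs j b0.
  rewrite mxE conjC0 scale0r add0r /clark_ker (linZ lY) conjC1 !mul1r.
  have := clark_neq0 norm1 b0; rewrite mul1r => n0 /(congr1 (fun x => (1 - (b 0)^*) *: x)).
  by rewrite !scalerA mulfV // scale1r.
rewrite /rot (linD lY) (linZ lY) bsE scalerA !perturbationE -addrA -scalerDl.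
congr (_ + _ *: _); rewrite conjC1 !mul1r.
have := clark_neq0 norm1 b0; have := clark_neq0' norm1 b0; have := clark_neq0' alpha1 b0.
rewrite conjC1 !mul1r /tau => n1 n2 n3.
by field; rewrite n1 n2 n3.
Qed.

Lemma rot_isometric f g : inner (rot f) (rot g) = inner f g.
Proof.
have b0 := @cball0 R d.
rewrite /rot innerDl !innerDr !innerZl !innerZr !inner_ker // cdot0l subr0 divr1.
rewrite (innerC (k 0) g) (_ : (tau * inner g (k 0))^* = tau^* * (inner g (k 0))^*);
  last exact: rmorphM.
set x := inner f (k 0).
set y := (inner g (k 0))^*; set z := inner f g.
have a0 : alpha^* != 0 by rewrite conjC_eq0 -normr_eq0 alpha1 oner_eq0.
have tauC : tau^* = (alpha / (1 - alpha * (b 0)^*) - 1 / (1 - (b 0)^*)) *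
    ((1 - (b 0)^*) / (1 - b 0)).
  by rewrite /tau !(rmorphM, rmorphB, fmorphV, rmorph1) /= !conjCK.
suff h : tau + tau^* + tau * tau^* * (1 - b 0 * (b 0)^*) = 0.
  rewrite -[RHS]addr0 -(mul0r (x * y)) -h; ring.
rewrite tauC /tau.
have := clark_neq0 norm1 b0; have := clark_neq0' norm1 b0.
have := clark_neq0' alpha1 b0; have := clark_neq0 alpha1 b0.
rewrite conjC1 !mul1r.
have := alphaV alpha1; move: (alpha^*) a0 => a a0 -> n3 n2 n1 n0.
have n3' : a - (b 0)^* != 0.
  have -> : a - (b 0)^* = a * (1 - a^-1 * (b 0)^*) by rewrite mulrBr mulr1 mulVKf.
  by rewrite mulf_neq0.
by field; rewrite n0 n1 n2 a0 n3'.
Qed.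

Lemma perturbation_isometric_all : column_isometric (perturbation X bs alpha).
Proof.
apply/(column_isometricP (perturbation_bounded alpha bs bX)) => f g.
have := perturbation_isometric norm1 bX hbs total1.
move/(column_isometricP (perturbation_bounded 1 bs bX)) => h.
under eq_bigr do rewrite !perturbation_rot.
by rewrite h rot_isometric.
Qed.

(** If f is orthogonal to the differences at alpha, the column Y f at alpha is
    orthogonal to all columns with entries w_j^* k_w.  These do not depend on
    alpha up to scalars, and at parameter 1 they span the range of Y, which also
    contains the column Y f at alpha by [perturbation_rot].  Hence that column
    is 0, and so is f. *)
Lemma clark_diffs_total f : closure (span (clark_diffs alpha)) f.
Proof.
move: f; apply: orthogonal_total => f hf.
have b0 := @cball0 R d.
have /(column_isometricP (perturbation_bounded alpha bs bX)) hA :=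
  perturbation_isometric_all.
have /(column_isometricP (perturbation_bounded 1 bs bX)) h1 :=
  perturbation_isometric norm1 bX hbs total1.
suff r0 : rot f = 0 by apply: inner_eq0; rewrite -rot_isometric r0 inner0l.
apply: (total_orthogonal total1) => _ [w bw <-].
have := hf _ (ex_intro2 _ _ w bw erefl); rewrite -hA.
under eq_bigr do rewrite (perturbation_clark_diff alpha1 bX hbs _ bw).
rewrite -h1 => h.
under eq_bigr do rewrite -perturbation_rot (perturbation_clark_diff norm1 bX hbs _ bw).
have na := clark_neq0 alpha1 bw.
have -> : clark_ker 1 w = ((1 - 1 * (b w)^*)^-1 * (1 - alpha * (b w)^*)) *: clark_ker alpha w.
  by rewrite /clark_ker scalerA mulfK.
apply/eqP; rewrite -[X in X == _]conjCK conjC_eq0.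
under eq_bigr do rewrite scalerA mulrC -scalerA innerZr.
by rewrite -mulr_sumr h mulr0 conjC0.
Qed.
End ChangeOfAlpha.
End DeBrangesRovnyak.

Arguments clark_diffs {R d b} Hb alpha _.

(** * The Fantappie transform *)

Section Unitaries.
Context {R : realType}.
Implicit Types H K : hilbertType R.

Lemma unitary_bounded H K (U : H -> K) : unitary U -> bounded_op U.
Proof. by move=> [lU iU _]; apply: isometry_bounded. Qed.

Lemma unitary_total H K (U : H -> K) (A : set H) : unitary U ->
  (forall x, closure (span A) x) <-> (forall y, closure (span (U @` A)) y).
Proof.
move=> [lU iU sU]; split=> tA; apply: orthogonal_total => x hx.
  have [u uE] := sU x; rewrite -uE; suff -> : u = 0 by exact: lin0.
  apply: (total_orthogonal tA) => a Aa; rewrite -iU uE.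
  by apply: hx; exists a.
apply: inner_eq0; rewrite -iU; suff -> : U x = 0 by rewrite inner0l.
by apply: (total_orthogonal tA) => _ [a Aa <-]; rewrite iU; exact: hx.
Qed.

Lemma oproj_setT H (x : H) : oproj setT x = x.
Proof.
rewrite /oproj; case: xgetP => [y _ [_ /(_ (x - y) I)/inner_eq0/eqP]|].
  by rewrite subr_eq0 => /eqP ->.
by move=> /(_ x); case; split=> // m _; rewrite subrr inner0l.
Qed.
End Unitaries.

Section Fantappie.
Context {R : realType} {d : nat} (F : fock R d).
Local Notation C := R[i].
Local Notation L := (@fock_L R d F).
Local Notation polyS := (@polyS R d F).
Local Notation polyS0 := (@polyS0 R d F).
Variables (b : 'rV[C]_d -> C) (Hb : rkhs cball (db_kernel b)).
Hypothesis b_nc : nonconstant b.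
Variable alpha : C.
Hypothesis alpha1 : `|alpha| = 1.
Variable mu : (F -> F) -> C.
Hypothesis smu : is_state (ncS F) mu.
Variable P : gns_space (ncS F) mu.
Local Notation cls := (gns_cls P).
Variable V : P -> Hb.
Hypothesis hV : fantappie alpha V.

(** Reproducing property: for p in the span of the L^(n), the value of V [p] at
    w is a multiple of <[p], [q_w]>. *)
Lemma V_kerop w : cball w -> V (cls (kerop F w)) = clark_ker Hb alpha w.
Proof.
move=> bw; have [uV VE] := hV; have [lV iV sV] := uV.
have [Mq resE _ _] := kerop_spec F bw.
have n0 := clark_neq0 Hb b_nc alpha1 bw.
rewrite /clark_ker; apply: (canRL (scalerK n0)).
apply/eqP; rewrite -subr_eq0; apply/eqP.
have /(unitary_total _ uV) tA := @clsS_total R d F mu smu P.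
apply: (total_orthogonal tA) => _ [_ [p Gp <-] <-].
have Sp : polyS p by exact: span_in.
rewrite innerC innerBr innerZr -rk_reproducing // VE // iV gns_cls_inner //; last first.
  exact: polyS_ncS.
have -> : (1 - alpha * (b w)^*)^* = 1 - alpha^* * b w.
  by rewrite rmorphB rmorph1 rmorphM /= conjCK.
by rewrite resE subrr conjC0.
Qed.

Lemma V_kerop_diff w : cball w ->
  V (cls (kerop F w) - cls id) = clark_ker Hb alpha w - clark_ker Hb alpha 0.
Proof.
move=> bw; have [[lV _ _] _] := hV; rewrite (linB lV) V_kerop //.
congr (_ - _); rewrite -V_kerop; last exact: cball0.
congr (V (cls _)); apply/funext => x.
have [_ _ sumq _] := kerop_spec F (@cball0 R d); rewrite (sumq 1%N x) big_ord1 /=.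
by rewrite /wL rowopE big1 ?addr0 // => j _; rewrite mxE conjC0 scale0r.
Qed.

Lemma V_kerop_diffs :
  V @` [set cls (kerop F w) - cls id | w in cball] = clark_diffs Hb alpha.
Proof.
apply/seteqP; split=> [_ [_ [w bw <-] <-]|_ [w bw <-]].
  by exists w => //; rewrite V_kerop_diff.
exists (cls (kerop F w) - cls id); first by exists w.
exact: V_kerop_diff.
Qed.

Lemma quasi_extreme_clark :
  quasi_extreme P <-> forall f, closure (span (clark_diffs Hb alpha)) f.
Proof.
have [uV _] := hV; rewrite -V_kerop_diffs; apply: (iff_trans _ (unitary_total _ uV)).
split=> [qe x|tA]; first exact: P2_0_total.
apply/seteqP; split=> // x _; apply: (cspan_min _ _ (tA x)).
  exact: cspan_closed.
by move=> _ [w bw <-]; exact: kerop_P2_0.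
Qed.

Section GnsTuple.
Hypothesis qe : quasi_extreme P.
Variable S : 'I_d -> P -> P.
Hypothesis hS : P2_gns_tuple S.

Lemma S_bounded j : bounded_op (S j). Proof. by have [] := hS j. Qed.

Lemma adjS_polyS0 j p : polyS0 p -> adj (S j) (cls p) = cls (adj (L j) \o p).
Proof.
move=> Sp; have [_ _ hp] := hS j; rewrite hp //.
by move: qe; rewrite /quasi_extreme => ->; exact: oproj_setT.
Qed.

Lemma adj_L_le j x : `|adj (L j) x| <= `|x|.
Proof.
have iL y : `|L j y| <= 1 * `|y|.
  have : `|L j y| = `|y|.
    apply: isometry_norm => u v; by rewrite inner_LL eqxx mul1r.
  by move=> ->; rewrite mul1r.
have [_ h] := adj_bounded (@L_linear R d F j) (conj ler01 iL).
by rewrite -[leRHS]mul1r; exact: h.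
Qed.

(** q_w - I is only a norm limit of polynomials without constant term, so the
    defining formula of the adjoints is needed for such limits. *)
Lemma adjS_limit j p : ncS F p -> ncS F (adj (L j) \o p) ->
  (forall e : C, 0 < e -> exists2 q, polyS0 q & bounded_by (p - q) e) ->
  adj (S j) (cls p) = cls (adj (L j) \o p).
Proof.
move=> Mp MLp hp; apply: normB_eq0 => e e0.
have [lA [M [M0 hM]]] := (bounded_opP _).1 (adj_bounded_op (S_bounded j)).
have [K K0 hK] := clsS_bound smu P.
have D0 : 0 < (M + 1) * K + 1 by rewrite ltr_wpDl // mulr_ge0 // addr_ge0.
have [q Sq pq] := hp _ (divr_gt0 e0 D0).
have Mq : ncS F q by exact/polyS_ncS/polyS0_sub.
have MLq : ncS F (adj (L j) \o q) by apply: polyS_ncS; case: (polyS0_rec Sq).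
have -> : adj (S j) (cls p) - cls (adj (L j) \o p) =
    adj (S j) (cls (p - q)) + cls ((adj (L j) \o q) - (adj (L j) \o p)).
  rewrite !(clsB (ncSE F)) // (linB lA) (adjS_polyS0 j Sq).
  by rewrite addrA subrK.
have h1 : `|cls (p - q)| <= K * (e / ((M + 1) * K + 1)).
  by apply: hK => //; apply: (lin_closedB (ncS_lin F)).
have h2 : `|cls ((adj (L j) \o q) - (adj (L j) \o p))| <= K * (e / ((M + 1) * K + 1)).
  apply: hK; first exact: (lin_closedB (ncS_lin F)).
  have [e1 hpq] := pq; split=> // x; rewrite !fctE /= distrC.
  have lL := adj_linear (fock_L_bounded F j).
  by rewrite -(linB lL); exact: le_trans (adj_L_le j _) (hpq x).
rewrite (le_trans (ler_normD _ _)) //.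
rewrite (le_trans (lerD (le_trans (hM _) (ler_wpM2l M0 h1)) h2)) //.
have -> : M * (K * (e / ((M + 1) * K + 1))) + K * (e / ((M + 1) * K + 1)) =
    ((M + 1) * K) * e / ((M + 1) * K + 1) by ring.
by rewrite ler_pdivrMr // mulrC ler_wpM2l ?lerDl // ltW.
Qed.

Lemma adjS_kerop j w : cball w ->
  adj (S j) (cls (kerop F w) - cls id) = (w 0 j)^* *: cls (kerop F w).
Proof.
move=> bw; have [Mq _ _ lim] := kerop_spec F bw.
have Mid := id_ncS F.
have MLq : ncS F (adj (L j) \o (kerop F w - id)).
  by rewrite adj_L_kerop //; apply: (lin_closedZ _ (ncS_lin F)).
rewrite -(clsB (ncSE F)) // adjS_limit //; last 1 first.
- move=> e e0; have [n0 /(_ n0.+1 (leqnSn _)) h] := lim e e0.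
  exists (\sum_(k < n0) iter k.+1 (wL F w)).
    by apply: lin_closed_sum => [|k _]; [exact: span_lin|exact: iter_row_polyS0].
  by move: h; rewrite big_ord_recl opprD addrA; apply.
- by rewrite adj_L_kerop // (clsZ (ncSE F)).
exact: (lin_closedB (ncS_lin F)).
Qed.

Variables (X : 'I_d -> Hb -> Hb) (bs : 'I_d -> Hb).
Hypothesis bX : forall j, bounded_op (X j).
Hypothesis hbs : gleason_functions X bs.

(** Both sides send [q_w] - [I] to w_j^* K_w, and these differences are
    total. *)
Lemma V_intertwines j : V \o adj (S j) = perturbation X bs alpha j \o V.
Proof.
have [uV _] := hV; have bV := unitary_bounded uV; have [lV _] := bV.
have tA (x : P) : closure (span [set cls (kerop F w) - cls id | w in cball]) x.
  exact: P2_0_total.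
apply: (bounded_eq _ _ tA).
- exact/bounded_comp/adj_bounded_op/S_bounded.
- exact/bounded_comp/bV/perturbation_bounded.
move=> _ [w bw <-] /=; rewrite adjS_kerop // (linZ lV) V_kerop // V_kerop_diff //.
by rewrite perturbation_clark_diff.
Qed.
End GnsTuple.
End Fantappie.

(** * Cyclic vectors of backward shifts *)

Section WordOperators.
Context {R : realType} {d : nat} {H : hilbertType R}.
Variable T : 'I_d -> H -> H.
Hypothesis bT : forall j, bounded_op (T j).

Lemma word_op_cat u v x : word_op T (u ++ v) x = word_op T u (word_op T v x).
Proof. by elim: u => [|j u IH] //=; rewrite IH. Qed.

Lemma word_op_rcons u j x : word_op T (rcons u j) x = word_op T u (T j x).
Proof. by rewrite -cats1 word_op_cat. Qed.

Definition orbit_span (h : H) : set H :=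
  closure (span [set word_op T w h | w in [set: seq 'I_d]]).

Lemma orbit_span_in w h : orbit_span h (word_op T w h).
Proof. by apply: cspan_in; exists w. Qed.

Lemma orbit_span_inv j h x : orbit_span h x -> orbit_span h (T j x).
Proof.
have cM := closed_subspace_preimage (bT j)
  (cspan_closed [set word_op T w h | w in [set: seq 'I_d]]).
move=> hx; apply: (cspan_min cM _ hx) => _ [w _ <-].
exact: (@orbit_span_in (j :: w) h).
Qed.

Lemma orbit_span_word w h x : orbit_span h x -> orbit_span h (word_op T w x).
Proof. by move=> hx; elim: w => [|j w IH] //=; exact: orbit_span_inv. Qed.
End WordOperators.

Section FastSeries.
Context {R : realType} {H : hilbertType R}.
Local Notation C := R[i].

Lemma pow2V_small (e : C) : 0 < e -> exists n : nat, forall m : nat, (n <= m)%N ->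
  (2 ^+ m)^-1 < e.
Proof.
move=> e0; have h0 : (0 : C) <= 2^-1 by rewrite invr_ge0 ler0n.
have h1 : (2^-1 : C) < 1 by rewrite invf_lt1 ?ltr0Sn // ltr1n.
have [n hn] := expr_small h0 h1 e0; exists n => m nm.
by rewrite -exprVn (le_lt_trans _ hn) // ler_wiXn2l // ltW.
Qed.

(** Coefficients that decay so fast that each one dominates the whole tail that
    follows it, however fast [v] grows. *)
Lemma fast_series (v : nat -> H) : exists (eta : nat -> C) (u : H),
  [/\ forall i, 0 < eta i, closure (span (range v)) u &
  forall i, `|u - \sum_(k < i.+1) eta k *: v k| <= eta i * (2 ^+ i)^-1].
Proof.
pose fix eta (i : nat) : C :=
  if i is i'.+1 then eta i' * (2 ^+ i'.+2)^-1 * (1 + `|v i'.+1|)^-1 else 1.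
have eta0 i : 0 < eta i.
  elim: i => [|i IH] /=; first exact: ltr01.
  by rewrite !mulr_gt0 // invr_gt0 ?exprn_gt0 ?ltr0Sn // ltr_wpDr.
have etaS i : eta i.+1 <= eta i.
  rewrite /= -mulrA ger_pMr // mulr_ile1 ?invr_ge0 ?exprn_ge0 ?ler0n ?addr_ge0 //.
    by rewrite invf_le1 ?exprn_gt0 ?ltr0Sn // exprn_ege1 // ler1n.
  by rewrite invf_le1 ?lerDl // ltr_wpDr.
have eta_le i j : (i <= j)%N -> eta j <= eta i.
  elim: j => [|j IH]; first by rewrite leqn0 => /eqP ->.
  rewrite leq_eqVlt => /orP[/eqP -> //|]; rewrite ltnS => /IH.
  exact/le_trans.
pose s (n : nat) := \sum_(k < n) eta k *: v k.
have term i : `|eta i.+1 *: v i.+1| <= eta i * (2 ^+ i.+2)^-1.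
  rewrite normrZ gtr0_norm // -[eta i.+1]/(eta i * (2 ^+ i.+2)^-1 * _) -!mulrA mulrA.
  apply: ler_piMr.
    by rewrite mulr_ge0 ?invr_ge0 ?exprn_ge0 ?ler0n ?(ltW (eta0 _)).
  by rewrite mulrC ler_pdivrMr ?ltr_wpDr // mul1r lerDr.
have tail i m : `|s (i.+1 + m)%N - s i.+1| <= eta i * ((2 ^+ i.+1)^-1 - (2 ^+ (i.+1 + m))^-1).
  elim: m => [|m IH]; first by rewrite addn0 !subrr normr0 mulr0.
  rewrite addnS {1}/s big_ord_recr /= -/(s (i + m).+1) -addSn addrAC.
  rewrite (le_trans (ler_normD _ _)) // (le_trans (lerD IH (term _))) //.
  rewrite (le_trans (lerD (lexx _) (ler_wpM2r _ (eta_le i (i + m)%N (leq_addr _ _))))) ?invr_ge0 ?exprn_ge0 ?ler0n //.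
  rewrite -mulrDr ler_wpM2l ?(ltW (eta0 i)) // -addrA lerD2l.
  rewrite -subr_ge0 le_eqVlt; apply/orP; left; apply/eqP.
  rewrite !addSn [2 ^+ (i + m).+2]exprS.
  have h : (2 : C) ^+ (i + m).+1 != 0 by rewrite expf_neq0 // pnatr_eq0.
  by field; rewrite h ?pnatr_eq0.
have tail1 i m : `|s (i.+1 + m)%N - s i.+1| <= eta i * (2 ^+ i.+1)^-1.
  rewrite (le_trans (tail i m)) // ler_wpM2l ?(ltW (eta0 i)) // gerBl.
  by rewrite invr_ge0 exprn_ge0 ?ler0n.
have eta1 i : eta i <= 1 by exact: (eta_le 0%N).
have [|u hu] := cauchy_seq_cvg (u := s).
  move=> e e0; have [n hn] := pow2V_small (ltC_half e0); exists n.+1.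
  have aux m : (n < m)%N -> `|s m - s n.+1| < e / 2.
    move=> nm; rewrite -(subnKC nm) (le_lt_trans (tail1 _ _)) //.
    rewrite (le_lt_trans _ (hn n.+1 (leqnSn n))) //.
    by rewrite ger_pMl ?invr_gt0 ?exprn_gt0 ?ltr0Sn.
  move=> m m' nm nm'; rewrite -(subrK (s n.+1) (s m)) -addrA.
  rewrite (le_lt_trans (ler_normD _ _)) // [ltRHS]splitr ltrD ?aux //.
  by rewrite distrC aux.
exists eta, u; split=> // [|i].
  have cN := cspan_closed (range v).
  apply: (closed_limit cN) => e e0; have [N hN] := hu e e0.
  exists (s N); last by rewrite distrC hN.
  apply: lin_closed_sum => [|k _]; first exact: cN.1.
  by apply: (lin_closedZ _ cN.1); apply: cspan_in; exists k.
rewrite -/(s i.+1).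
have [|N hN] := hu (eta i * (2 ^+ i.+1)^-1).
  by rewrite mulr_gt0 // invr_gt0 exprn_gt0 ?ltr0Sn.
have := hN (i.+1 + N)%N (leq_addl _ _) => lt1.
rewrite -(subrK (s (i.+1 + N)%N) u) -addrA (le_trans (ler_normD _ _)) //.
have -> : (2 ^+ i)^-1 = (2 ^+ i.+1)^-1 + (2 ^+ i.+1)^-1 :> C.
  have h : (2 : C) ^+ i != 0 by rewrite expf_neq0 // pnatr_eq0.
  by rewrite exprS; field; rewrite h ?pnatr_eq0.
by rewrite mulrDr lerD // distrC ltW.
Qed.
End FastSeries.

(** The families considered here behave like the classes of the L^(n) under the
    adjoints of the GNS tuple: [T j] lowers the j-th index, and kills the vectors
    whose j-th index is 0, except that its value on [e 0] is arbitrary.  So the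
    [T j] commute only up to the vectors [T j (e 0)]. *)
Section Cyclic.
Context {R : realType} {d : nat} {H : hilbertType R}.
Variables (T : 'I_d -> H -> H) (e : ('I_d -> nat) -> H).
Hypothesis bT : forall j, bounded_op (T j).
Hypothesis cT : forall j x, `|T j x| <= `|x|.
Hypothesis Te : forall j n, (0 < \sum_i n i)%N ->
  T j (e n) = if (0 < n j)%N then e (dec_at j n) else 0.
Hypothesis te : forall x, closure (span (range e)) x.

Let T0 j : T j 0 = 0. Proof. exact: (lin0 (bT j).1). Qed.

Lemma word_op_le w x : `|word_op T w x| <= `|x|.
Proof. by elim: w => [|j w IH] //=; exact: le_trans (cT _ _) IH. Qed.

Lemma word_op_sub w n : (forall i, count_mem i w <= n i)%N ->
  word_op T w (e n) = e (fun i => n i - count_mem i w)%N.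
Proof.
elim: w => [|j w IH] hw /=.
  by congr e; apply/funext => i; rewrite subn0.
have hj i : (count_mem i w <= n i)%N.
  by apply: leq_trans (hw i); rewrite /= leq_addl.
have nj : (0 < n j - count_mem j w)%N.
  by rewrite subn_gt0; apply: leq_trans (hw j); rewrite /= eqxx.
rewrite IH // Te; last by rewrite (bigD1 j) //= addn_gt0 nj.
rewrite nj; congr e; apply/funext => i; rewrite /dec_at.
by rewrite -subnDA addnC [j == i]eq_sym.
Qed.

(** A word longer than the degree of [e n] passes through [e 0] before it is
    used up, unless it kills the vector. *)
Lemma word_op_past (Z : set H) w n : (0 < d)%N ->
  Z 0 -> (forall j x, Z x -> Z (T j x)) -> (forall j, Z (T j (e (fun=> 0%N)))) ->
  (\sum_i n i < size w)%N -> Z (word_op T w (e n)).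
Proof.
move=> d0 Z0 ZT Ze; have Zw w' x : Z x -> Z (word_op T w' x).
  by move=> Zx; elim: w' => [|j w' IH] //=; exact: ZT.
elim/last_ind: w n => [|w j IH] n //.
rewrite size_rcons ltnS word_op_rcons; have [n0 _|n0 nw] := posnP (\sum_i n i)%N.
  have -> : n = (fun=> 0%N).
    apply/funext => i; apply/eqP; move/eqP: n0.
    by rewrite sum_nat_eq0 => /forallP/(_ i).
  exact: Zw.
rewrite Te //; case: ifP => nj; last first.
  by apply: Zw.
by apply: IH; rewrite -(sum_dec_at nj).
Qed.

Lemma shift_comm i k n : (1 < \sum_i n i)%N ->
  T i (T k (e n)) = T k (T i (e n)).
Proof.
move=> n1; have n0 := ltnW n1.
have [->//|ik] := eqVneq i k.
have aux a c : a != c -> T a (T c (e n)) =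
    if (0 < n a)%N && (0 < n c)%N then e (dec_at a (dec_at c n)) else 0.
  move=> ac; rewrite Te //; case: ifP => nc; last by rewrite andbF T0.
  rewrite Te; last by move: n1; rewrite (sum_dec_at nc) ltnS.
  by rewrite andbT {1}/dec_at (negPf ac) subn0.
rewrite !aux // 1?eq_sym // andbC; case: ifP => // _.
by congr e; apply/funext => l; rewrite /dec_at -!subnDA addnC.
Qed.

(** The vector h is the sum of the [e (2 delta_j)] and of a series
    sum_i eta_i e(lam_i) with lam_i constant equal to 2^(i+2).  Let Z be the
    closed invariant subspace that it generates.
    - For i <> k, the operator [T_i, T_k] T_k kills every [e n] of degree at
      least 3 and every [e (2 delta_j)] with j <> k, and it sends
      [e (2 delta_k)] to T_i e(0).  So Z contains all T_i e(0); this needs two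
      different indices.
    - Modulo these vectors, a word with letter counts lam_i - n maps h to
      eta_i (e(n) + small): the terms of low degree are used up, and the later
      ones are small compared with eta_i because T is contractive.  Letting i
      grow gives e(n) in Z. *)
Lemma cyclic_shift_gt1 : (1 < d)%N -> exists h, forall x, orbit_span T h x.
Proof.
move=> d1; have d0 := ltnW d1.
pose lam (i : nat) : 'I_d -> nat := fun=> (2 ^ i.+2)%N.
pose dbl (j : 'I_d) : 'I_d -> nat := fun i => (2 * (i == j))%N.
have sum_lam i : (\sum_j lam i j = d * 2 ^ i.+2)%N by rewrite sum_nat_const card_ord.
have sum_dbl j : (\sum_i dbl j i = 2)%N.
  by rewrite (bigD1 j) //= /dbl eqxx big1 // => i /negPf ->.
have [eta [u [eta0 hu tail]]] := fast_series (fun i => e (lam i)).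
pose h := \sum_j e (dbl j) + u; exists h.
pose Z := orbit_span T h; have cZ : closed_subspace Z by exact: cspan_closed.
have ZT j x : Z x -> Z (T j x) by exact: orbit_span_inv.
have Zh : Z h by exact: (@orbit_span_in _ _ _ T [::] h).
have Ze0 i : Z (T i (e (fun=> 0%N))).
  have [k ki] : exists k : 'I_d, k != i.
    have [->|i0] := eqVneq i (Ordinal d0); first by exists (Ordinal d1).
    by exists (Ordinal d0); rewrite eq_sym.
  pose D x := T i (T k (T k x)) - T k (T i (T k x)).
  have bD : bounded_op D.
    have b1 : bounded_op (T i \o (T k \o T k)) by apply/bounded_comp/bounded_comp.
    have b2 : bounded_op (T k \o (T i \o T k)) by apply/bounded_comp/bounded_comp.
    have := (bounded_lin_closed H H).2 (-1) _ _ b2 b1.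
    by rewrite scaleN1r addrC.
  have lD := bD.1.
  (* All terms of the series have degree at least 3. *)
  have D3 n : (2 < \sum_l n l)%N -> D (e n) = 0.
    move=> n2; rewrite /D Te ?(ltnW (ltnW n2)) //; case: ifP => nk.
      by rewrite shift_comm ?subrr //; move: n2; rewrite (sum_dec_at nk).
    by rewrite !T0 subrr.
  have Du : D u = 0.
    apply: (cspan_min (closed_subspace_preimage bD (set0_closed H)) _ hu).
    move=> _ [n _ <-] /=; apply: D3; rewrite sum_lam.
    by apply: leq_trans (leq_pmull _ d0); apply: leq_ltn_trans (ltn_expl n.+2 (ltnSn 1)).
  have Ddbl j : j != k -> D (e (dbl j)) = 0.
    move=> jk; rewrite /D Te ?sum_dbl // /dbl eq_sym (negPf jk) muln0 /=.
    by rewrite !T0 subrr.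
  have Dk : D (e (dbl k)) = T i (e (fun=> 0%N)).
    pose one : 'I_d -> nat := fun l => (l == k).
    have one1 : (\sum_l one l = 1)%N.
      by rewrite (bigD1 k) //= /one eqxx big1 // => l /negPf ->.
    have E1 : T k (e (dbl k)) = e one.
      rewrite Te ?sum_dbl // /dbl eqxx /=; congr e; apply/funext => l.
      by rewrite /dec_at /one; case: (l == k).
    have ok : one k = 1%N by rewrite /one eqxx.
    have oi : one i = 0%N by rewrite /one eq_sym (negPf ki).
    rewrite /D E1 Te ?one1 // ok /= [T i (e one)]Te ?one1 // oi /= T0 subr0.
    by congr (T i (e _)); apply/funext => l; rewrite /dec_at /one subnn.
  have <- : D h = T i (e (fun=> 0%N)).
    rewrite /h (linD lD) Du addr0 (lin_sum lD) (bigD1 k) //= Dk.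
    by rewrite big1 ?addr0.
  by apply: (lin_closedB cZ.1); exact: (ZT _ _ (ZT _ _ (ZT _ _ Zh))).
suff eZ : range e `<=` Z.
  by move=> x; exact: (cspan_min cZ eZ (@te x)).
move=> _ [n _ <-]; apply: (closed_limit cZ) => eps eps0.
have [N hN] := pow2V_small eps0.
pose i := (N + (\sum_j n j) + 2)%N.
have i_lt : (\sum_j n j + d * 2 ^ i.+1 < d * 2 ^ i.+2)%N.
  rewrite [(2 ^ i.+2)%N]expnS mulnCA mul2n -addnn ltn_add2r.
  apply: leq_trans (leq_pmull _ d0); apply: leq_ltn_trans (ltn_expl i.+1 (ltnSn 1)).
  by rewrite /i -addnA addnCA -addnS leq_addr.
have two_lt : (\sum_j n j + 2 < d * 2 ^ i.+2)%N.
  apply: leq_trans (leq_pmull _ d0); apply: leq_ltn_trans (ltn_expl i.+2 (ltnSn 1)).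
  rewrite /i -addnA.
  exact: leq_trans (leq_addl N _) (leq_trans (leqnSn _) (leqnSn _)).
have n_lam j : (n j <= lam i j)%N.
  apply: (@leq_trans (\sum_j n j)); first by rewrite (bigD1 j) //= leq_addr.
  rewrite /lam; apply: leq_trans (ltnW (ltn_expl i.+2 (ltnSn 1))).
  by rewrite /i -addnA addnCA -!addnS leq_addr.
(* Lowering lam_i along this word gives n. *)
pose w : seq 'I_d := flatten [seq nseq (lam i j - n j) j | j <- enum 'I_d].
have cw j : count_mem j w = (lam i j - n j)%N.
  rewrite /w count_flatten -map_comp sumnE big_map big_enum /= (bigD1 j) //=.
  rewrite count_nseq /= eqxx mul1n big1 ?addn0 // => k kj.
  by rewrite count_nseq /= (negPf kj).
have sw : size w = (d * 2 ^ i.+2 - \sum_j n j)%N.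
  rewrite -sum_count_mem -sum_lam -sumnB //.
  by apply: eq_bigr => j _; rewrite cw.
have [r [hE rle]] : exists r, h = \sum_j e (dbl j) +
    (\sum_(k < i) eta k *: e (lam k) + eta i *: e (lam i) + r) /\
    `|r| <= eta i * (2 ^+ i)^-1.
  exists (u - \sum_(k < i.+1) eta k *: e (lam k)); split; last exact: tail.
  by rewrite /h; congr (_ + _); rewrite big_ord_recr /= [RHS]addrC subrK.
have lw : linear (word_op T w) by case: (word_op_bounded w bT).
have E1 : word_op T w (e (lam i)) = e n.
  rewrite word_op_sub => [|j]; last by rewrite cw leq_subr.
  by congr e; apply/funext => j; rewrite cw subKn.
have past m : (\sum_j m j < size w)%N -> Z (word_op T w (e m)).
  by move=> hm; apply: (word_op_past d0 _ ZT Ze0 hm); case: cZ.1.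
have Zsum : Z (e n + (eta i)^-1 *: word_op T w r).
  have -> : e n + (eta i)^-1 *: word_op T w r = (eta i)^-1 *: (word_op T w h -
     \sum_j word_op T w (e (dbl j)) - \sum_(k < i) eta k *: word_op T w (e (lam k))).
    rewrite hE !(linD lw) !(lin_sum lw) (linZ lw) E1.
    under [X in _ + (X + _ + _)]eq_bigr do rewrite (linZ lw).
    set A := \sum_j word_op T w (e (dbl j)).
    set B := \sum_(k < i) eta k *: word_op T w (e (lam k)).
    have -> : A + (B + eta i *: e n + word_op T w r) - A - B =
        eta i *: e n + word_op T w r.
      apply/eqP; rewrite !subr_eq addrC; apply/eqP; congr (_ + _).
      by rewrite -addrA addrC.
    by rewrite scalerDr scalerA mulVf ?scale1r // gt_eqF.
  apply: (lin_closedZ _ cZ.1); apply: (lin_closedB cZ.1).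
    apply: (lin_closedB cZ.1); first exact: orbit_span_word.
    apply: lin_closed_sum => [|j _]; first exact: cZ.1.
    apply: past; rewrite sum_dbl sw.
    by rewrite ltn_subRL.
  apply: lin_closed_sum => [|k _]; first exact: cZ.1.
  apply: (lin_closedZ _ cZ.1); apply: past; rewrite sum_lam sw ltn_subRL.
  apply: leq_ltn_trans i_lt; rewrite leq_add2l leq_mul2l leq_exp2l // ltnS.
  by rewrite (ltn_ord k) orbT.
exists (e n + (eta i)^-1 *: word_op T w r) => //.
rewrite opprD addrA subrr add0r normrN normrZ normfV gtr0_norm //.
rewrite mulrC ltr_pdivrMr // (le_lt_trans (word_op_le _ _)) //.
rewrite (le_lt_trans rle) // mulrC ltr_pM2r // hN //.
by rewrite /i -addnA leq_addr.
Qed.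

End Cyclic.

Section CyclicOne.
Context {R : realType} {H : hilbertType R}.
Variables (T : H -> H) (e : nat -> H).
Hypothesis lT : linear T.
Hypothesis iT : forall x y, inner (T x) (T y) = inner x y.
Hypothesis Te : forall n, T (e n.+1) = e n.
Hypothesis te : forall x, closure (span (range (fun n => e n.+1))) x.

Let f n := iter n T (e 0%N).

Let iter_iso m x y : inner (iter m T x) (iter m T y) = inner x y.
Proof. by elim: m => [|m IH] //=; rewrite iT. Qed.

Let iter_lin m : linear (iter m T).
Proof. by elim: m => [|m IH] // a x y; rewrite !iterS IH lT. Qed.

Let iter_e m n : iter m T (e (m + n)%N) = e n.
Proof. by elim: m => [|m IH] //; rewrite iterSr addSn Te. Qed.

(* The Gram matrix is Toeplitz, so conjugating the coefficients turns
   combinations of the e_k isometrically into combinations of the T^k e_0. *)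
Let gram k l : inner (f k) (f l) = inner (e l) (e k).
Proof.
wlog kl : k l / (k <= l)%N.
  move=> h; have [/h //|/ltnW/h] := leqP k l.
  by move=> hh; rewrite innerC hh -innerC.
have iter_e0 m : iter m T (e m) = e 0%N by rewrite -[X in e X]addn0 iter_e.
rewrite -(subnKC kl); move: (l - k)%N => m; rewrite /f iterD iter_iso.
by rewrite -(iter_iso k (e (k + m)%N)) iter_e iter_e0 -(iter_iso m (e m)) iter_e0.
Qed.

(** In one variable e_0 itself is cyclic.  Since e_0 is a limit of combinations
    of the e_k with k >= 1, conjugating the coefficients ([gram]) makes it a
    limit of combinations of the T^k e_0 with k >= 1.  Pulling this back by the
    isometry T^m approximates e_m by vectors e_i with i < m and vectors
    T^i e_0, so induction applies. *)
Lemma cyclic_shift_1 x : closure (span (range f)) x.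
Proof.
have cZ := cspan_closed (range f).
have e0E : f 0%N = e 0%N by [].
suff eZ m : closure (span (range f)) (e m).
  by apply: (cspan_min cZ _ (@te x)) => _ [n _ <-]; exact: eZ.
elim/ltn_ind: m => -[_|m IH]; first by apply: cspan_in; exists 0%N.
apply: (closed_limit cZ) => eps eps0.
have /closureNP/(_ eps eps0)[_ [n [c [a [Ga ->]]]] lt1] := @te (e 0%N).
have /choice[k hk] : forall i, exists k, a i = e k.+1.
  by move=> i; have [k _ <-] := Ga i; exists k.
(* The preimage of [f (k i).+1] under T^(m+1). *)
pose g (i : 'I_n) := if (k i <= m)%N then e (m - k i)%N else f (k i - m.+1).+1.
have gE i : iter m.+1 T (g i) = f (k i).+1.
  rewrite /g; case: ifP => [km|/negbT]; last first.
    by rewrite -ltnNge => mk; rewrite /f -iterD addnS subnKC.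
  have -> : m.+1 = ((k i).+1 + (m - k i))%N by rewrite addSn subnKC.
  by rewrite iterD -[X in e X]addn0 iter_e.
exists (\sum_i (c i)^* *: g i).
  apply: lin_closed_sum => [|i _]; first exact: cZ.1.
  apply: (lin_closedZ _ cZ.1); rewrite /g; case: ifP => km.
    by apply: IH; rewrite ltnS leq_subr.
  by apply: cspan_in; exists (k i - m.+1).+1.
have nT y : `|iter m.+1 T y| = `|y| by apply: isometry_norm; exact: iter_iso.
rewrite -nT (linB (@iter_lin m.+1)) (lin_sum (@iter_lin m.+1)).
have -> : iter m.+1 T (e m.+1) = e 0%N by rewrite -[X in e X]addn0 iter_e.
under eq_bigr do rewrite (linZ (@iter_lin m.+1)) gE.
suff -> : `|e 0%N - \sum_i (c i)^* *: f (k i).+1| = `|e 0%N - \sum_i c i *: a i| by [].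
apply/eqP; rewrite -(eqrXn2 (n := 2)) ?normr_ge0 // !inner_normE; apply/eqP.
have -> : \sum_i c i *: a i = \sum_i c i *: e (k i).+1.
  by apply: eq_bigr => i _; rewrite hk.
set x1 := \sum_i (c i)^* *: f (k i).+1; set x2 := \sum_i c i *: e (k i).+1.
have h1 : inner (e 0%N) x1 = inner x2 (e 0%N).
  rewrite inner_sumr inner_suml; apply: eq_bigr => i _.
  by rewrite innerZr innerZl conjCK -{1}e0E gram.
have h3 : inner x1 x1 = inner x2 x2.
  rewrite /x1 !inner_suml; under eq_bigr do rewrite inner_sumr.
  rewrite exchange_big; apply: eq_bigr => i _; rewrite inner_sumr.
  apply: eq_bigr => j _; rewrite !innerZl !innerZr conjCK gram.
  by rewrite !mulrA [(c j)^* * _]mulrC.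
rewrite !innerBl !innerBr h1 h3 (innerC x1) h1 -innerC; ring.
Qed.
End CyclicOne.

Lemma cyclic_shift (R : realType) (d : nat) (H : hilbertType R)
    (T : 'I_d -> H -> H) (e : ('I_d -> nat) -> H) : (0 < d)%N ->
  (forall j, bounded_op (T j)) ->
  (forall x y, \sum_j inner (T j x) (T j y) = inner x y) ->
  (forall j n, (0 < \sum_i n i)%N ->
     T j (e n) = if (0 < n j)%N then e (dec_at j n) else 0) ->
  (forall x, closure (span [set e n | n in [set n | (0 < \sum_i n i)%N]]) x) ->
  exists h, forall x, orbit_span T h x.
Proof.
case: d T e => [|[|d]] // T e _ bT iT Te te.
  exists (e (fun=> 0%N)) => x; pose e' n := e (fun=> n).
  have Tw w y : word_op T w y = iter (size w) (T ord0) y.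
    by elim: w => [|j w IH] //=; rewrite IH (ord1 j).
  have cZ := cspan_closed (range (fun n => iter n (T ord0) (e' 0%N))).
  have sZ : range (fun n => iter n (T ord0) (e' 0%N)) `<=`
      orbit_span T (e (fun=> 0%N)).
    move=> _ [n _ <-]; apply: cspan_in; exists (nseq n ord0) => //.
    by rewrite Tw size_nseq.
  apply: (cspan_min (cspan_closed _) sZ); apply: cyclic_shift_1.
  - exact: (bT ord0).1.
  - by move=> y z; rewrite -[RHS]iT big_ord1.
  - move=> n; rewrite /e' Te; last by rewrite big_ord1.
    rewrite /=; congr e; apply/funext => i.
    by rewrite /dec_at (ord1 i) eqxx subn1.
  - move=> y; apply: (cspan_min (cspan_closed _) _ (@te y)) => _ [n n0 <-].
    apply: cspan_in; exists (n ord0).-1 => //; rewrite /e' prednK.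
      by congr e; apply/funext => i; rewrite (ord1 i).
    by move: n0; rewrite /= big_ord1.
apply: (@cyclic_shift_gt1 _ _ _ T e) => //.
  move=> j x; rewrite -(ler_pXn2r (n := 2)) ?nnegrE ?normr_ge0 // !inner_normE.
  rewrite -[leRHS]iT (bigD1 j) //= lerDl; apply: sumr_ge0 => i _.
  exact: inner_ge0.
move=> x; apply: (cspan_min (cspan_closed _) _ (@te x)) => _ [n _ <-].
by apply: cspan_in; exists n.
Qed.

(** * Minimal isometric dilations *)

Section Dilations.
Context {R : realType} {d : nat} {H : hilbertType R}.
Variable T : 'I_d -> H -> H.

Lemma dilation_compress (K : hilbertType R) (J : H -> K) (V : 'I_d -> K -> K) :
  minimal_isometric_dilation T J V ->
  forall v h k, inner (J h) (word_op V v (J k)) = inner h (word_op T v k).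
Proof.
move=> [[bT _] [_ iJ] [bV _] VJ _]; elim=> [|j v IH] h k /=; first exact: iJ.
rewrite -adjPl // -[adj (V j) (J h)]/((adj (V j) \o J) h) VJ /= IH.
by rewrite adjPl.
Qed.

(** Peel off equal first letters with V_i^* V_j = delta_ij until one of the two
    words is empty; then [dilation_compress] expresses the inner product through
    T alone. *)
Lemma dilation_gram (K K' : hilbertType R) (J : H -> K) (V : 'I_d -> K -> K)
    (J' : H -> K') (V' : 'I_d -> K' -> K') :
  minimal_isometric_dilation T J V -> minimal_isometric_dilation T J' V' ->
  forall w v h k, inner (word_op V w (J h)) (word_op V v (J k)) =
    inner (word_op V' w (J' h)) (word_op V' v (J' k)).
Proof.
move=> hV hV'; elim=> [|i w IH] [|j v] h k.
- by rewrite !(dilation_compress hV) !(dilation_compress hV').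
- by rewrite !(dilation_compress hV) !(dilation_compress hV').
- by rewrite innerC (dilation_compress hV) -(dilation_compress hV') -innerC.
have [_ _ [bV oV] _ _] := hV; have [_ _ [bV' oV'] _ _] := hV'.
rewrite /= (adjP (bV i)) (adjP (bV' i)).
rewrite -[adj _ (V j _)]/((adj (V i) \o V j) _) oV.
rewrite -[adj _ (V' j _)]/((adj (V' i) \o V' j) _) oV'.
by rewrite !fctE !innerZr IH.
Qed.

Lemma dilation_unique (K K' : hilbertType R) (J : H -> K) (V : 'I_d -> K -> K)
    (J' : H -> K') (V' : 'I_d -> K' -> K') :
  minimal_isometric_dilation T J V -> minimal_isometric_dilation T J' V' ->
  unitarily_equivalent V V'.
Proof.
move=> hV hV'; have [_ _ [bV _] _ /dense_closure tV] := hV.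
have [_ _ [bV' _] _ /dense_closure tV'] := hV'.
have [W [lW iW WE]] := gram_isometry (fun wh vk : seq 'I_d * H =>
  dilation_gram hV hV' wh.1 vk.1 wh.2 vk.2) tV.
exists W; split.
  apply: (isometry_unitary lW iW tV') => _ [wh _ <-].
  by exists (word_op V wh.1 (J wh.2)).
move=> j; have bW := isometry_bounded lW iW.
apply: (bounded_eq _ _ tV); [exact: bounded_comp|exact: bounded_comp|].
move=> _ [[w h] _ <-] /=.
by rewrite (WE (w, h)) -[V j _]/(word_op V (j :: w) (J h)) (WE (j :: w, h)).
Qed.
End Dilations.

(** * The free disk algebra *)

Section FreeAlgebra.
Context {R : realType} {d : nat} (F : fock R d).
Local Notation C := R[i].
Local Notation L := (@fock_L R d F).
Local Notation GA := (range (word_op L)).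

Lemma GA_bounded : GA `<=` [set T | bounded_op T].
Proof. by move=> _ [w _ <-]; apply: word_op_bounded; exact: fock_L_bounded. Qed.

Lemma GA_id : GA id. Proof. by exists [::]. Qed.

Lemma GA_GG p q : GA p -> GA q -> adj_sums (span GA) (adj q \o p).
Proof.
move=> [w _ <-] [v _ <-] {p q}.
have lE := adj_sums_lin (span_lin GA) (spanG_bounded GA_bounded).
have bw u : bounded_op (word_op L u) by apply: GA_bounded; exists u.
have a0 : adj (0 : F -> F) = 0.
  by apply: adj_unique => x y; rewrite !fun0E inner0l inner0r.
elim: v w => [|i v IH] w.
  rewrite adj_id; exists (word_op L w), 0; split; last by rewrite a0 addr0.
    by apply: span_in; exists w.
  exact: (span_lin GA).1.
case: w => [|j w].
  exists 0, (word_op L (i :: v)); split; last by rewrite add0r.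
    exact: (span_lin GA).1.
  by apply: span_in; exists (i :: v).
rewrite (_ : _ \o _ = (i == j)%:R *: (adj (word_op L v) \o word_op L w)).
  exact: (lin_closedZ _ lE).
apply/funext => x; rewrite /= adj_comp //; last exact: fock_L_bounded.
by rewrite /= adj_LL (linZ (adj_bounded_op (bw v)).1).
Qed.

Lemma span_GA_comp p q : span GA p -> span GA q -> span GA (p \o q).
Proof.
move=> Gp [n [c [a [Ga ->]]]]; have bp := spanG_bounded GA_bounded Gp.
pose N := [set r : F -> F | forall g, GA g -> span GA (r \o g)].
have lN : linear_closed N.
  split=> [g Gg|x r s hr hs g Gg]; first exact: (span_lin GA).1.
  exact: ((span_lin GA).2 x (r \o g) (s \o g) (hr g Gg) (hs g Gg)).
have sN : GA `<=` N.
  move=> _ [w _ <-] _ [v _ <-]; apply: span_in; exists (w ++ v) => //.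
  by apply/funext => x; rewrite word_op_cat.
have hp := span_min lN sN Gp.
rewrite (_ : _ \o _ = \sum_i c i *: (p \o a i)).
  apply: lin_closed_sum => [|i _]; first exact: span_lin.
  by apply: lin_closedZ; [exact: span_lin|exact: hp].
apply/funext => x /=; rewrite !fct_sumE (lin_sum bp.1).
by apply: eq_bigr => i _; rewrite (linZ bp.1).
Qed.

Lemma norm_closure_comp p q : norm_closure (span GA) p ->
  norm_closure (span GA) q -> norm_closure (span GA) (p \o q).
Proof.
move=> Mp Mq eps e0.
have aux (a k y : C) : 0 <= a -> 0 <= k -> 0 <= y -> a / (k + 1) * (k * y) <= a * y.
  move=> a0 k0 y0; have -> : a / (k + 1) * (k * y) = a * y * (k / (k + 1)) by ring.
  by rewrite ler_piMr ?mulr_ge0 // ler_pdivrMr ?ltr_wpDl // mul1r lerDl.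
have bM := ncG_bounded GA_bounded.
have /bounded_opP[lp [kp [kp0 hp]]] := bM _ Mp.
have /bounded_opP[lq [kq [kq0 hq]]] := bM _ Mq.
have k1 : 0 < kq + 1 by rewrite ltr_wpDl.
have [p' Gp' pp'] := Mp _ (divr_gt0 (ltC_half e0) k1).
have /bounded_opP[lp' [kp' [kp0' hp']]] := spanG_bounded GA_bounded Gp'.
have k1' : 0 < kp' + 1 by rewrite ltr_wpDl.
have [q' Gq' qq'] := Mq _ (divr_gt0 (ltC_half e0) k1').
exists (p' \o q'); first exact: span_GA_comp.
move=> x /=; rewrite -(subrK (p' (q x)) (p (q x))) -addrA -(linB lp').
rewrite (le_trans (ler_normD _ _)) // [eps]splitr mulrDl lerD //.
  rewrite (le_trans (pp' _)) // (le_trans _ (aux _ _ _ (ltW (ltC_half e0)) kq0 (normr_ge0 x))) //.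
  by rewrite ler_wpM2l // ltW // divr_gt0 // ltC_half.
rewrite (le_trans (hp' _)) // (le_trans (ler_wpM2l kp0' (qq' _))) //.
by rewrite mulrCA aux // ltW // ltC_half.
Qed.

(** The norm closure of the span of the words is stable under products. *)
Lemma ncAE : ncA F = norm_closure (span GA).
Proof.
apply/seteqP; split.
  apply: smallest_sub; last first.
    move=> T [->|[j _ <-]]; apply: norm_closure_in; apply: span_in.
      exact: GA_id.
    by exists [:: j].
  have bM := ncG_bounded GA_bounded.
  split; first exact: ncG_lin.
    exact: norm_closure_comp.
  exact: norm_closureK.
move=> T hT M [[lM cM nM] GM]; apply: (nM); apply: norm_closure_mono hT.
apply: span_min => // _ [w _ <-]; elim: w => [|j w IH].
  by apply: GM; left.
by apply: cM => //; apply: GM; right; exists j.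
Qed.

End FreeAlgebra.

(** * The dilation coming from an extended state *)

Section GnsDilation.
Context {R : realType} {d : nat} (F : fock R d).
Local Notation C := R[i].
Local Notation L := (@fock_L R d F).
Local Notation Lsym := (@Lsym R d F).
Local Notation polyS := (@polyS R d F).
Local Notation polyS0 := (@polyS0 R d F).
Local Notation GA := (range (word_op L)).
Local Notation ncA := (ncA F).
Local Notation ncS := (ncS F).

Variable mu : (F -> F) -> C.
Hypothesis smu : is_state ncS mu.
Variable P : gns_space ncS mu.
Hypothesis qe : quasi_extreme P.
Variable S : 'I_d -> P -> P.
Hypothesis hS : P2_gns_tuple S.
Hypothesis colS : forall x y, \sum_j inner (adj (S j) x) (adj (S j) y) = inner x y.

Local Notation e n := (gns_cls P (Lsym n)).

Lemma e_total (x : P) :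
  closure (span [set e n | n in [set n | (0 < \sum_i n i)%N]]) x.
Proof.
have cN := cspan_closed [set e n | n in [set n | (0 < \sum_i n i)%N]].
have : P2_0 (P:=P) x by rewrite qe.
apply: (cspan_min cN) => _ [_ [k [c [f [hf ->]]]] <-].
have Mf i : ncS (f i) by case: (hf i) => n _ <-; exact: Lsym_ncS.
rewrite (cls_sum (ncSE F)) => [|i]; last exact: (lin_closedZ _ (ncS_lin F)).
apply: lin_closed_sum => [|i _]; first exact: cN.1.
rewrite (clsZ (ncSE F)) //; apply: (lin_closedZ _ cN.1).
by have [n n0 <-] := hf i; apply: cspan_in; exists n.
Qed.

Lemma adjS_e j n : (0 < \sum_i n i)%N ->
  adj (S j) (e n) = if (0 < n j)%N then e (dec_at j n) else 0.
Proof.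
move=> n0; rewrite (adjS_polyS0 qe hS); last by apply: span_in; exists n.
by rewrite adj_L_Lsym //; case: ifP => // _; exact: (cls0 (ncSE F)).
Qed.

(** The adjoints of the GNS tuple act on the classes of the L^(n) as backward
    shifts, and their column is isometric. *)
Lemma adjS_cyclic : (0 < d)%N ->
  exists h, forall x, orbit_span (fun j => adj (S j)) h x.
Proof.
move=> d0; apply: (cyclic_shift (e := fun n => e n) d0) => //.
- by move=> j; apply: adj_bounded_op; exact: (S_bounded hS).
- exact: adjS_e.
- exact: e_total.
Qed.

Variable nu : (F -> F) -> C.
Hypothesis snu : is_state ncA nu.
Hypothesis ext : extends_state mu nu.
Variable G : gns_space ncA nu.
Variable U : 'I_d -> G -> G.
Hypothesis hU : gns_tuple U.
Local Notation clsG := (gns_cls G).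

Let bU j : bounded_op (U j). Proof. exact: (hU j).1. Qed.

Lemma word_ncA w : ncA (word_op L w).
Proof. by apply: (gns_in (ncAE F)); exists w. Qed.

Lemma polyS_ncA p : polyS p -> ncA p.
Proof.
move=> Sp; rewrite ncAE; apply: norm_closure_in; move: p Sp.
apply: span_min; first exact: span_lin.
move=> _ [n _ <-]; apply: lin_closed_sum => [|u _]; first exact: span_lin.
by apply: span_in; exists u.
Qed.

Lemma L_ncA j a : ncA a -> ncA (L j \o a).
Proof.
rewrite ncAE => Ma; apply: norm_closure_comp => //.
by apply/norm_closure_in/span_in; exists [:: j].
Qed.

Lemma clsG_total (x : G) : closure (span (clsG @` GA)) x.
Proof.
exact: (cls_total (@GA_bounded R d F) (@GA_id R d F) (@GA_GG R d F) (ncAE F) snu).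
Qed.

Lemma U_word w : word_op U w (clsG id) = clsG (word_op L w).
Proof.
elim: w => [|j w IH] //=; rewrite IH (hU j).2 //; exact: word_ncA.
Qed.

Lemma U_orthogonal : orthogonal_isometries U.
Proof.
have bA a : ncA a -> bounded_op a.
  by move=> Ma; apply: (gns_bounded (@GA_bounded R d F) (ncAE F)).
move=> i j.
apply: (bounded_eq _ _ (@clsG_total)).
- exact/bounded_comp/bU/adj_bounded_op/bU.
- have := (bounded_lin_closed G G).2 (i == j)%:R id 0 (bounded_id G) (bounded_lin_closed G G).1.
  by rewrite addr0.
move=> _ [a GAa <-]; have Ma : ncA a by exact: (gns_in (ncAE F)).
apply/eqP; rewrite -subr_eq0; apply/eqP.
apply: (total_orthogonal clsG_total) => _ [c GAc <-].
have Mc : ncA c by exact: (gns_in (ncAE F)).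
rewrite innerBl /= adjPl // !(hU _).2 // gns_cls_inner //; [|exact: L_ncA..].
rewrite !fctE -(clsZ (ncAE F)) // gns_cls_inner //; last first.
  exact: (lin_closedZ _ (gns_lin (ncAE F))).
rewrite adj_comp; [|exact: fock_L_bounded|exact: bA].
apply/eqP; rewrite subr_eq0; apply/eqP; congr nu; apply/funext => x /=.
by rewrite adj_LL.
Qed.

Lemma adjU j i y : adj (U j) (U i y) = (j == i)%:R *: y.
Proof. by rewrite -[LHS]/((adj (U j) \o U i) y) U_orthogonal. Qed.

Lemma clsG_polyS0 p : polyS0 p ->
  clsG p = \sum_i U i (clsG (adj (L i) \o p)).
Proof.
move=> Sp; have [h1 h2] := polyS0_rec Sp.
rewrite (eq_bigr (fun i => clsG (L i \o (adj (L i) \o p)))) => [|i _].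
  rewrite -(cls_sum (ncAE F)); last by move=> i; apply: L_ncA; apply: polyS_ncA; exact: h1.
  by congr clsG; apply/funext => x; rewrite fct_sumE h2.
by rewrite (hU i).2 //; exact: polyS_ncA.
Qed.

Lemma adjU_polyS0 j p : polyS0 p -> adj (U j) (clsG p) = clsG (adj (L j) \o p).
Proof.
move=> Sp; have lA := (adj_bounded_op (bU j)).1.
rewrite clsG_polyS0 // (lin_sum lA) (bigD1 j) //= adjU eqxx scale1r.
by rewrite big1 ?addr0 // => i ij; rewrite adjU eq_sym (negPf ij) scale0r.
Qed.

(** The extended state has the same values on the products of symmetric
    polynomials, so the two Gram matrices agree. *)
Lemma gns_embedding : exists J : P -> G, [/\ linear J,
  forall x y, inner (J x) (J y) = inner x y &
  forall p, polyS p -> J (gns_cls P p) = clsG p].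
Proof.
have gram n m : inner (e n) (e m) = inner (clsG (Lsym n)) (clsG (Lsym m)).
  have Mk k : ncS (Lsym k) by exact: Lsym_ncS.
  have Ak k : ncA (Lsym k) by apply: polyS_ncA; apply: span_in; exists k.
  rewrite !gns_cls_inner //.
  apply/esym/ext; apply: (opsys_mul (@GS_bounded R d F) (@Lsym_GG R d F));
    exact: Lsym_ncS.
have te (x : P) : closure (span (range (fun n => e n))) x.
  apply: (cspan_min (cspan_closed _) _ (@e_total x)) => _ [n _ <-].
  by apply: cspan_in; exists n.
have [J [lJ iJ JE]] := gram_isometry gram te; exists J; split=> //.
move=> p [k [c [f [hf ->]]]].
have Sf i : polyS (f i) by apply: span_in; exact: hf.
rewrite (cls_sum (ncSE F)) => [|i]; last by apply: (lin_closedZ _ (ncS_lin F)); exact: polyS_ncS.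
rewrite (cls_sum (ncAE F)) => [|i]; last first.
  by apply: (lin_closedZ _ (gns_lin (ncAE F))); exact: polyS_ncA.
rewrite (lin_sum lJ); apply: eq_bigr => i _.
rewrite (clsZ (ncSE F)); last exact: polyS_ncS.
rewrite (clsZ (ncAE F)); last exact: polyS_ncA.
by rewrite (linZ lJ); have [n _ <-] := hf i; rewrite JE.
Qed.

(** Minimality holds because the words applied to the class of I give all classes
    of words; coinvariance because U_j^* and S_j^* both send the class of a
    symmetric polynomial p without constant term to the class of L_j^* p, and
    such classes are dense in P when mu is quasi-extreme. *)
Lemma gns_dilation : exists J : P -> G,
  minimal_isometric_dilation S J U.
Proof.
have [J [lJ iJ JE]] := gns_embedding.
have bJ := isometry_bounded lJ iJ.
have JI : J (gns_cls P id) = clsG id by apply: JE; exact/span_in/id_polyS.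
have bS := S_bounded hS.
exists J; split=> //.
- split=> // x; rewrite -[X in inner X x]/(x - (\sum_j (S j \o adj (S j))) x).
  rewrite fct_sumE innerBl inner_suml -{1}colS.
  rewrite subr_ge0 le_eqVlt; apply/orP; left; apply/eqP.
  by apply: eq_bigr => j _; rewrite /= adjP.
- by split=> //; exact: U_orthogonal.
- move=> j; apply: (bounded_eq _ _ (@e_total)).
  + exact/bounded_comp/bJ/adj_bounded_op/bU.
  + exact/bounded_comp/adj_bounded_op/bS.
  move=> _ [n n0 <-] /=.
  have Sn : polyS0 (Lsym n) by apply: span_in; exists n.
  rewrite (adjS_polyS0 qe hS) // !JE; first exact: adjU_polyS0.
    by case: (polyS0_rec Sn).
  exact: polyS0_sub.
- apply/dense_closure => x.
  apply: (cspan_min (cspan_closed _) _ (@clsG_total x)) => _ [_ [w _ <-] <-].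
  apply: cspan_in; exists (w, gns_cls P id) => //=.
  by rewrite JI U_word.
Qed.

(** The ranges of the U_j span the classes of the nonempty words.  By
    quasi-extremality the class of I is a limit of classes of symmetric
    polynomials without constant term, so it belongs to their closed span
    too. *)
Lemma gns_cuntz : cuntz U.
Proof.
split; [exact: bU|exact: U_orthogonal|].
have [J [lJ iJ JE]] := gns_embedding.
pose Q : G -> G := \sum_j (U j \o adj (U j)).
have QE x : Q x = \sum_j U j (adj (U j) x) by rewrite /Q fct_sumE.
have bQ : bounded_op Q.
  suff : [set T : G -> G | bounded_op T] Q by [].
  apply: lin_closed_sum => [|j _]; first exact: bounded_lin_closed.
  exact/bounded_comp/adj_bounded_op/bU.
have QU j y : Q (U j y) = U j y.
  rewrite QE (bigD1 j) //= adjU eqxx scale1r big1 ?addr0 // => i ij.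
  by rewrite adjU (negPf ij) scale0r (lin0 (bU i).1).
have QJ : Q \o J = J.
  have bJ := isometry_bounded lJ iJ.
  apply: (bounded_eq _ bJ (@e_total)); first exact: bounded_comp.
  move=> _ [n n0 <-] /=.
  have Sn : polyS0 (Lsym n) by apply: span_in; exists n.
  rewrite JE; last exact: polyS0_sub.
  rewrite clsG_polyS0 // (lin_sum bQ.1); apply: eq_bigr => j _; exact: QU.
have Qid : Q (clsG id) = clsG id.
  have JI : J (gns_cls P id) = clsG id by apply: JE; exact/span_in/id_polyS.
  by rewrite -JI -[LHS]/((Q \o J) _) QJ.
apply: (bounded_eq bQ (bounded_id G) (@clsG_total)) => _ [_ [w _ <-] <-].
case: w => [|j w]; first exact: Qid.
by rewrite -[word_op _ _]/(L j \o word_op L w) -(hU j).2 ?QU //; exact: word_ncA.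
Qed.
End GnsDilation.

Theorem theorem5p1 (R : realType) (d : nat) (hd : (0 < d)%N) (F : fock R d)
  (H2 : rkhs (@cball R d) drury_arveson_kernel)
  (b : 'rV[R[i]]_d -> R[i])
  (hb : contractive_multiplier H2 b) (hb_nc : nonconstant b)
  (Hb : rkhs cball (db_kernel b))
  (mu : circle R -> (F -> F) -> R[i])
  (hmu : forall alpha : circle R, ac_state b alpha (mu alpha))
  (P : forall alpha, P2 (mu alpha))
  (hb_qe : quasi_extreme (P (circle1 R)))
  (X : 'I_d -> Hb -> Hb) (hX : gleason_contractive_solution X)
  (bs : 'I_d -> Hb) (hbs : gleason_functions X bs)
  (S : forall alpha, 'I_d -> P alpha -> P alpha)
  (hS : forall alpha, P2_gns_tuple (S alpha))
  (V : forall alpha, P alpha -> Hb)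
  (hV : forall alpha : circle R, fantappie alpha (V alpha)) :
  forall alpha : circle R,
  [/\ cyclic_tuple (perturbation X bs alpha),
      column_isometric (perturbation X bs alpha) &
      forall j, V alpha \o adj (S alpha j) = perturbation X bs alpha j \o V alpha]
  /\
  forall (nu : (F -> F) -> R[i]),
    is_state (ncA F) nu -> extends_state (mu alpha) nu ->
  forall (G : gns_space (ncA F) nu) (U : 'I_d -> G -> G), gns_tuple U ->
    cuntz U /\
    (exists (K : hilbertType R) (J : P alpha -> K) (W : 'I_d -> K -> K),
       minimal_isometric_dilation (S alpha) J W) /\
    (forall (K : hilbertType R) (J : P alpha -> K) (W : 'I_d -> K -> K),
       minimal_isometric_dilation (S alpha) J W -> unitarily_equivalent U W).
Proof.
have bX j : bounded_op (X j) by case: hX.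
have smu alpha : is_state (ncS F) (mu alpha) by case: (hmu alpha).
have total1 : forall f, closure (span (clark_diffs Hb 1)) f.
  exact: (quasi_extreme_clark hb_nc (normr1 _) (smu _) (hV (circle1 R))).1.
move=> alpha; have alpha1 := circle_norm alpha.
have colY := perturbation_isometric_all hb_nc bX hbs alpha1 total1.
have qe : quasi_extreme (P alpha).
  apply: (quasi_extreme_clark hb_nc alpha1 (smu _) (hV alpha)).2.
  exact: (clark_diffs_total hb_nc bX hbs alpha1 total1).
have VS := V_intertwines hb_nc alpha1 (smu _) (hV alpha) qe (hS alpha) bX hbs.
have [uV _] := hV alpha; have [lV iV _] := uV.
have bY := perturbation_bounded alpha bs bX.
have colS x y : \sum_j inner (adj (S alpha j) x) (adj (S alpha j) y) = inner x y.
  rewrite -[RHS]iV -((column_isometricP bY).1 colY).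
  apply: eq_bigr => j _; rewrite -iV.
  have VSx z : V alpha (adj (S alpha j) z) = perturbation X bs alpha j (V alpha z).
    by rewrite -[LHS]/((V alpha \o adj (S alpha j)) z) VS.
  by rewrite !VSx.
split.
  split=> //.
  have [h th] := adjS_cyclic qe (hS alpha) colS hd.
  exists (V alpha h); apply/dense_closure.
  have VE w : V alpha (word_op (fun j => adj (S alpha j)) w h) =
      word_op (perturbation X bs alpha) w (V alpha h).
    elim: w => [|j w IH] //=; rewrite -IH.
    by rewrite -[LHS]/((V alpha \o adj (S alpha j)) _) VS.
  have /(unitary_total _ uV) tV := th.
  move=> y; apply: (cspan_min (cspan_closed _) _ (@tV y)) => _ [_ [w _ <-] <-].
  by rewrite VE; apply: cspan_in; exists w.
move=> nu snu ext G U hU; split; first exact: (gns_cuntz qe snu ext hU).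
have [J hJ] := gns_dilation qe (hS alpha) colS snu ext hU.
split; first by exists G, J, U.
by move=> K J' W hW; exact: (dilation_unique hJ hW).
Qed.
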